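(* For all $q\in[1,\infty]$ and $\sigma,\beta\in(0,1)$ such that $$\frac{2\beta}{1-\sigma}<1-\Big(1-\frac2q-\frac1\infty\Big)(3-2)=\frac2q,$$ there exist $u\in L^\infty([0,1],B^{\sigma,\infty}_\infty(\mathbb T^2))$, $\mathbb R^2$-valued with $\nabla\cdot u=0$, and $\theta\in L^q([0,1],B^{\beta,q}_\infty(\mathbb T^2))$, real-valued, such that on $[0,1]\times\mathbb T^2$ $$\partial_t\theta+\nabla\cdot(u\theta)=0,$$ and the dissipation distribution associated to $(u,\theta)$, $$D:=\partial_t\theta^2+\nabla\cdot(u\theta^2),$$ satisfies: $D\neq0$ is a non-trivial negative Radon measure supported on $S:=\{1/2\}\times\mathbb T^2$, which has Hausdorff dimension $2$.
   Context: $\mathbb T^2$ is $[0,\sqrt2]\times[0,1]$ with periodic boundary. For $s\in(0,1)$ and $p\in[1,\infty]$, $\|f\|_{B^{s,p}_\infty(\mathbb T^2)}:=\sup_{\ell\in\mathbb T^2,\ \ell\ne0}|\ell|^{-s}\|f(\cdot+\ell)-f\|_{L^p(\mathbb T^2)}$, where $|\ell|$ is the distance of $\ell$ to $0$ in $\mathbb T^2$; $B^{s,p}_\infty(\mathbb T^2)$ is the space of $f\in L^p(\mathbb T^2)$ for which this is finite (componentwise for vector fields). The equation for $\theta$ and the definition of $D$ are understood in the sense of distributions on $(0,1)\times\mathbb T^2$ (in particular $u\theta$ and $u\theta^2$ are integrable). A measure $D$ is supported on $S$ if $D(A\cap S)=D(A)$ for all Borel sets $A$; negative means $-D$ is a nonnegative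 measure. *)

(* Defs.v *)
From HB Require Import structures.
From mathcomp Require Export all_boot all_order all_algebra.
From mathcomp Require Export all_classical all_reals all_analysis.
Export Order.TTheory GRing.Theory Num.Theory.
Export numFieldNormedType.Exports.

Set Implicit Arguments.
Unset Strict Implicit.
Unset Printing Implicit Defensive.

Local Open Scope classical_set_scope.
Local Open Scope ring_scope.

(** * The torus [0, sqrt 2] x [0, 1] with periodic boundary

   Functions on the torus are periodic functions on R * R, and the torus as a
   measurable space is the fundamental domain [cell]. *)

Definition cell (R : realType) : set (R * R) :=
  `[0, Num.sqrt 2[%classic `*` `[0, 1[%classic.

Definition shift (R : realType) (k : int * int) (x : R * R) : R * R :=
  (x.1 + Num.sqrt 2 * k.1%:~R, x.2 + k.2%:~R).

Definition periodic (R : realType) (f : R * R -> R) : Prop :=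
  forall k x, f (shift k x) = f x.

(* Euclidean distance to the lattice, i.e. the distance to 0 in the torus. *)
Definition torus_norm (R : realType) (l : R * R) : R :=
  inf [set Num.sqrt ((shift k l).1 ^+ 2 + (shift k l).2 ^+ 2) | k in setT].

Definition lattice (R : realType) : set (R * R) :=
  [set shift k (0, 0) | k in setT].

(* R * R and R * (R * R) with the Borel sigma-algebra carrying the library's
   Lebesgue measure. *)
Notation plane R := (measurableTypeR R * measurableTypeR R)%type.
Notation R_plane R :=
  (measurableTypeR R * (measurableTypeR R * measurableTypeR R))%type.

Definition leb2 (R : realType) : set (plane R) -> \bar R :=
  ((@lebesgue_measure R) \x (@lebesgue_measure R))%E.

HB.instance Definition _ (R : realType) := Measure.on (@leb2 R).

Lemma leb2_sigma_finite (R : realType) : sigma_finite setT (@leb2 R).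
Proof.
have /sigma_finiteP[F [TF ndF Foo]] := sigma_finiteT (@lebesgue_measure R).
exists (fun n => F n `*` F n).
  rewrite -setXTT TF predeqE => -[x y]; split.
    move=> [/= [n _ Fnx] [k _ Fky]]; exists (maxn n k) => //; split.
    - by move: x Fnx; exact/subsetPset/ndF/leq_maxl.
    - by move: y Fky; exact/subsetPset/ndF/leq_maxr.
  by move=> [n _ []/= ? ?]; split; exists n.
move=> k; have [? ?] := Foo k.
split; first exact: measurableX.
by rewrite /leb2 product_measure1E// lte_mul_pinfty// ge0_fin_numE.
Qed.

HB.instance Definition _ (R : realType) :=
  Measure_isSigmaFinite.Build _ _ _ (@leb2 R) (@leb2_sigma_finite R).

Definition leb3 (R : realType) : set (R_plane R) -> \bar R :=
  ((@lebesgue_measure R) \x (@leb2 R))%E.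

HB.instance Definition _ (R : realType) := Measure.on (@leb3 R).

(** * Besov spaces B^{s,p}_oo of the torus *)

Definition torus_Lnorm (R : realType) (p : \bar R) (f : R * R -> R) : \bar R :=
  Lnorm (@leb2 R) p (EFin \o f \_ (@cell R)).

Definition besov_seminorm (R : realType) (s : R) (p : \bar R)
    (f : R * R -> R) : \bar R :=
  ereal_sup
    [set ((torus_norm l `^ (- s))%:E
            * torus_Lnorm p (fun x => (f (x.1 + l.1, x.2 + l.2) - f x)%R))%E
    | l in ~` @lattice R].

(* [besov_seminorm] vanishes on constants; the L^p norm is added to get the
   Banach space norm of B^{s,p}_oo. *)
Definition besov_norm (R : realType) (s : R) (p : \bar R)
    (f : R * R -> R) : \bar R :=
  (torus_Lnorm p f + besov_seminorm s p f)%E.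

Definition besov (R : realType) (s : R) (p : \bar R) : set (R * R -> R) :=
  [set f | [/\ measurable_fun [set: plane R] f, periodic f,
     (torus_Lnorm p f < +oo)%E & (besov_seminorm s p f < +oo)%E]].

(** * Bochner spaces L^q([0, 1], B^{s,p}_oo) *)

Definition besov_simple (R : realType) (s : R) (p : \bar R)
    (g : R -> R * R -> R) : Prop :=
  exists n (A : 'I_n -> set (measurableTypeR R)) (c : 'I_n -> R * R -> R),
    [/\ forall i, measurable (A i), forall i, besov s p (c i) &
        forall t x, g t x = \sum_(i < n) \1_(A i) t * c i x].

Definition strongly_measurable (R : realType) (s : R) (p : \bar R)
    (f : R -> R * R -> R) : Prop :=
  exists2 g : nat -> R -> R * R -> R,
    forall n, besov_simple s p (g n) &
    {ae @lebesgue_measure R, forall t, `[0, 1]%classic t ->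
       besov_norm s p (fun x => f t x - g n t x) @[n --> \oo] --> 0%E}.

(* Elements are given by a representative that is jointly measurable in time
   and space, so that it can be integrated over space-time. *)
Definition Lq_besov (R : realType) (q : \bar R) (s : R) (p : \bar R)
    (f : R -> R * R -> R) : Prop :=
  [/\ measurable_fun [set z : R_plane R | 0 <= z.1 <= 1]
        (fun z => f z.1 z.2),
      {ae @lebesgue_measure R, forall t, `[0, 1]%classic t -> besov s p (f t)},
      strongly_measurable s p f &
      (Lnorm (@lebesgue_measure R) q
         ((fun t => besov_norm s p (f t)) \_ `[0%R, 1%R]%classic) < +oo)%E].

(** * Distributions on (0, 1) x torus *)

Definition spacetime (R : realType) : set (R * (R * R)) :=
  `]0, 1[%classic `*` @cell R.

Definition basis_vec (R : realType) (i : 'I_3) : R * (R * R) :=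
  ((i == 0 :> nat)%:R, ((i == 1 :> nat)%:R, (i == 2 :> nat)%:R)).

Definition partial (R : realType) (i : 'I_3) (f : R * (R * R) -> R) :
    R * (R * R) -> R := 'D_(basis_vec R i) f.

Fixpoint is_Ck (R : realType) (k : nat) (f : R * (R * R) -> R) : Prop :=
  continuous f /\
  if k is k'.+1 then
    forall i : 'I_3, (forall z, derivable f z (basis_vec R i)) /\
                     is_Ck k' (partial i f)
  else True.

Definition test_function (R : realType) (phi : R * (R * R) -> R) : Prop :=
  [/\ forall k, is_Ck k phi,
      forall t, periodic (fun x => phi (t, x)) &
      exists a b : R, [/\ 0 < a, b < 1 &
        forall t x, ~~ (a <= t <= b) -> phi (t, x) = 0]].

Definition d_t (R : realType) (phi : R * (R * R) -> R) : R * (R * R) -> R :=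
  partial (inord 0) phi.

Definition u_dot_grad (R : realType) (u : R -> R * R -> R * R)
    (phi : R * (R * R) -> R) (z : R * (R * R)) : R :=
  (u z.1 z.2).1 * partial (inord 1) phi z
  + (u z.1 z.2).2 * partial (inord 2) phi z.

Definition div_free (R : realType) (u : R -> R * R -> R * R) : Prop :=
  forall phi, test_function phi ->
    \int[@leb3 R]_(z in @spacetime R) (u_dot_grad u phi z) = 0.

Definition st_integrable (R : realType) (f : R -> R * R -> R) : Prop :=
  (@leb3 R).-integrable (@spacetime R)
    (fun z => (f z.1 z.2)%:E).

(* [transport u g] is the distribution d_t g + div (u g). *)
Definition transport (R : realType) (u : R -> R * R -> R * R)
    (g : R -> R * R -> R) (phi : R * (R * R) -> R) : R :=
  - \int[@leb3 R]_(z in @spacetime R)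
      (g z.1 z.2 * (d_t phi z + u_dot_grad u phi z)).

(* d_t g and div (u g) make sense as distributions. *)
Definition transport_defined (R : realType) (u : R -> R * R -> R * R)
    (g : R -> R * R -> R) : Prop :=
  [/\ st_integrable g,
      st_integrable (fun t x => (u t x).1 * g t x) &
      st_integrable (fun t x => (u t x).2 * g t x)].

Definition solves_transport (R : realType) (u : R -> R * R -> R * R)
    (theta : R -> R * R -> R) : Prop :=
  transport_defined u theta /\
  forall phi, test_function phi -> transport u theta phi = 0.

Definition dissipation (R : realType) (u : R -> R * R -> R * R)
    (theta : R -> R * R -> R) : (R * (R * R) -> R) -> R :=
  transport u (fun t x => theta t x ^+ 2).

(* Nonnegative Radon measures on (0, 1) x torus, as Borel measures of the
   ambient space carried by [spacetime]; local finiteness suffices for inner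
   regularity. *)
Definition is_Radon (R : realType)
    (nu : {measure set (R_plane R) -> \bar R}) : Prop :=
  nu (~` @spacetime R) = 0%E /\
  forall a b : R, 0 < a -> b < 1 ->
    (nu (`[a, b]%classic `*` @cell R) < +oo)%E.

Definition supported_on (R : realType)
    (nu : {measure set (R_plane R) -> \bar R}) (S : set (R * (R * R))) :
    Prop :=
  forall A : set (R_plane R), measurable A -> nu (A `&` S) = nu A.

Definition negative_Radon_supported_on (R : realType)
    (D : (R * (R * R) -> R) -> R) (S : set (R * (R * R))) : Prop :=
  exists nu : {measure set (R_plane R) -> \bar R},
    [/\ is_Radon nu,
        forall phi, test_function phi ->
          D phi = - \int[nu]_(z in @spacetime R) phi z &
        supported_on nu S].

Definition nonzero_distribution (R : realType)
    (D : (R * (R * R) -> R) -> R) : Prop :=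
  exists2 phi, test_function phi & D phi <> 0.

(** * Hausdorff dimension *)

Definition ediam (R : realType) (T : Type) (dist : T -> T -> R) (U : set T) :
    \bar R :=
  ereal_sup (0%E |` [set (dist z.1 z.2)%:E | z in U `*` U]).

Definition hausdorff_content (R : realType) (T : Type) (dist : T -> T -> R)
    (s delta : R) (A : set T) : \bar R :=
  ereal_inf [set (\sum_(0 <= i <oo) poweR (ediam dist (U i)) s)%E
    | U in [set U : nat -> set T | A `<=` \bigcup_i U i /\
                          forall i, (ediam dist (U i) <= delta%:E)%E]].

Definition hausdorff_measure (R : realType) (T : Type) (dist : T -> T -> R)
    (s : R) (A : set T) : \bar R :=
  ereal_sup [set hausdorff_content dist s delta A
            | delta in [set delta | 0 < delta]].

Definition hausdorff_dim (R : realType) (T : Type) (dist : T -> T -> R)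
    (A : set T) : \bar R :=
  ereal_inf [set s%:E
            | s in [set s | 0 < s /\ hausdorff_measure dist s A = 0%E]].

(* The distance of R x torus. *)
Definition spacetime_dist (R : realType) (z w : R * (R * R)) : R :=
  Num.sqrt ((z.1 - w.1) ^+ 2 +
    torus_norm (z.2.1 - w.2.1, z.2.2 - w.2.2) ^+ 2).

(* Main.v *)
From HB Require Import structures.
Require Import Defs.
From mathcomp Require Import measurable_realfun zify ring lra.

Set Implicit Arguments.
Unset Strict Implicit.
Unset Printing Implicit Defensive.

Local Open Scope classical_set_scope.
Local Open Scope ring_scope.

(** Before time 1/2 the scalar is the sign of a phase, and a divergence-free velocity winds it into
    finer and finer stripes, so that it tends weakly to 0 as t tends to 1/2; after 1/2 scalar and
    velocity are both 0. Weak convergence to 0 makes this extension a solution across t = 1/2.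
    Meanwhile theta^2 is 1 before time 1/2 and 0 after it, and the velocity is divergence free, so D
    is minus the area measure on the slice t = 1/2 ([theta_solves], [dissipation_theta]).

    The phase is k cos(a x) + cos(b y), or the same with the amplitude k on the other wave, where k
    moves between 0 and 1 during a stage. The velocity is a sum of two shear flows along the
    diagonals a x - b y = const and a x + b y = const, with a profile for which the material
    derivative of the phase equals the phase times a rate ([stripes_transport]). Hence the nodal
    lines move with the flow and the sign of the phase is transported. This is proved by smoothing
    the sign: the error involves v S'(v), S being the smoothed sign, which is bounded and tends to 0
    ([transport_sign]). At k = 1 the nodal lines cross and their topology changes. Four stages
    replace cos(b y) by cos(2 b y), and the side sqrt 2 of the torus makes the pattern self-similar.
    Consecutive stages agree at their common time ([phase_glue]), so the weak formulation telescopes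
    ([telescope]), and the last boundary term tends to 0 by oscillation ([cvg_slice_int0]).

    Stage n lasts about rho^n and has frequencies about gam^n, with gam = 2^(1/4) and rho = gam^(-(1
    - sigma)). The velocity is of size rho^(-n) gam^(-n) and its Lipschitz constant of size
    rho^(-n), up to powers of the distance [gap] to the change of topology. Interpolation gives a
    Hoelder norm of size rho^(-n) gam^(-n (1 - sigma)) = 1. The powers of [gap] do no harm because k
    is chosen flat of high order 2 g at k = 1 ([hoelder_rate], [hoelder_norm_le]).

    A translation by l changes the sign on a set of area at most C gam^n |l|, since a cosine plus a
    constant has at most one zero per half-period ([switch_measure], [jump_stripes]). So the Besov
    norm of order beta is at most C gam^(n beta), and its q-th power is integrable in time when rho
    gam^(beta q) < 1, that is beta q < 1 - sigma, which is the hypothesis ([besov_norm_theta],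
    [theta_time_norm]).

    Strong measurability in time follows from right continuity in Besov norm at almost every time.
    The dimension of the slice is 2 by a grid covering and the mass distribution principle
    ([hausdorff_dim_half]). *)

(** * Joint measurability of continuous functions *)

(** The continuous variable is rounded down to a grid of mesh 1/(n+1): the approximations are
    measurable on countably many strips and converge pointwise by continuity. *)
Lemma measurable_caratheodory d (T : measurableType d) (R : realType)
    (g : T -> R -> R) :
  (forall x, measurable_fun setT (g^~ x)) -> (forall t, continuous (g t)) ->
  measurable_fun [set: T * measurableTypeR R] (fun z => g z.1 z.2).
Proof.
move=> mg cg.
pose r n (x : R) : R := (Num.floor (x * n.+1%:R))%:~R / n.+1%:R.
apply: (@measurable_fun_cvg _ _ _ _ (fun n z => g z.1 (r n z.2))).
  move=> n; pose F (i : int) : set (T * measurableTypeR R) :=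
    setT `*` `[i%:~R / n.+1%:R, (i + 1)%:~R / n.+1%:R[%classic.
  have mF i : measurable (F i) by apply: measurableX => //; exact: measurable_itv.
  (* The integers are enumerated through [unpickle]; the default 0 only repeats a strip. *)
  have -> : [set: T * measurableTypeR R] =
      \bigcup_i F (if unpickle i is Some j then j else 0).
    apply/seteqP; split => // -[t x] _.
    exists (pickle (Num.floor (x * n.+1%:R))) => //.
    rewrite pickleK; split => //=; rewrite in_itv/=.
    by rewrite ler_pdivrMr// ltr_pdivlMr// floor_itv.
  apply/measurable_fun_bigcup; first by move=> i; exact: mF.
  move=> i; set j := (if _ is Some _ then _ else _).
  apply: (@eq_measurable_fun _ _ _ _ _ (fun z => g z.1 (j%:~R / n.+1%:R))).
    move=> [t x] /set_mem[_ /=]; rewrite in_itv/= => /andP[jx xj].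
    congr (g t _); rewrite /r; congr (_%:~R / _); apply/esym/eqP.
    by rewrite floor_eq -ler_pdivrMr// jx -ltr_pdivlMr.
  apply: measurable_funTS; exact: (measurableT_comp (mg _) measurable_fst).
move=> [t x] _ /=; apply: (@cvg_comp _ _ _ (r^~ x) (g t) _ (nbhs x) _ _ (cg t x)).
apply/cvgrPdist_le => e e0; near=> n.
have n0 : 0 < n.+1%:R :> R by [].
have /andP[h1] := floor_itv (x * n.+1%:R); rewrite intrD => h2.
have -> : x - r n x = (x * n.+1%:R - (Num.floor (x * n.+1%:R))%:~R) / n.+1%:R.
  by rewrite mulrBl mulfK ?gt_eqF.
rewrite ger0_norm ?divr_ge0 ?subr_ge0//; apply: (@le_trans _ _ n.+1%:R^-1).
  rewrite -[leRHS]mul1r ler_pM2r ?invr_gt0//.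
  by rewrite lerBlDl ltW.
near: n; have := near_infty_natSinv_lt (PosNum e0).
by apply: filterS => n /ltW.
Unshelve. all: by end_near. Qed.

Lemma continuous_mkpair (T1 T2 T3 : topologicalType) (f : T1 -> T2) (g : T1 -> T3) x :
  {for x, continuous f} -> {for x, continuous g} ->
  {for x, continuous (fun x => (f x, g x))}.
Proof. by move=> cf cg; exact: (cvg_pair cf cg). Qed.

Lemma continuous_pairl (T1 T2 T3 : topologicalType) (f : T1 * T2 -> T3) y :
  continuous f -> continuous (fun x => f (x, y)).
Proof.
move=> cf x; apply: (@continuous_comp _ _ _ (fun x => (x, y)) f x); last exact: cf.
by apply: continuous_mkpair => //; exact: cvg_cst.
Qed.

Lemma continuous_pairr (T1 T2 T3 : topologicalType) (f : T1 * T2 -> T3) x :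
  continuous f -> continuous (fun y => f (x, y)).
Proof.
move=> cf y; apply: (@continuous_comp _ _ _ (fun y => (x, y)) f y); last exact: cf.
by apply: continuous_mkpair => //; exact: cvg_cst.
Qed.

Lemma continuous_pairA (T1 T2 T3 T4 : topologicalType) (f : T1 * (T2 * T3) -> T4) :
  continuous f -> continuous (fun z : (T1 * T2) * T3 => f (z.1.1, (z.1.2, z.2))).
Proof.
move=> cf z.
apply: (@continuous_comp _ _ _ (fun z : (T1 * T2) * T3 => (z.1.1, (z.1.2, z.2))) f z); last exact: cf.
apply: continuous_mkpair.
  by apply: (@continuous_comp _ _ _ fst fst); exact: cvg_fst.
apply: continuous_mkpair; last exact: cvg_snd.
by apply: (@continuous_comp _ _ _ fst snd); [exact: cvg_fst|exact: cvg_snd].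
Qed.

(** Continuity refers to the product topology and measurability to the product sigma-algebra; the
    previous criterion passes from one to the other, one coordinate at a time. *)
Lemma measurable_continuous2 (R : realType) (f : R * R -> R) :
  continuous f -> measurable_fun [set: plane R] f.
Proof.
move=> cf.
apply: (@eq_measurable_fun _ _ _ _ _ (fun z : plane R => f (z.1, z.2))) => [[x y]//|].
apply: (@measurable_caratheodory _ (measurableTypeR R) R (fun x y => f (x, y))).
- by move=> y; apply: continuous_measurable_fun; exact: continuous_pairl.
- by move=> x; exact: continuous_pairr.
Qed.

Lemma measurable_continuous3 (R : realType) (f : R * (R * R) -> R) :
  continuous f -> measurable_fun [set: R_plane R] f.
Proof.
move=> /continuous_pairA cf.
have s : measurable_fun [set: R_plane R] (fun z : R_plane R => ((z.1, z.2.1) : plane R, z.2.2 : measurableTypeR R)).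
  apply: measurable_fun_pair; last exact: measurableT_comp measurable_snd measurable_snd.
  apply: measurable_fun_pair; first exact: measurable_fst.
  exact: measurableT_comp measurable_fst measurable_snd.
apply: (@eq_measurable_fun _ _ _ _ _ ((fun z : plane R * measurableTypeR R => f (z.1.1, (z.1.2, z.2))) \o
   (fun z : R_plane R => ((z.1, z.2.1) : plane R, z.2.2 : measurableTypeR R)))).
  by move=> [t [x y]].
apply: measurableT_comp s.
apply: (@measurable_caratheodory _ (plane R) R (fun w y => f (w.1, (w.2, y)))).
- by move=> y; apply: (@measurable_continuous2 R (fun w => f (w.1, (w.2, y)))); exact: (continuous_pairl cf).
- move=> w; exact: (continuous_pairr cf).
Qed.

Lemma ae_sub d (T : measurableType d) (R : realType) (mu : {measure set T -> \bar R})
    (P Q : T -> Prop) :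
  (forall x, P x -> Q x) -> {ae mu, forall x, P x} -> {ae mu, forall x, Q x}.
Proof. by move=> PQ; exact: filterS. Qed.

(** * Real-valued integrals of bounded functions: dominated convergence and Fubini *)

Section bounded_integrals.
Context d (T : measurableType d) (R : realType).
Variable mu : {measure set T -> \bar R}.

Lemma integrable_bounded (D : set T) (f : T -> R) (M : R) :
  measurable D -> (mu D < +oo)%E -> measurable_fun D f ->
  (forall x, D x -> `|f x| <= M) -> mu.-integrable D (EFin \o f).
Proof.
move=> mD fD mf fM; apply: measurable_bounded_integrable => //.
exists M; split; first by rewrite num_real.
by move=> y My x /fM /le_trans; apply; exact: ltW.
Qed.

Lemma cvg_Rintegral_bounded (D : set T) (f_ : nat -> T -> R) (f : T -> R) (M : R) :
  measurable D -> (mu D < +oo)%E -> (forall n, measurable_fun D (f_ n)) ->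
  measurable_fun D f -> (forall n x, D x -> `|f_ n x| <= M) ->
  {ae mu, forall x, D x -> f_ n x @[n --> \oo] --> f x} ->
  \int[mu]_(x in D) f_ n x @[n --> \oo] --> \int[mu]_(x in D) f x.
Proof.
move=> mD fD mf_ mf fM cf.
have := @dominated_convergence _ _ R mu D mD (fun n x => (f_ n x)%:E) (EFin \o f) (cst M%:E).
case.
- by move=> n; apply/measurable_EFinP.
- exact/measurable_EFinP.
- by apply: filterS cf => x h Dx; apply: cvg_EFin; [exact: nearW|exact: h].
- by apply: (@integrable_bounded _ (cst M) `|M|) => //; exact: measurable_cst.
- by apply: aeW => x n Dx; rewrite /= lee_fin fM.
move=> i1 _ h; apply: fine_cvg; rewrite fineK; first exact: h.
exact: integrable_fin_num i1.
Qed.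

Lemma le_Rintegral_bounded (D : set T) (f : T -> R) (M c : R) :
  measurable D -> mu D = c%:E -> measurable_fun D f ->
  (forall x, D x -> `|f x| <= M) -> `|\int[mu]_(x in D) f x| <= M * c.
Proof.
move=> mD Dc mf fM.
have fD : (mu D < +oo)%E by rewrite Dc ltry.
have i := integrable_bounded mD fD mf fM.
apply: le_trans (le_normr_Rintegral mD i) _.
have -> : M * c = \int[mu]_(x in D) M by rewrite Rintegral_cst// Dc.
apply: le_Rintegral => //.
- apply: (@integrable_bounded _ (fun x => `|f x|) M) => //.
    exact: measurableT_comp.
  by move=> x Dx; rewrite normr_id fM.
- by apply: (@integrable_bounded _ (cst M) `|M|).
Qed.

End bounded_integrals.

Section fubini_bounded.
Context d1 d2 (T1 : measurableType d1) (T2 : measurableType d2) (R : realType).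
Variables (m1 : {sigma_finite_measure set T1 -> \bar R})
          (m2 : {sigma_finite_measure set T2 -> \bar R}).
Variables (A : set T1) (B : set T2) (mA : measurable A) (mB : measurable B).
Hypotheses (fA : (m1 A < +oo)%E) (fB : (m2 B < +oo)%E).
Variables (h : T1 * T2 -> R) (M : R).
Hypothesis mh : measurable_fun (A `*` B) h.
Hypothesis hM : forall z, (A `*` B) z -> `|h z| <= M.

Let mAB : measurable (A `*` B). Proof. exact: measurableX. Qed.

Let fAB : ((m1 \x m2)%E (A `*` B) < +oo)%E.
Proof. by rewrite product_measure1E// lte_mul_pinfty// ge0_fin_numE. Qed.

Let ih : (m1 \x m2)%E.-integrable setT (EFin \o (h \_ (A `*` B))).
Proof.
rewrite -restrict_EFin; apply/integrable_restrict => //; rewrite setTI.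
exact: integrable_bounded hM.
Qed.

Let inner1 x : (\int[m2]_y ((h \_ (A `*` B)) (x, y))%:E)%E =
  ((fun x => (\int[m2]_(y in B) (h (x, y))%:E)%E) \_ A) x.
Proof.
rewrite /patch; case: ifPn => [/set_mem Ax|/negP nAx].
  rewrite [RHS]integral_mkcond; apply: eq_integral => y _.
  rewrite /patch; case: ifPn => [/set_mem[_ By]|]; first by rewrite mem_set.
  case: (boolP (y \in B)) => // /set_mem By /negP[]; exact/mem_set.
apply: integral0_eq => y _; case: ifPn => // /set_mem[Ax _].
by case: nAx; exact/mem_set.
Qed.

Let inner2 y : (\int[m1]_x ((h \_ (A `*` B)) (x, y))%:E)%E =
  ((fun y => (\int[m1]_(x in A) (h (x, y))%:E)%E) \_ B) y.
Proof.
rewrite /patch; case: ifPn => [/set_mem By|/negP nBy].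
  rewrite [RHS]integral_mkcond; apply: eq_integral => x _.
  rewrite /patch; case: ifPn => [/set_mem[Ax _]|]; first by rewrite mem_set.
  case: (boolP (x \in A)) => // /set_mem Ax /negP[]; exact/mem_set.
apply: integral0_eq => x _; case: ifPn => // /set_mem[_ By].
by case: nBy; exact/mem_set.
Qed.

Let mhR : measurable_fun setT (h \_ (A `*` B)).
Proof. by apply/(measurable_restrictT _ mAB). Qed.

Let section1 x : A x -> measurable_fun B (fun y => h (x, y)).
Proof.
move=> Ax; apply: (@eq_measurable_fun _ _ _ _ _ (fun y => (h \_ (A `*` B)) (x, y))).
  by move=> y /set_mem By; rewrite /patch mem_set.
by apply: measurable_funTS; exact: (measurable_fun_pair2 _ mhR).
Qed.

Let section2 y : B y -> measurable_fun A (fun x => h (x, y)).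
Proof.
move=> By; apply: (@eq_measurable_fun _ _ _ _ _ (fun x => (h \_ (A `*` B)) (x, y))).
  by move=> x /set_mem Ax; rewrite /patch mem_set.
by apply: measurable_funTS; exact: (measurable_fun_pair1 _ mhR).
Qed.

(** The function is extended by 0 outside the rectangle, so that Fubini on the whole product
    applies; it is integrable because it is bounded on a set of finite measure. *)
Lemma Rintegral_prod12 : Rintegral (m1 \x m2)%E (A `*` B) h =
  \int[m1]_(x in A) \int[m2]_(y in B) h (x, y).
Proof.
rewrite {1}/Rintegral integral_mkcond restrict_EFin -integral12_prod_meas1//.
rewrite [in RHS]/Rintegral [in RHS]integral_mkcond; congr fine.
apply: eq_integral => x _; rewrite /fubini_F inner1 /patch.
case: ifPn => // /set_mem Ax; rewrite /Rintegral fineK//.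
apply: integrable_fin_num => //; apply: (@integrable_bounded _ _ _ _ _ _ M) => //; first exact: section1.
by move=> y By; apply: hM.
Qed.

Lemma Rintegral_prod21 : Rintegral (m1 \x m2)%E (A `*` B) h =
  \int[m2]_(y in B) \int[m1]_(x in A) h (x, y).
Proof.
rewrite {1}/Rintegral integral_mkcond restrict_EFin -integral21_prod_meas1//.
rewrite [in RHS]/Rintegral [in RHS]integral_mkcond; congr fine.
apply: eq_integral => x _; rewrite /fubini_G inner2 /patch.
case: ifPn => // /set_mem Ax; rewrite /Rintegral fineK//.
apply: integrable_fin_num => //; apply: (@integrable_bounded _ _ _ _ _ _ M) => //; first exact: section2.
by move=> y By; apply: hM.
Qed.

End fubini_bounded.

(** * One-variable calculus with explicit derivatives *)

Lemma Rintegral_FTC (R : realType) (F f : R -> R) (a b : R) : a < b ->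
  (forall x : R, is_derive x 1 F (f x)) -> continuous f ->
  \int[lebesgue_measure]_(x in `[a, b[) f x = F b - F a.
Proof.
move=> ab dF cf.
have i : lebesgue_measure.-integrable `[a, b] (EFin \o f).
  by apply: continuous_compact_integrable; [exact: segment_compact|exact: continuous_subspaceT].
rewrite Rintegral_itv_bndo_bndc; last first.
  by apply: integrableS i => //; exact: subset_itv_co_cc.
rewrite /Rintegral (@continuous_FTC2 _ f F)//.
- exact: continuous_subspaceT.
- have cF x : {for x, continuous F}.
    by apply: differentiable_continuous; apply/derivable1_diffP; exact: ex_derive.
  split=> [x _||]; first exact: ex_derive.
    exact: cvg_at_right_filter (cF a).
  exact: cvg_at_left_filter (cF b).
- by move=> x _; rewrite derive1E; apply: derive_val.
Qed.

Section pointwise_derivatives.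
Context (R : realType).
Implicit Types (f g : R -> R) (x a b : R).

Lemma is_derive1_ext f g x a : f =1 g -> is_derive x 1 f a -> is_derive x 1 g a.
Proof. by move=> /funext ->. Qed.

Lemma is_derive1_eq f x a b : is_derive x 1 f a -> a = b -> is_derive x 1 f b.
Proof. by move=> df <-. Qed.

Lemma is_derive1D f g x a b : is_derive x 1 f a -> is_derive x 1 g b ->
  is_derive x 1 (fun y => f y + g y) (a + b).
Proof. by move=> df dg; exact: is_deriveD. Qed.

Lemma is_derive1N f x a : is_derive x 1 f a -> is_derive x 1 (fun y => - f y) (- a).
Proof. by move=> df; exact: is_deriveN. Qed.

Lemma is_derive1M f g x a b : is_derive x 1 f a -> is_derive x 1 g b ->
  is_derive x 1 (fun y => f y * g y) (a * g x + f x * b).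
Proof.
move=> df dg; apply: (@is_derive1_eq _ _ (f x *: b + g x *: a)).
by rewrite /GRing.scale/= addrC mulrC.
Qed.

Lemma is_derive1_cst x (c : R) : is_derive x 1 (fun=> c) 0.
Proof. exact: is_derive_cst. Qed.

Lemma is_derive1Ml (c : R) f x a : is_derive x 1 f a ->
  is_derive x 1 (fun y => c * f y) (c * a).
Proof. by move=> df; apply: is_derive1_eq (is_derive1M (is_derive1_cst x c) df) _; ring. Qed.

Lemma is_derive1_scale (c : R) x : is_derive x 1 (fun y => c * y) c.
Proof. by apply: is_derive1_eq (is_derive1Ml c (is_derive_id x 1)) _; ring. Qed.

Lemma is_derive1V f x a : f x != 0 -> is_derive x 1 f a ->
  is_derive x 1 (fun y => (f y)^-1) (- a / f x ^+ 2).
Proof.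
move=> f0 df; apply: (@is_derive1_eq _ _ (- f x ^- 2 *: a)).
by rewrite /GRing.scale/=; field.
Qed.

Lemma is_derive1_compf f g x a b : is_derive (g x) 1 f a -> is_derive x 1 g b ->
  is_derive x 1 (fun y => f (g y)) (a * b).
Proof. by move=> df dg; exact: is_derive1_comp. Qed.

Lemma is_derive1_continuous f (df : R -> R) :
  (forall x, is_derive x 1 f (df x)) -> continuous f.
Proof.
move=> d x; apply: differentiable_continuous; apply/derivable1_diffP.
exact: ex_derive.
Qed.

End pointwise_derivatives.

Section pointwise_continuity.
Context (T : topologicalType) (R : realType).
Implicit Types f g : T -> R.

Lemma continuous_add f g : continuous f -> continuous g -> continuous (fun x => f x + g x).
Proof. by move=> cf cg x; apply: cvgD; [exact: cf|exact: cg]. Qed.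

Lemma continuous_mul f g : continuous f -> continuous g -> continuous (fun x => f x * g x).
Proof. by move=> cf cg x; apply: cvgM; [exact: cf|exact: cg]. Qed.

Lemma continuous_opp f : continuous f -> continuous (fun x => - f x).
Proof. by move=> cf x; apply: cvgN; exact: cf. Qed.

Lemma continuous_inv f : (forall x, f x != 0) -> continuous f -> continuous (fun x => (f x)^-1).
Proof. by move=> f0 cf x; apply: cvgV => //; exact: cf. Qed.

Lemma continuous_compr (h : R -> R) f : continuous h -> continuous f ->
  continuous (fun x => h (f x)).
Proof. by move=> ch cf x; apply: (@continuous_comp _ _ _ f h); [exact: cf|exact: ch]. Qed.

Lemma continuous_const (c : R) : continuous (fun _ : T => c).
Proof. by move=> x; exact: cvg_cst. Qed.

End pointwise_continuity.

(** * Integration over the cell and over time slabs; the divergence theorem *)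

Section boxes.
Context (R : realType).

Lemma bounded_box2 (f : R * R -> R) (a1 b1 a2 b2 : R) : continuous f ->
  exists2 M, 0 <= M & forall x y, a1 <= x <= b1 -> a2 <= y <= b2 -> `|f (x, y)| <= M.
Proof.
move=> cf.
have /compact_bounded[M [_ MP]] := continuous_compact (continuous_subspaceT cf)
  (compact_setX (@segment_compact R a1 b1) (@segment_compact R a2 b2)).
exists (`|M| + 1) => [|x y xab yab]; first by rewrite addr_ge0.
apply: (MP (`|M| + 1)); first by rewrite (le_lt_trans (ler_norm _))// ltrDl.
by exists (x, y) => //; split; rewrite /= in_itv.
Qed.

Lemma bounded_box3 (f : R * (R * R) -> R) (a0 b0 a1 b1 a2 b2 : R) : continuous f ->
  exists2 M, 0 <= M & forall t x y,
    a0 <= t <= b0 -> a1 <= x <= b1 -> a2 <= y <= b2 -> `|f (t, (x, y))| <= M.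
Proof.
move=> cf.
have /compact_bounded[M [_ MP]] := continuous_compact (continuous_subspaceT cf)
  (compact_setX (@segment_compact R a0 b0)
    (compact_setX (@segment_compact R a1 b1) (@segment_compact R a2 b2))).
exists (`|M| + 1) => [|t x y tab xab yab]; first by rewrite addr_ge0.
apply: (MP (`|M| + 1)); first by rewrite (le_lt_trans (ler_norm _))// ltrDl.
by exists (t, (x, y)) => //; split; rewrite /= ?in_itv//; split; rewrite /= in_itv.
Qed.

Lemma measurable_cell : measurable (@cell R : set (plane R)).
Proof. by apply: measurableX; exact: measurable_itv. Qed.

Lemma leb2_cell : leb2 (@cell R : set (plane R)) = (Num.sqrt 2)%:E.
Proof.
transitivity (lebesgue_measure (`[0%R, (Num.sqrt 2)%R[ : set R) * lebesgue_measure (`[0%R, 1%R[ : set R))%E.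
  by apply: product_measure1E; exact: measurable_itv.
by rewrite !lebesgue_measure_itv/= !lte_fin sqrtr_gt0 ltr0n ltr01 /= !oppr0 !adde0 mule1.
Qed.

Lemma leb2_cell_lty : (leb2 (@cell R : set (plane R)) < +oo)%E.
Proof. by rewrite leb2_cell ltry. Qed.

Lemma cell_box (z : R * R) : cell z -> 0 <= z.1 <= Num.sqrt 2 /\ 0 <= z.2 <= 1.
Proof.
by move=> [/=]; rewrite !in_itv/= => /andP[-> /ltW->] /andP[-> /ltW->].
Qed.

Lemma sqrt2_gt0 : 0 < Num.sqrt 2 :> R. Proof. by rewrite sqrtr_gt0. Qed.

Definition slab (t1 t2 : R) : set (R_plane R) := `[t1, t2[%classic `*` @cell R.

Lemma measurable_slab t1 t2 : measurable (slab t1 t2).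
Proof. by apply: measurableX; [exact: measurable_itv|exact: measurable_cell]. Qed.

Lemma leb_itvco_lty (t1 t2 : R) : (lebesgue_measure (`[t1, t2[ : set (measurableTypeR R)) < +oo)%E.
Proof. by rewrite lebesgue_measure_itv/=; case: ifP => // _; rewrite -EFinB ltry. Qed.

Lemma leb3_slab_lty t1 t2 : (leb3 (slab t1 t2) < +oo)%E.
Proof.
rewrite /leb3 /slab product_measure1E; [|exact: measurable_itv|exact: measurable_cell].
rewrite lte_mul_pinfty//; [|exact: leb2_cell_lty].
by rewrite ge0_fin_numE//; exact: leb_itvco_lty.
Qed.

Lemma Rintegral_slab12 (h : R * (R * R) -> R) (M t1 t2 : R) :
  measurable_fun (slab t1 t2) h -> (forall z, slab t1 t2 z -> `|h z| <= M) ->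
  \int[@leb3 R]_(z in slab t1 t2) h z =
  \int[lebesgue_measure]_(t in `[t1, t2[) \int[@leb2 R]_(w in @cell R) h (t, w).
Proof.
move=> mh hM; rewrite /leb3; apply: Rintegral_prod12 hM => //.
- exact: measurable_cell.
- exact: leb_itvco_lty.
- exact: leb2_cell_lty.
Qed.

Lemma Rintegral_slab21 (h : R * (R * R) -> R) (M t1 t2 : R) :
  measurable_fun (slab t1 t2) h -> (forall z, slab t1 t2 z -> `|h z| <= M) ->
  \int[@leb3 R]_(z in slab t1 t2) h z =
  \int[@leb2 R]_(w in @cell R) \int[lebesgue_measure]_(t in `[t1, t2[) h (t, w).
Proof.
move=> mh hM; rewrite /leb3; apply: Rintegral_prod21 hM => //.
- exact: measurable_cell.
- exact: leb_itvco_lty.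
- exact: leb2_cell_lty.
Qed.

Lemma Rintegral_cell12 (h : R * R -> R) : continuous h ->
  \int[@leb2 R]_(w in @cell R) h w =
  \int[lebesgue_measure]_(x in `[0, Num.sqrt 2[) \int[lebesgue_measure]_(y in `[0, 1[) h (x, y).
Proof.
move=> ch; have [M M0 hM] := bounded_box2 0 (Num.sqrt 2) 0 1 ch.
rewrite /leb2 /cell; apply: (@Rintegral_prod12 _ _ _ _ _ _ _ _ _ _ _ _ _ _ M) => //.
- exact: leb_itvco_lty.
- exact: leb_itvco_lty.
- by apply: measurable_funTS; exact: measurable_continuous2.
- by move=> [x y] /cell_box[/= ? ?]; exact: hM.
Qed.

Lemma Rintegral_cell21 (h : R * R -> R) : continuous h ->
  \int[@leb2 R]_(w in @cell R) h w =
  \int[lebesgue_measure]_(y in `[0, 1[) \int[lebesgue_measure]_(x in `[0, Num.sqrt 2[) h (x, y).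
Proof.
move=> ch; have [M M0 hM] := bounded_box2 0 (Num.sqrt 2) 0 1 ch.
rewrite /leb2 /cell; apply: (@Rintegral_prod21 _ _ _ _ _ _ _ _ _ _ _ _ _ _ M) => //.
- exact: leb_itvco_lty.
- exact: leb_itvco_lty.
- by apply: measurable_funTS; exact: measurable_continuous2.
- by move=> [x y] /cell_box[/= ? ?]; exact: hM.
Qed.

Lemma integrable_cell (h : R * R -> R) : continuous h ->
  (@leb2 R).-integrable (@cell R) (EFin \o h).
Proof.
move=> ch; have [M M0 hM] := bounded_box2 0 (Num.sqrt 2) 0 1 ch.
apply: (@integrable_bounded _ _ _ _ _ _ M).
- exact: measurable_cell.
- exact: leb2_cell_lty.
- by apply: measurable_funTS; exact: measurable_continuous2.
- by move=> [x y] /cell_box[/= ? ?]; exact: hM.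
Qed.

Lemma Rintegral_FTC0 (F f : R -> R) (a b : R) : a < b ->
  (forall x : R, is_derive x 1 F (f x)) -> continuous f -> F a = F b ->
  \int[lebesgue_measure]_(x in `[a, b[) f x = 0.
Proof. by move=> ab dF cf e; rewrite (Rintegral_FTC ab dF cf) e subrr. Qed.

(* Only the values on opposite sides of the cell are required to agree. *)
Lemma divergence_cell (v1 v2 v1x v2y g gx gy : R * R -> R) :
  continuous v1 -> continuous v2 -> continuous v1x -> continuous v2y ->
  continuous g -> continuous gx -> continuous gy ->
  (forall x y : R, is_derive x 1 (fun x => v1 (x, y)) (v1x (x, y))) ->
  (forall x y : R, is_derive y 1 (fun y => v2 (x, y)) (v2y (x, y))) ->
  (forall x y : R, is_derive x 1 (fun x => g (x, y)) (gx (x, y))) ->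
  (forall x y : R, is_derive y 1 (fun y => g (x, y)) (gy (x, y))) ->
  (forall z, v1x z + v2y z = 0) ->
  (forall y, v1 (0, y) * g (0, y) = v1 (Num.sqrt 2, y) * g (Num.sqrt 2, y)) ->
  (forall x, v2 (x, 0) * g (x, 0) = v2 (x, 1) * g (x, 1)) ->
  \int[@leb2 R]_(z in @cell R) (v1 z * gx z + v2 z * gy z) = 0.
Proof.
move=> cv1 cv2 cv1x cv2y cg cgx cgy dv1 dv2 dgx dgy div p1 p2.
have c1 : continuous (fun z => v1x z * g z + v1 z * gx z).
  by apply: continuous_add; apply: continuous_mul.
have c2 : continuous (fun z => v2y z * g z + v2 z * gy z).
  by apply: continuous_add; apply: continuous_mul.
(* As the field is divergence free, the integrand is the divergence of (v1 g, v2 g); each term is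
   integrated in its own variable first. *)
transitivity (\int[@leb2 R]_(z in @cell R)
   ((v1x z * g z + v1 z * gx z) + (v2y z * g z + v2 z * gy z))).
  apply: eq_Rintegral => z _.
  by have := div z; move: (v1x z) (v2y z) => a b /eqP; rewrite addr_eq0 => /eqP ->; ring.
rewrite RintegralD; [|exact: measurable_cell|exact: integrable_cell c1|exact: integrable_cell c2].
rewrite (Rintegral_cell21 c1) (Rintegral_cell12 c2).
rewrite (_ : (fun y : R => _) = cst 0); last first.
  apply/funext => y; apply: (Rintegral_FTC0 (F := fun x => v1 (x, y) * g (x, y))).
  - exact: sqrt2_gt0.
  - by move=> x; apply: is_derive1M.
  - exact: continuous_pairl c1.
  - exact: p1.
rewrite (_ : (fun x : R => _) = cst 0); last first.
  apply/funext => x; apply: (Rintegral_FTC0 (F := fun y => v2 (x, y) * g (x, y))).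
  - exact: ltr01.
  - by move=> y; apply: is_derive1M.
  - exact: continuous_pairr c2.
  - exact: p2.
by rewrite !Rintegral_cst ?mul0r ?addr0.
Qed.

End boxes.

(** * Partial derivatives and boundary values of test functions *)

Section test_functions.
Context (R : realType) (phi : R * (R * R) -> R).
Hypothesis test_phi : test_function phi.

Lemma test_function_continuous : continuous phi.
Proof. by case: test_phi => /(_ 0%N)[]. Qed.

Lemma test_function_derivable (i : 'I_3) z : derivable phi z (basis_vec R i).
Proof. by case: test_phi => /(_ 1%N)[_ /(_ i)[]]. Qed.

Lemma test_function_continuous_partial (i : 'I_3) : continuous (partial i phi).
Proof. by case: test_phi => /(_ 1%N)[_ /(_ i)[_ []]]. Qed.

Lemma basis_vec0 : basis_vec R (inord 0) = (1, (0, 0)).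
Proof. by rewrite /basis_vec !inordK. Qed.

Lemma basis_vec1 : basis_vec R (inord 1) = (0, (1, 0)).
Proof. by rewrite /basis_vec !inordK. Qed.

Lemma basis_vec2 : basis_vec R (inord 2) = (0, (0, 1)).
Proof. by rewrite /basis_vec !inordK. Qed.

(** A directional derivative only sees the difference quotients, which the one-variable section
    shares. *)
Let section_derive (F : R -> R) (i : 'I_3) (z : R * (R * R)) (s : R) :
  (forall h, F (h *: 1 + s) = phi (h *: basis_vec R i + z)) -> F s = phi z ->
  is_derive s 1 F (partial i phi z).
Proof.
move=> Fh F0; have E : (fun h : R => h^-1 *: (F (h *: 1 + s) - F s)) =
    (fun h : R => h^-1 *: (phi (h *: basis_vec R i + z) - phi z)).
  by apply/funext => h; rewrite Fh F0.
have : derivable phi z (basis_vec R i) by exact: test_function_derivable.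
rewrite /partial /derivable => d.
split; first by rewrite /derivable /= E.
by rewrite /derive /= E.
Qed.

Lemma test_function_derive_t (t : R) w : is_derive t 1 (fun t => phi (t, w)) (d_t phi (t, w)).
Proof.
apply: section_derive => // h; rewrite basis_vec0; congr (phi _).
by case: w => x y; rewrite -[RHS]/(h *: 1 + t, (h *: 0 + x, h *: 0 + y)) !scaler0 !add0r.
Qed.

Lemma test_function_derive_x t (x y : R) :
  is_derive x 1 (fun x => phi (t, (x, y))) (partial (inord 1) phi (t, (x, y))).
Proof.
apply: section_derive => // h; rewrite basis_vec1; congr (phi _).
by rewrite -[RHS]/(h *: 0 + t, (h *: 1 + x, h *: 0 + y)) !scaler0 !add0r.
Qed.

Lemma test_function_derive_y t (x y : R) :
  is_derive y 1 (fun y => phi (t, (x, y))) (partial (inord 2) phi (t, (x, y))).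
Proof.
apply: section_derive => // h; rewrite basis_vec2; congr (phi _).
by rewrite -[RHS]/(h *: 0 + t, (h *: 0 + x, h *: 1 + y)) !scaler0 !add0r.
Qed.

Lemma test_function_periodic_x t y : phi (t, (Num.sqrt 2, y)) = phi (t, (0, y)).
Proof.
case: test_phi => _ /(_ t (1, 0) (0, y)) + _.
by rewrite /shift/= mulr1 addr0 add0r.
Qed.

Lemma test_function_periodic_y t x : phi (t, (x, 1)) = phi (t, (x, 0)).
Proof.
case: test_phi => _ /(_ t (0, 1) (x, 0)) + _.
by rewrite /shift/= mulr0 addr0 add0r.
Qed.

Lemma test_function_start w : phi (0, w) = 0.
Proof.
by case: test_phi => _ _ [a [b [a0 _ h]]]; apply: h; rewrite leNgt a0.
Qed.

End test_functions.

(** * The sign function and its smooth approximations *)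

Section smooth_sign.
Context (R : realType).
Implicit Types (e v : R).

(** The value -1 at 0 keeps the square equal to 1 everywhere. *)
Definition pm (v : R) : R := if 0 < v then 1 else -1.

Lemma normr_pm v : `|pm v| = 1.
Proof. by rewrite /pm; case: ifP; rewrite ?normrN normr1. Qed.

Lemma pm_sqr v : pm v ^+ 2 = 1.
Proof. by rewrite /pm; case: ifP; rewrite ?sqrrN expr1n. Qed.

Lemma measurable_pm : measurable_fun setT pm.
Proof.
apply: measurable_fun_ifT; [|exact: measurable_cst|exact: measurable_cst].
by apply: measurable_fun_ltr => //; exact: measurable_id.
Qed.

(** A smooth sign, converging to [pm] off 0 as e tends to 0; [dssgn] is its derivative in v. *)
Definition ssgn (e v : R) : R := v / Num.sqrt (v ^+ 2 + e).
Definition dssgn (e v : R) : R := e / ((v ^+ 2 + e) * Num.sqrt (v ^+ 2 + e)).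

Lemma sqrDe_gt0 e v : 0 < e -> 0 < v ^+ 2 + e.
Proof. by move=> e0; rewrite ltr_wpDl// sqr_ge0. Qed.

Lemma is_derive_ssgn e v : 0 < e -> is_derive v 1 (ssgn e) (dssgn e v).
Proof.
move=> e0; have p := sqrDe_gt0 v e0.
have s0 : 0 < Num.sqrt (v ^+ 2 + e) by rewrite sqrtr_gt0.
have d1 : is_derive v 1 (fun v => v ^+ 2 + e) (2 * v).
  apply: is_derive1_eq (is_derive1D (is_derive1M (is_derive_id v 1) (is_derive_id v 1)) (is_derive1_cst v e)) _.
  by ring.
have d2 := @is_derive1_compf R Num.sqrt (fun v => v ^+ 2 + e) v _ _ (is_derive1_sqrt p) d1.
have sn0 : Num.sqrt (v ^+ 2 + e) != 0 by rewrite gt_eqF.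
have d3 := @is_derive1M R id (fun v => (Num.sqrt (v ^+ 2 + e))^-1) v _ _ (is_derive_id v 1) (@is_derive1V R (fun v => Num.sqrt (v ^+ 2 + e)) v _ sn0 d2).
apply: is_derive1_eq d3 _; rewrite /dssgn.
have E := sqr_sqrtr (ltW p); move: sn0 E.
set s := Num.sqrt _ => sn0 E.
have -> : e = s ^+ 2 - v ^+ 2 by rewrite E; ring.
by rewrite subrKC; field.
Qed.

Lemma continuous_ssgn e : 0 < e -> continuous (ssgn e).
Proof. by move=> e0; apply: (@is_derive1_continuous _ _ (dssgn e)) => v; exact: is_derive_ssgn. Qed.

Lemma continuous_dssgn e : 0 < e -> continuous (dssgn e).
Proof.
move=> e0; have c : continuous (fun v : R => v ^+ 2 + e).
  apply: continuous_add; last exact: continuous_const.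
  by apply: (@continuous_mul _ _ id id) => x; exact: cvg_id.
have cs : continuous (fun v : R => Num.sqrt (v ^+ 2 + e)).
  by apply: (continuous_compr _ c); exact: sqrt_continuous.
apply: continuous_mul; first exact: continuous_const.
apply: continuous_inv; last exact: continuous_mul.
by move=> x; have p := sqrDe_gt0 x e0; rewrite mulf_neq0 ?gt_eqF ?sqrtr_gt0.
Qed.

Lemma ssgn_le1 e v : 0 < e -> `|ssgn e v| <= 1.
Proof.
move=> e0; have p := sqrDe_gt0 v e0.
rewrite /ssgn normrM normfV (ger0_norm (sqrtr_ge0 _)) ler_pdivrMr ?sqrtr_gt0// mul1r.
by rewrite -sqrtr_sqr ler_wsqrtr// lerDl ltW.
Qed.

(** This product is the error left when the smoothed sign of a phase is differentiated along the
    flow. The bound shows that it stays below 1 uniformly in [e] and tends to 0 at each nonzero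
    v. *)
Lemma dssgn_mul_le e v : 0 < e -> `|v * dssgn e v| <= e / (v ^+ 2 + e).
Proof.
move=> e0; have p := sqrDe_gt0 v e0.
have -> : v * dssgn e v = ssgn e v * (e / (v ^+ 2 + e)).
  by rewrite /ssgn /dssgn; field; rewrite !gt_eqF ?sqrtr_gt0.
have q0 : 0 <= e / (v ^+ 2 + e) by rewrite divr_ge0// ltW.
by rewrite normrM (ger0_norm q0) ler_piMl ?ssgn_le1.
Qed.

Lemma dssgn_mul_le1 e v : 0 < e -> `|v * dssgn e v| <= 1.
Proof.
move=> e0; have p := sqrDe_gt0 v e0; apply: le_trans (dssgn_mul_le v e0) _.
by rewrite ler_pdivrMr// mul1r lerDr sqr_ge0.
Qed.

Lemma cvg_mul0 (u : nat -> R) (c : R) : u n @[n --> \oo] --> (0 : R) -> (u n * c) @[n --> \oo] --> (0 : R).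
Proof.
move=> h; have H : (u n * c) @[n --> \oo] --> 0 * c by exact: (cvgMr_tmp h).
by move: H; rewrite mul0r.
Qed.

Lemma cvg_balance (u v w1 w2 : nat -> R) (a b c d : R) :
  u n @[n --> \oo] --> a -> v n @[n --> \oo] --> b ->
  w1 n @[n --> \oo] --> c -> w2 n @[n --> \oo] --> d ->
  (forall n, u n + v n = w1 n - w2 n) -> a + b = c - d.
Proof.
move=> ua vb wc wd E.
have l : (u n + v n) @[n --> \oo] --> a + b by exact: cvgD.
have r : (u n + v n) @[n --> \oo] --> c - d by under eq_fun do rewrite E; exact: cvgB.
by rewrite -(cvg_lim (@Rhausdorff R) l) (cvg_lim (@Rhausdorff R) r).
Qed.

Lemma cvg_harmonic0 : (n.+1%:R^-1 : R) @[n --> \oo] --> 0.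
Proof. exact: cvg_harmonic. Qed.

Lemma cvg_ssgn v : v != 0 -> ssgn n.+1%:R^-1 v @[n --> \oo] --> pm v.
Proof.
move=> v0.
have -> : pm v = v / Num.sqrt (v ^+ 2 + 0).
  rewrite addr0 sqrtr_sqr /pm; case: ifPn => [h|]; first by rewrite gtr0_norm// divff.
  by rewrite -leNgt => h; rewrite ler0_norm// invrN mulrN divff.
apply: cvgMl_tmp; apply: cvgV; first by rewrite addr0 sqrtr_sqr normr_eq0.
apply: (@cvg_comp _ _ _ (fun n => v ^+ 2 + n.+1%:R^-1) Num.sqrt _ (nbhs (v ^+ 2 + 0))); last exact: sqrt_continuous.
by apply: cvgD; [exact: cvg_cst|exact: cvg_harmonic0].
Qed.

Lemma cvg_dssgn v : v * dssgn n.+1%:R^-1 v @[n --> \oo] --> 0.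
Proof.
have [->|v0] := eqVneq v 0; first by under eq_fun do rewrite mul0r; exact: cvg_cst.
apply/norm_cvg0P.
apply: (@squeeze_cvgr _ _ _ _ (fun=> 0) (fun n => n.+1%:R^-1 / (v ^+ 2 + n.+1%:R^-1))).
- by apply: nearW => n; rewrite normr_ge0 dssgn_mul_le.
- exact: cvg_cst.
- rewrite -(mul0r (v ^+ 2 + 0)^-1); apply: cvgM; first exact: cvg_harmonic0.
  apply: cvgV; first by rewrite addr0 sqrf_eq0.
  by apply: cvgD; [exact: cvg_cst|exact: cvg_harmonic0].
Qed.

End smooth_sign.

(** * The sign of a phase is transported when the nodal set moves with the flow *)

Section transport_on_slabs.
Context (R : realType).
Implicit Types (G Gt Gx Gy : R * (R * R) -> R).

(** Derivatives are carried as named, jointly continuous functions, and periodicity is stated across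
    opposite sides of the cell: this is the form that integration by parts consumes. *)
Record C1_cell_periodic G Gt Gx Gy : Prop := C1CellPeriodic {
  C1_cont : continuous G;
  C1_cont_t : continuous Gt;
  C1_cont_x : continuous Gx;
  C1_cont_y : continuous Gy;
  C1_derive_t : forall (t : R) w, is_derive t 1 (fun t => G (t, w)) (Gt (t, w));
  C1_derive_x : forall t (x y : R), is_derive x 1 (fun x => G (t, (x, y))) (Gx (t, (x, y)));
  C1_derive_y : forall t (x y : R), is_derive y 1 (fun y => G (t, (x, y))) (Gy (t, (x, y)));
  C1_periodic_x : forall t y, G (t, (Num.sqrt 2, y)) = G (t, (0, y));
  C1_periodic_y : forall t x, G (t, (x, 1)) = G (t, (x, 0)) }.

Lemma C1_test_function phi : test_function phi ->
  C1_cell_periodic phi (d_t phi) (partial (inord 1) phi) (partial (inord 2) phi).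
Proof.
move=> h; split.
- exact: test_function_continuous.
- exact: test_function_continuous_partial.
- exact: test_function_continuous_partial.
- exact: test_function_continuous_partial.
- by move=> t w; exact: test_function_derive_t.
- by move=> t x y; exact: test_function_derive_x.
- by move=> t x y; exact: test_function_derive_y.
- by move=> t y; exact: test_function_periodic_x.
- by move=> t y; exact: test_function_periodic_y.
Qed.

Record solenoidal_cell (v1 v2 v1x v2y : R * R -> R) : Prop := SolenoidalCell {
  sol_cont1 : continuous v1;
  sol_cont2 : continuous v2;
  sol_cont1x : continuous v1x;
  sol_cont2y : continuous v2y;
  sol_derive1 : forall x y : R, is_derive x 1 (fun x => v1 (x, y)) (v1x (x, y));
  sol_derive2 : forall x y : R, is_derive y 1 (fun y => v2 (x, y)) (v2y (x, y));
  sol_div0 : forall z, v1x z + v2y z = 0;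
  sol_periodic1 : forall y, v1 (Num.sqrt 2, y) = v1 (0, y);
  sol_periodic2 : forall x, v2 (x, 1) = v2 (x, 0) }.

Definition material (v1 v2 Gt Gx Gy : R * (R * R) -> R) (z : R * (R * R)) : R :=
  Gt z + (v1 z * Gx z + v2 z * Gy z).

Variables (t1 t2 : R) (v1 v2 : R * (R * R) -> R) (V : R).
Hypothesis t12 : t1 < t2.
Hypotheses (mv1 : measurable_fun (slab t1 t2) v1) (mv2 : measurable_fun (slab t1 t2) v2).
Hypotheses (v1V : forall z, slab t1 t2 z -> `|v1 z| <= V)
           (v2V : forall z, slab t1 t2 z -> `|v2 z| <= V).
Hypothesis sol : forall t, t1 <= t < t2 -> exists v1x v2y,
  solenoidal_cell (fun w => v1 (t, w)) (fun w => v2 (t, w)) v1x v2y.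

Lemma slab_box z : slab t1 t2 z -> [/\ t1 <= z.1 < t2, 0 <= z.2.1 <= Num.sqrt 2 & 0 <= z.2.2 <= 1].
Proof. by move=> [/=]; rewrite in_itv/= => ? /cell_box[]. Qed.

Lemma bounded_slab (f : R * (R * R) -> R) : continuous f ->
  exists2 M, 0 <= M & forall z, slab t1 t2 z -> `|f z| <= M.
Proof.
move=> cf; have [M M0 hM] := bounded_box3 t1 t2 0 (Num.sqrt 2) 0 1 cf.
exists M => // -[t [x y]] /slab_box[/andP[a b] c d]; apply: hM => //=.
by move: a b => /= -> /ltW ->.
Qed.

Lemma measurable_slab_continuous (f : R * (R * R) -> R) : continuous f -> measurable_fun (slab t1 t2) f.
Proof. by move=> cf; apply: measurable_funTS; exact: measurable_continuous3. Qed.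

Lemma measurable_advection Gx Gy : continuous Gx -> continuous Gy ->
  measurable_fun (slab t1 t2) (fun z => v1 z * Gx z + v2 z * Gy z).
Proof.
by move=> ? ?; apply: measurable_funD; apply: measurable_funM => //;
  exact: measurable_slab_continuous.
Qed.

Lemma bounded_advection Gx Gy : continuous Gx -> continuous Gy ->
  exists2 M, 0 <= M & forall z, slab t1 t2 z -> `|v1 z * Gx z + v2 z * Gy z| <= M.
Proof.
move=> /bounded_slab[A A0 hA] /bounded_slab[B B0 hB].
exists (`|V| * A + `|V| * B) => [|z sz]; first by rewrite addr_ge0// mulr_ge0.
apply: le_trans (ler_normD _ _) _; rewrite !normrM lerD// ler_pM//.
- exact: le_trans (v1V sz) (ler_norm _).
- exact: hA.
- exact: le_trans (v2V sz) (ler_norm _).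
- exact: hB.
Qed.

Lemma measurable_material Gt Gx Gy : continuous Gt -> continuous Gx -> continuous Gy ->
  measurable_fun (slab t1 t2) (material v1 v2 Gt Gx Gy).
Proof.
by move=> ? ? ?; apply: measurable_funD; [exact: measurable_slab_continuous|exact: measurable_advection].
Qed.

Lemma bounded_material Gt Gx Gy : continuous Gt -> continuous Gx -> continuous Gy ->
  exists2 M, 0 <= M & forall z, slab t1 t2 z -> `|material v1 v2 Gt Gx Gy z| <= M.
Proof.
move=> /bounded_slab[A A0 hA] cx cy; have [B B0 hB] := bounded_advection cx cy.
exists (A + B) => [|z sz]; first exact: addr_ge0.
by apply: le_trans (ler_normD _ _) _; rewrite lerD ?hA ?hB.
Qed.

Lemma integrable_slab (h : R * (R * R) -> R) M : measurable_fun (slab t1 t2) h ->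
  (forall z, slab t1 t2 z -> `|h z| <= M) -> (@leb3 R).-integrable (slab t1 t2) (EFin \o h).
Proof.
move=> mh hM; apply: (integrable_bounded _ _ mh hM); first exact: measurable_slab.
exact: leb3_slab_lty.
Qed.

(** The time derivative is integrated along each vertical segment by the fundamental theorem; the
    advective part has zero integral on each time slice because the field is solenoidal. *)
Lemma transport_smooth G Gt Gx Gy : C1_cell_periodic G Gt Gx Gy ->
  \int[@leb3 R]_(z in slab t1 t2) material v1 v2 Gt Gx Gy z =
  \int[@leb2 R]_(w in @cell R) G (t2, w) - \int[@leb2 R]_(w in @cell R) G (t1, w).
Proof.
move=> [cG cGt cGx cGy dt dx dy px py].
have mt := measurable_slab_continuous cGt; have [A A0 hA] := bounded_slab cGt.
have ma := measurable_advection cGx cGy; have [B B0 hB] := bounded_advection cGx cGy.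
rewrite /material RintegralD; [|exact: measurable_slab|exact: integrable_slab hA|exact: integrable_slab hB].
rewrite (Rintegral_slab21 mt hA) (Rintegral_slab12 ma hB).
rewrite [X in _ + X](_ : _ = 0) ?addr0.
  rewrite -RintegralB; [|exact: measurable_cell|exact/integrable_cell/continuous_pairr|exact/integrable_cell/continuous_pairr].
  apply: eq_Rintegral => w _; apply: (Rintegral_FTC t12 (F := fun t => G (t, w))).
  exact: continuous_pairl.
rewrite -[RHS](mul0r (fine (lebesgue_measure (`[t1, t2[ : set (measurableTypeR R)))))
  -Rintegral_cst//.
apply: eq_Rintegral => t; rewrite inE/= in_itv/= => tt.
have [v1x [v2y [c1 c2 c1x c2y d1 d2 div p1 p2]]] := sol tt.
apply: (@divergence_cell _ _ _ v1x v2y (fun w => G (t, w))) => //.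
- exact: continuous_pairr.
- exact: continuous_pairr.
- exact: continuous_pairr.
- by move=> y; rewrite p1 px.
- by move=> x; rewrite p2 py.
Qed.

Section sign.
Variables (f ft fx fy : R * (R * R) -> R).
Hypothesis C1f : C1_cell_periodic f ft fx fy.
Variables (h : R * (R * R) -> R) (H : R).
Hypothesis fh : forall z, slab t1 t2 z -> material v1 v2 ft fx fy z = f z * h z.
Hypothesis hH : forall z, slab t1 t2 z -> `|h z| <= H.
Hypothesis null_slab : {ae (@leb3 R), forall z, slab t1 t2 z -> f z != 0}.
Hypothesis null1 : {ae (@leb2 R), forall w, @cell R w -> f (t1, w) != 0}.
Hypothesis null2 : {ae (@leb2 R), forall w, @cell R w -> f (t2, w) != 0}.
Variable phi : R * (R * R) -> R.
Hypothesis test_phi : test_function phi.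

Let phit := d_t phi.
Let phix := partial (inord 1) phi.
Let phiy := partial (inord 2) phi.

Let C1phi : C1_cell_periodic phi phit phix phiy. Proof. exact: C1_test_function. Qed.

Lemma C1_ssgn e : 0 < e -> C1_cell_periodic (fun z => ssgn e (f z) * phi z)
  (fun z => dssgn e (f z) * ft z * phi z + ssgn e (f z) * phit z)
  (fun z => dssgn e (f z) * fx z * phi z + ssgn e (f z) * phix z)
  (fun z => dssgn e (f z) * fy z * phi z + ssgn e (f z) * phiy z).
Proof.
move=> e0; case: C1f => cf cft cfx cfy dft dfx dfy pfx pfy.
case: C1phi => cp cpt cpx cpy dpt dpx dpy ppx ppy.
have cs : continuous (fun z => ssgn e (f z)) by apply: (continuous_compr _ cf); exact: continuous_ssgn.
have cd : continuous (fun z => dssgn e (f z)) by apply: (continuous_compr _ cf); exact: continuous_dssgn.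
have ds (s : R -> R) (v a : R) : is_derive v 1 s a -> is_derive v 1 (fun v => ssgn e (s v)) (dssgn e (s v) * a).
  move=> d; exact: (is_derive1_compf (is_derive_ssgn (s v) e0) d).
split.
- exact: (continuous_mul cs cp).
- exact: (continuous_add (continuous_mul (continuous_mul cd cft) cp) (continuous_mul cs cpt)).
- exact: (continuous_add (continuous_mul (continuous_mul cd cfx) cp) (continuous_mul cs cpx)).
- exact: (continuous_add (continuous_mul (continuous_mul cd cfy) cp) (continuous_mul cs cpy)).
- by move=> t w; apply: (is_derive1M (ds _ _ _ (dft t w)) (dpt t w)).
- by move=> t x y; apply: (is_derive1M (ds _ _ _ (dfx t x y)) (dpx t x y)).
- by move=> t x y; apply: (is_derive1M (ds _ _ _ (dfy t x y)) (dpy t x y)).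
- by move=> t y; rewrite pfx ppx.
- by move=> t x; rewrite pfy ppy.
Qed.

Let eps n : R := n.+1%:R^-1.
Let eps0 n : 0 < eps n. Proof. by rewrite invr_gt0. Qed.

Let cvg_slice t : {ae (@leb2 R), forall w, @cell R w -> f (t, w) != 0} ->
  \int[@leb2 R]_(w in @cell R) (ssgn (eps n) (f (t, w)) * phi (t, w)) @[n --> \oo] -->
  \int[@leb2 R]_(w in @cell R) (pm (f (t, w)) * phi (t, w)).
Proof.
move=> nul; have cp := continuous_pairr (x := t) (C1_cont C1phi).
have cf := continuous_pairr (x := t) (C1_cont C1f).
have [M M0 hM] := bounded_box2 0 (Num.sqrt 2) 0 1 cp.
apply: (@cvg_Rintegral_bounded _ _ _ _ _ _ _ M).
- exact: measurable_cell.
- exact: leb2_cell_lty.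
- move=> n; apply: measurable_funTS; apply: measurable_continuous2.
  by apply: continuous_mul => //; apply: (continuous_compr _ cf); exact: continuous_ssgn.
- apply: measurable_funTS; apply: measurable_funM; last exact: measurable_continuous2.
  by apply: (measurableT_comp (@measurable_pm R)); exact: measurable_continuous2.
- move=> n [x y] /cell_box[/= xb yb]; rewrite normrM -[M]mul1r ler_pM ?ssgn_le1//.
  exact: hM.
- apply: (ae_sub _ nul) => w nz cw; apply: cvgMr_tmp; apply: cvg_ssgn; exact: nz.
Qed.

(** The smooth identity is applied to S(f) phi, with S a smoothed sign. By the chain rule and the
    equation for f, the extra term is f S'(f) h phi, which is bounded and tends to 0; the other
    terms converge because f vanishes on null sets only. *)
Lemma transport_sign :
  \int[@leb3 R]_(z in slab t1 t2) (pm (f z) * material v1 v2 phit phix phiy z) =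
  \int[@leb2 R]_(w in @cell R) (pm (f (t2, w)) * phi (t2, w)) -
  \int[@leb2 R]_(w in @cell R) (pm (f (t1, w)) * phi (t1, w)).
Proof.
case: C1f => cf cft cfx cfy dft dfx dfy pfx pfy.
case: C1phi => cp cpt cpx cpy dpt dpx dpy ppx ppy.
have [M M0 hM] := bounded_slab cp.
have mm := measurable_material cpt cpx cpy.
have [N N0 hN] := bounded_material cpt cpx cpy.
have ms n : measurable_fun (slab t1 t2) (fun z => ssgn (eps n) (f z)).
  by apply: measurable_slab_continuous; apply: (continuous_compr _ cf); exact: continuous_ssgn.
have mmf := measurable_material cft cfx cfy.
pose g n z := dssgn (eps n) (f z) * material v1 v2 ft fx fy z * phi z.
have mg n : measurable_fun (slab t1 t2) (g n).
  apply: measurable_funM; last exact: measurable_slab_continuous.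
  apply: measurable_funM => //; apply: measurable_slab_continuous.
  by apply: (continuous_compr _ cf); exact: continuous_dssgn.
have gE n z : slab t1 t2 z -> g n z = (f z * dssgn (eps n) (f z)) * (h z * phi z).
  by move=> sz; rewrite /g fh//; ring.
have gM n z : slab t1 t2 z -> `|g n z| <= `|H| * M.
  move=> sz; rewrite gE// normrM -[leRHS]mul1r ler_pM ?dssgn_mul_le1//.
  by rewrite normrM ler_pM ?hM//; exact: le_trans (hH sz) (ler_norm _).
have L n : \int[@leb3 R]_(z in slab t1 t2) g n z +
    \int[@leb3 R]_(z in slab t1 t2) (ssgn (eps n) (f z) * material v1 v2 phit phix phiy z) =
    \int[@leb2 R]_(w in @cell R) (ssgn (eps n) (f (t2, w)) * phi (t2, w)) -
    \int[@leb2 R]_(w in @cell R) (ssgn (eps n) (f (t1, w)) * phi (t1, w)).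
  rewrite -(transport_smooth (C1_ssgn (eps0 n))) -RintegralD.
  - by apply: eq_Rintegral => z _; rewrite /g /material; ring.
  - exact: measurable_slab.
  - exact: integrable_slab (gM n).
  - apply: (@integrable_slab _ N); first exact: measurable_funM.
    move=> z sz; rewrite normrM -[N]mul1r ler_pM ?ssgn_le1//; exact: hN.
have c0 : \int[@leb3 R]_(z in slab t1 t2) g n z @[n --> \oo] --> \int[@leb3 R]_(z in slab t1 t2) (cst 0 z : R).
  apply: (@cvg_Rintegral_bounded _ _ _ _ _ _ _ (`|H| * M)) => //.
  - exact: measurable_slab.
  - exact: leb3_slab_lty.
  - apply: aeW => z sz; under eq_fun do rewrite gE//.
    by apply: cvg_mul0; exact: cvg_dssgn.
have c1 : \int[@leb3 R]_(z in slab t1 t2) (ssgn (eps n) (f z) * material v1 v2 phit phix phiy z) @[n --> \oo] -->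
   \int[@leb3 R]_(z in slab t1 t2) (pm (f z) * material v1 v2 phit phix phiy z).
  apply: (@cvg_Rintegral_bounded _ _ _ _ _ _ _ N).
  - exact: measurable_slab.
  - exact: leb3_slab_lty.
  - by move=> n; exact: measurable_funM.
  - apply: measurable_funM => //; apply: measurable_funTS.
    by apply: (measurableT_comp (@measurable_pm R)); exact: measurable_continuous3.
  - by move=> n z sz; rewrite normrM -[N]mul1r ler_pM ?ssgn_le1//; exact: hN.
  - apply: (ae_sub _ null_slab) => z nz sz; apply: cvgMr_tmp; apply: cvg_ssgn; exact: nz.
have := cvg_balance c0 c1 (cvg_slice null2) (cvg_slice null1) L.
by rewrite Rintegral_cst; [rewrite mul0r add0r|exact: measurable_slab].
Qed.

End sign.

End transport_on_slabs.

(** * The profile of the shear flows and its bounds *)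

Section shear_profile.
Context (R : realType).
Implicit Types (k z w x y : R).

Lemma lipschitz_of_derive (F f : R -> R) (K : R) :
  (forall x, is_derive x 1 F (f x)) -> (forall x, `|f x| <= K) ->
  forall x y, `|F x - F y| <= K * `|x - y|.
Proof.
move=> dF fK x y; wlog xy : x y / y <= x.
  move=> W; have [|/ltW] := leP y x; first exact: W.
  by move=> xy; rewrite distrC (distrC x); exact: W.
have cF : continuous F by exact: is_derive1_continuous dF.
have [c _ ->] := MVT_segment xy (fun x _ => dF x) (continuous_subspaceT cF).
by rewrite normrM ler_wpM2r.
Qed.

(** For k > 0 this is the derivative of log(1 + k cos z) / (2 k). The denominator degenerates only
    as k reaches 1, at the change of topology. *)
Definition shear k z : R := - (1 / 2) * (sin z / (1 + k * cos z)).

Definition dshear k z : R := - (1 / 2) * ((cos z + k) / (1 + k * cos z) ^+ 2).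

Lemma shear_den_ge k z : 0 <= k -> 1 - k <= 1 + k * cos z.
Proof. by move=> k0; have := cos_geN1 z; nra. Qed.

Lemma shear_den_gt0 k z : 0 <= k < 1 -> 0 < 1 + k * cos z.
Proof. by move=> /andP[k0 k1]; have := shear_den_ge z k0; lra. Qed.

Lemma is_derive_shear k z : 0 <= k < 1 -> is_derive z 1 (shear k) (dshear k z).
Proof.
move=> kb; have p := shear_den_gt0 z kb.
have d0 : 1 + k * cos z != 0 by rewrite gt_eqF.
have dd : is_derive z 1 (fun z => 1 + k * cos z) (0 + k * - sin z).
  exact: is_derive1D (is_derive1_cst z 1) (is_derive1Ml k (is_derive_cos z)).
have := is_derive1Ml (- (1 / 2)) (@is_derive1M _ _ (fun z => (1 + k * cos z)^-1) _ _ _ (is_derive_sin z) (@is_derive1V _ (fun z => 1 + k * cos z) z _ d0 dd)).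
move=> d; apply: is_derive1_eq d _; rewrite /dshear.
have E : sin z ^+ 2 = 1 - cos z ^+ 2 by rewrite sin2cos2.
transitivity (- (1 / 2) * ((cos z * (1 + k * cos z) + k * sin z ^+ 2) / (1 + k * cos z) ^+ 2)).
  by field.
by rewrite E; congr (_ * (_ / _)); ring.
Qed.

Lemma continuous_shear k : 0 <= k < 1 -> continuous (shear k).
Proof. move=> kb; apply: (@is_derive1_continuous R (shear k) (dshear k)) => z.
exact: (is_derive_shear z kb). Qed.

Lemma continuous_dshear k : 0 <= k < 1 -> continuous (dshear k).
Proof.
move=> kb; apply: continuous_mul; first exact: continuous_const.
apply: continuous_mul.
  by apply: continuous_add; [exact: continuous_cos|exact: continuous_const].
have c : continuous (fun z => 1 + k * cos z).
  apply: continuous_add; first exact: continuous_const.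
  by apply: continuous_mul; [exact: continuous_const|exact: continuous_cos].
apply: (@continuous_inv _ _ (fun z => (1 + k * cos z) ^+ 2)); last exact: continuous_mul.
by move=> z; rewrite sqrf_eq0 gt_eqF// shear_den_gt0.
Qed.

(** After squaring, the claim reduces to (1 + k c)^2 - (1 - k^2) (1 - c^2) = (k + c)^2 >= 0 with c =
    cos z, since W^2 <= 1 - k <= 1 - k^2. *)
Lemma shear_bound k W z : 0 <= k < 1 -> 0 < W -> W ^+ 2 <= 1 - k -> `|shear k z| <= 1 / (2 * W).
Proof.
move=> kb W0 Wk; have p := shear_den_gt0 z kb; have /andP[k0 k1] := kb.
rewrite /shear normrM normrN (ger0_norm (x := 1 / 2))// normrM normfV (gtr0_norm p).
have -> : 1 / (2 * W) = 1 / 2 * W^-1 by field; rewrite gt_eqF.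
rewrite ler_pM2l// ler_pdivrMr// ler_pdivlMl//.
rewrite -(@ler_pXn2r _ 2%N) ?nnegrE ?mulr_ge0//; [|exact: ltW|exact: ltW].
rewrite exprMn real_normK ?num_real// sin2cos2.
have := cos_le1 z; have := cos_geN1 z; move: (cos z) => c c1 c2.
have : 0 <= 1 - c ^+ 2 by nra.
have : W ^+ 2 <= 1 - k ^+ 2 by nra.
have := sqr_ge0 (k + c); nra.
Qed.

(** As |cos z + k| <= 1 + k cos z, one factor of the denominator cancels, and the other is at least
    1 - k. *)
Lemma dshear_bound k z : 0 <= k < 1 -> `|dshear k z| <= 1 / (2 * (1 - k)).
Proof.
move=> kb; have p := shear_den_gt0 z kb; have /andP[k0 k1] := kb.
have k10 : 0 < 1 - k by lra.
have q := shear_den_ge z k0.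
rewrite /dshear normrM normrN (ger0_norm (x := 1 / 2))// normrM normfV.
rewrite (gtr0_norm (x := _ ^+ 2)) ?exprn_gt0//.
have -> : 1 / (2 * (1 - k)) = 1 / 2 * (1 - k)^-1 by field; rewrite gt_eqF.
rewrite ler_pM2l// ler_pdivrMr ?exprn_gt0// ler_pdivlMl//.
have c1 := cos_le1 z; have c2 := cos_geN1 z.
have : `|cos z + k| <= 1 + k * cos z by rewrite ler_norml; apply/andP; split; nra.
by move: `|_ + k| (normr_ge0 (cos z + k)) => n n0 hn; nra.
Qed.

Lemma shear_lipschitz k z w : 0 <= k < 1 ->
  `|shear k z - shear k w| <= 1 / (2 * (1 - k)) * `|z - w|.
Proof.
move=> kb; apply: (@lipschitz_of_derive _ (dshear k)) => x; first exact: is_derive_shear.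
exact: dshear_bound.
Qed.

(** Gives the continuity in time of the velocity, whose time dependence enters through k. *)
Lemma shear_param_lipschitz k1 k2 K z : 0 <= k1 <= K -> 0 <= k2 <= K -> K < 1 ->
  `|shear k1 z - shear k2 z| <= `|k1 - k2| / (1 - K) ^+ 2.
Proof.
move=> /andP[a1 b1] /andP[a2 b2] K1.
have p1 := shear_den_ge z a1; have p2 := shear_den_ge z a2.
have d1 : 0 < 1 - K by lra.
have n1 : 0 < 1 + k1 * cos z by lra.
have n2 : 0 < 1 + k2 * cos z by lra.
have -> : shear k1 z - shear k2 z =
    (k1 - k2) * ((sin z * cos z / 2) / ((1 + k1 * cos z) * (1 + k2 * cos z))).
  by rewrite /shear; field; rewrite !gt_eqF.
rewrite normrM ler_wpM2l//.
rewrite normrM normfV (gtr0_norm (x := _ * (1 + _))) ?mulr_gt0//.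
rewrite ler_pdivrMr ?mulr_gt0// ler_pdivlMl ?exprn_gt0//.
apply: (@le_trans _ _ ((1 - K) ^+ 2)).
  rewrite ler_piMr ?sqr_ge0// normrM (ger0_norm (x := 2^-1))//.
  by rewrite normrM; have := sin_max z; have := cos_max z; have := normr_ge0 (sin z); have := normr_ge0 (cos z); nra.
by rewrite expr2 ler_pM //; lra.
Qed.

Lemma sinDn (n : nat) z : sin (z + pi *+ 2 *+ n) = sin z.
Proof. by rewrite (periodicn (@sinD2pi R)). Qed.

Lemma cosDn (n : nat) z : cos (z + pi *+ 2 *+ n) = cos z.
Proof. by rewrite (periodicn (@cosD2pi R)). Qed.

Lemma shear_periodic k z n : shear k (z + pi *+ 2 *+ n) = shear k z.
Proof. by rewrite /shear sinDn cosDn. Qed.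

End shear_profile.

(** * The striped phase, its velocity field and the transport identity *)

Section stripes.
Context (R : realType).
Variables (a b : R) (Na Nb : nat).
Hypotheses (a0 : 0 < a) (b0 : 0 < b).
Hypotheses (aN : a * Num.sqrt 2 = pi *+ 2 *+ Na) (bN : b = pi *+ 2 *+ Nb).

(* [v] selects the direction whose amplitude is [k]; the other one is 1. *)
Definition stripes (v : bool) (k x y : R) : R :=
  (if v then k else 1) * cos (a * x) + (if v then 1 else k) * cos (b * y).

(** With [vel2], a superposition of two shear flows: one is directed along the lines a x - b y =
    const and constant on them, the other likewise for a x + b y = const. Each is divergence
    free. *)
Definition vel1 (k c x y : R) : R :=
  c / a * (shear k (a * x - b * y) + shear k (a * x + b * y)).

Definition vel2 (k c x y : R) : R :=
  c / b * (shear k (a * x - b * y) - shear k (a * x + b * y)).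

Definition stripes_rate (v : bool) (k x y : R) : R :=
  (if v then cos (b * y) * (k * cos (b * y) + cos (a * x))
   else cos (a * x) * (k * cos (a * x) + cos (b * y))) /
  ((1 + k * cos (a * x - b * y)) * (1 + k * cos (a * x + b * y))).

(** The material derivative of the phase is a multiple of the phase, so the nodal lines are carried
    by the flow although the phase itself is not. Addition formulas turn the claim into an algebraic
    identity in the sines and cosines of a x and b y. *)
Lemma stripes_transport v k dk x y : 0 <= k < 1 ->
  let c := if v then dk else - dk in
  dk * (if v then cos (a * x) else cos (b * y)) +
  (vel1 k c x y * ((if v then k else 1) * (- sin (a * x) * a)) +
   vel2 k c x y * ((if v then 1 else k) * (- sin (b * y) * b))) =
  stripes v k x y * (dk * stripes_rate v k x y).
Proof.
move=> kb /=; have d1 := shear_den_gt0 (a * x - b * y) kb.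
have d2 := shear_den_gt0 (a * x + b * y) kb.
rewrite /vel1 /vel2 /stripes /stripes_rate /shear.
move: d1 d2; rewrite cosB cosD sinB sinD.
have X : sin (a * x) ^+ 2 = 1 - cos (a * x) ^+ 2 by rewrite sin2cos2.
have Y : sin (b * y) ^+ 2 = 1 - cos (b * y) ^+ 2 by rewrite sin2cos2.
move: (cos (a * x)) (cos (b * y)) (sin (a * x)) (sin (b * y)) X Y => P q sx sy X Y.
move=> d1 d2; have an : a != 0 by rewrite gt_eqF.
have bn : b != 0 by rewrite gt_eqF.
set D1 := 1 + _ in d1 *; set D2 := 1 + _ in d2 *.
have D1n : D1 != 0 by rewrite gt_eqF.
have D2n : D2 != 0 by rewrite gt_eqF.
(* Once the denominators are cleared, the sines occur through their squares only, which [X] and [Y]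
   eliminate. *)
have E1 : D1 * D2 = (1 + k * (P * q)) ^+ 2 - k ^+ 2 * (sx ^+ 2 * sy ^+ 2) by rewrite /D1 /D2; ring.
have E2 : (sx * q - P * sy) * (k * sx + sy) * D2 + (sx * q + P * sy) * (k * sx - sy) * D1 =
    2 * ((1 + k * (P * q)) * (k * q * sx ^+ 2 - P * sy ^+ 2) + k * (sx ^+ 2 * sy ^+ 2) * (k * P - q)).
  by rewrite /D1 /D2; ring.
have E3 : (sx * q - P * sy) * (sx + k * sy) * D2 + (sx * q + P * sy) * (sx - k * sy) * D1 =
    2 * ((1 + k * (P * q)) * (q * sx ^+ 2 - k * P * sy ^+ 2) + k * (sx ^+ 2 * sy ^+ 2) * (P - k * q)).
  by rewrite /D1 /D2; ring.
case: v => /=.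
  transitivity (dk * (P * (D1 * D2) + 1 / 2 * ((sx * q - P * sy) * (k * sx + sy) * D2 + (sx * q + P * sy) * (k * sx - sy) * D1)) / (D1 * D2)).
    by field; rewrite an bn D1n D2n.
  transitivity (dk * ((k * P + q) * (q * (k * q + P))) / (D1 * D2)); last by field; rewrite D1n D2n.
  congr (dk * _ / _).
  by rewrite E1 E2 X Y; field.
transitivity (dk * (q * (D1 * D2) - 1 / 2 * ((sx * q - P * sy) * (sx + k * sy) * D2 + (sx * q + P * sy) * (sx - k * sy) * D1)) / (D1 * D2)).
  by field; rewrite an bn D1n D2n.
transitivity (dk * ((P + k * q) * (P * (k * P + q))) / (D1 * D2)); last by field; rewrite D1n D2n.
congr (dk * _ / _).
by rewrite E1 E3 X Y; field.
Qed.

Lemma stripes_rate_bound v k K x y : 0 <= k <= K -> K < 1 ->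
  `|stripes_rate v k x y| <= 2 / (1 - K) ^+ 2.
Proof.
move=> /andP[k0 kK] K1.
have p1 := shear_den_ge (a * x - b * y) k0; have p2 := shear_den_ge (a * x + b * y) k0.
rewrite /stripes_rate normrM normfV ler_pM ?invr_ge0 //.
  have B (P q : R) : `|P| <= 1 -> `|q| <= 1 -> `|q * (k * q + P)| <= 2.
    move=> hP hq; rewrite normrM; apply: (@le_trans _ _ (1 * 2)); last by rewrite mul1r.
    rewrite ler_pM//; apply: le_trans (ler_normD _ _) _; rewrite normrM ger0_norm//.
    by have := normr_ge0 q; nra.
  by case: v; apply: B; exact: cos_max.
rewrite gtr0_norm; last by rewrite mulr_gt0//; lra.
rewrite lef_pV2 ?posrE ?exprn_gt0 ?mulr_gt0//; try lra.
by rewrite expr2 ler_pM//; lra.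
Qed.

Lemma stripes_periodic_x v k y : stripes v k (Num.sqrt 2) y = stripes v k 0 y.
Proof. by rewrite /stripes aN mulr0 -[pi *+ 2 *+ Na]add0r cosDn. Qed.

Lemma stripes_periodic_y v k x : stripes v k x 1 = stripes v k x 0.
Proof. by rewrite /stripes mulr1 mulr0 {1}bN -[pi *+ 2 *+ Nb]add0r cosDn. Qed.

Let dphase1 (s x y : R) : is_derive x 1 (fun x => a * x + s * (b * y)) a.
Proof.
apply: is_derive1_eq (is_derive1D (is_derive1_scale a x) (is_derive1_cst x (s * (b * y)))) _.
by rewrite addr0.
Qed.

Let dphase2 (s x y : R) : is_derive y 1 (fun y => a * x + s * (b * y)) (s * b).
Proof.
apply: is_derive1_eq (is_derive1D (is_derive1_cst y (a * x)) (is_derive1Ml s (is_derive1_scale b y))) _.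
by rewrite add0r.
Qed.

Let vel1E k c x y : vel1 k c x y = c / a * (shear k (a * x + -1 * (b * y)) + shear k (a * x + 1 * (b * y))).
Proof. by rewrite mulN1r mul1r. Qed.

Let vel2E k c x y : vel2 k c x y = c / b * (shear k (a * x + -1 * (b * y)) + - shear k (a * x + 1 * (b * y))).
Proof. by rewrite mulN1r mul1r. Qed.

Let cphase s : continuous (fun z : R * R => a * z.1 + s * (b * z.2)).
Proof.
apply: continuous_add; apply: continuous_mul; try exact: continuous_const.
  by move=> z; exact: cvg_fst.
by apply: continuous_mul; [exact: continuous_const|move=> z; exact: cvg_snd].
Qed.

Lemma solenoidal_vel k c : 0 <= k < 1 ->
  exists v1x v2y, solenoidal_cell (fun w => vel1 k c w.1 w.2) (fun w => vel2 k c w.1 w.2) v1x v2y.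
Proof.
move=> kb; have an : a != 0 by rewrite gt_eqF.
have bn : b != 0 by rewrite gt_eqF.
have cs s : continuous (fun z : R * R => shear k (a * z.1 + s * (b * z.2))).
  exact: (continuous_compr (continuous_shear kb) (@cphase s)).
have cd s : continuous (fun z : R * R => dshear k (a * z.1 + s * (b * z.2))).
  exact: (continuous_compr (continuous_dshear kb) (@cphase s)).
exists (fun z => c / a * (dshear k (a * z.1 + -1 * (b * z.2)) * a + dshear k (a * z.1 + 1 * (b * z.2)) * a)).
exists (fun z => c / b * (dshear k (a * z.1 + -1 * (b * z.2)) * (-1 * b) + - (dshear k (a * z.1 + 1 * (b * z.2)) * (1 * b)))).
have cc r : continuous (fun _ : R * R => r : R) by exact: continuous_const.
split.
- under eq_fun do rewrite vel1E; exact: (continuous_mul (cc _) (continuous_add (cs _) (cs _))).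
- under eq_fun do rewrite vel2E; exact: (continuous_mul (cc _) (continuous_add (cs _) (continuous_opp (cs _)))).
- exact: (continuous_mul (cc _) (continuous_add (continuous_mul (cd _) (cc _)) (continuous_mul (cd _) (cc _)))).
- exact: (continuous_mul (cc _) (continuous_add (continuous_mul (cd _) (cc _)) (continuous_opp (continuous_mul (cd _) (cc _))))).
- move=> x y /=; under eq_fun do rewrite vel1E.
  have d s := @is_derive1_compf R (shear k) (fun x => a * x + s * (b * y)) x _ _ (is_derive_shear (a * x + s * (b * y)) kb) (dphase1 s x y).
  exact: (is_derive1Ml (c / a) (is_derive1D (d (-1)) (d 1))).
- move=> x y /=; under eq_fun do rewrite vel2E.
  have d s := @is_derive1_compf R (shear k) (fun y => a * x + s * (b * y)) y _ _ (is_derive_shear (a * x + s * (b * y)) kb) (dphase2 s x y).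
  exact: (is_derive1Ml (c / b) (is_derive1D (d (-1)) (is_derive1N (d 1)))).
- by move=> z; field; rewrite an bn.
- by move=> y; rewrite /= /vel1 aN mulr0 !(addrC (pi *+ 2 *+ Na)) !shear_periodic !add0r.
- move=> x /=; have e1 : shear k (a * x - b) = shear k (a * x).
    by rewrite -(shear_periodic k (a * x - b) Nb) -bN subrK.
  have e2 : shear k (a * x + b) = shear k (a * x) by rewrite {1}bN shear_periodic.
  by rewrite /vel2 mulr1 mulr0 subr0 addr0 e1 e2.
Qed.

Lemma vel1_bound k c W x y : 0 <= k < 1 -> 0 < W -> W ^+ 2 <= 1 - k ->
  `|vel1 k c x y| <= `|c| / (a * W).
Proof.
move=> kb W0 Wk; rewrite /vel1 normrM normrM normfV (gtr0_norm a0).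
have -> : `|c| / (a * W) = `|c| / a * (1 / (2 * W) + 1 / (2 * W)) by field; rewrite !gt_eqF.
rewrite ler_wpM2l ?divr_ge0 ?(ltW a0)//.
by apply: le_trans (ler_normD _ _) _; rewrite lerD// shear_bound.
Qed.

Lemma vel2_bound k c W x y : 0 <= k < 1 -> 0 < W -> W ^+ 2 <= 1 - k ->
  `|vel2 k c x y| <= `|c| / (b * W).
Proof.
move=> kb W0 Wk; rewrite /vel2 normrM normrM normfV (gtr0_norm b0).
have -> : `|c| / (b * W) = `|c| / b * (1 / (2 * W) + 1 / (2 * W)) by field; rewrite !gt_eqF.
rewrite ler_wpM2l ?divr_ge0 ?(ltW b0)//.
by apply: le_trans (ler_normB _ _) _; rewrite lerD// shear_bound.
Qed.

Let phase_dist x y x' y' (s : R) : `|s| = 1 ->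
  `|(a * x + s * (b * y)) - (a * x' + s * (b * y'))| <= a * `|x - x'| + b * `|y - y'|.
Proof.
move=> s1; have -> : (a * x + s * (b * y)) - (a * x' + s * (b * y')) = a * (x - x') + s * (b * (y - y')) by ring.
apply: le_trans (ler_normD _ _) _; rewrite !normrM s1 mul1r (gtr0_norm a0) (gtr0_norm b0) lexx.
by [].
Qed.

Let shear_pair_lip k x y x' y' (e s : R) : 0 <= k < 1 -> `|e| = 1 -> `|s| = 1 ->
  `|(shear k (a * x + -1 * (b * y)) + e * shear k (a * x + 1 * (b * y))) -
    (shear k (a * x' + -1 * (b * y')) + e * shear k (a * x' + 1 * (b * y')))|
  <= (1 - k)^-1 * (a * `|x - x'| + b * `|y - y'|).
Proof.
move=> kb e1 _; have k10 : 0 < 1 - k by lra.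
set A := shear k (a * x + _); set B := shear k (a * x + _); set A' := shear k (a * x' + _); set B' := shear k (a * x' + _).
have -> : A + e * B - (A' + e * B') = (A - A') + e * (B - B') by ring.
apply: le_trans (ler_normD _ _) _; rewrite normrM e1 mul1r.
set D := a * _ + b * _.
have -> : (1 - k)^-1 * D = 1 / (2 * (1 - k)) * D + 1 / (2 * (1 - k)) * D.
  by field; rewrite gt_eqF.
have c0 : 0 <= 1 / (2 * (1 - k)) by rewrite divr_ge0//; lra.
by rewrite lerD//; apply: le_trans (shear_lipschitz _ _ kb) _; rewrite ler_wpM2l// phase_dist ?normrN1 ?normr1.
Qed.

Lemma vel1_lipschitz k c x y x' y' : 0 <= k < 1 ->
  `|vel1 k c x y - vel1 k c x' y'| <= `|c| / (a * (1 - k)) * (a * `|x - x'| + b * `|y - y'|).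
Proof.
move=> kb; have k10 : 1 - k != 0 by rewrite gt_eqF//; lra.
rewrite !vel1E -mulrBr normrM normrM normfV (gtr0_norm a0).
have := @shear_pair_lip k x y x' y' 1 1 kb (normr1 _) (normr1 _); rewrite !mul1r => h.
have -> : `|c| / (a * (1 - k)) = `|c| / a * (1 - k)^-1 by field; rewrite k10 gt_eqF.
by rewrite -[leRHS]mulrA ler_wpM2l ?divr_ge0 ?(ltW a0).
Qed.

Lemma vel2_lipschitz k c x y x' y' : 0 <= k < 1 ->
  `|vel2 k c x y - vel2 k c x' y'| <= `|c| / (b * (1 - k)) * (a * `|x - x'| + b * `|y - y'|).
Proof.
move=> kb; have k10 : 1 - k != 0 by rewrite gt_eqF//; lra.
rewrite !vel2E -mulrBr normrM normrM normfV (gtr0_norm b0).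
have := @shear_pair_lip k x y x' y' (-1) 1 kb (normrN1 _) (normr1 _); rewrite !mulN1r !mul1r => h.
have -> : `|c| / (b * (1 - k)) = `|c| / b * (1 - k)^-1 by field; rewrite k10 gt_eqF.
by rewrite -[leRHS]mulrA ler_wpM2l ?divr_ge0 ?(ltW b0).
Qed.

End stripes.

(** * Measures of sets in a product bounded through their sections *)

Section product_measure_bounds.
Context d1 d2 (T1 : measurableType d1) (T2 : measurableType d2) (R : realType).
Variables (m1 : {sigma_finite_measure set T1 -> \bar R})
          (m2 : {sigma_finite_measure set T2 -> \bar R}).
Local Open Scope ereal_scope.

Lemma product_measure_xsection_le (A : set (T1 * T2)) (B : set T1) (c : \bar R) :
  measurable A -> measurable B -> 0 <= c -> A `<=` B `*` setT ->
  (forall x, B x -> m2 (xsection A x) <= c) -> (m1 \x m2) A <= c * m1 B.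
Proof.
move=> mA mB c0 AB h.
rewrite -[leLHS]/(\int[m1]_x m2 (xsection A x)) -integral_cst//.
rewrite [leRHS]integral_mkcond; apply: ge0_le_integral => //.
- exact: measurable_fun_xsection.
- by apply/(measurable_restrictT _ mB); exact: measurable_cst.
- move=> x _; rewrite patchE; case: ifPn => [/set_mem|/negP nB]; first exact: h.
  rewrite (_ : xsection A x = set0) ?measure0//; apply/seteqP; split=> // y.
  by rewrite /xsection/= inE => /AB[/= Bx _]; case: nB; exact/mem_set.
Qed.

(** The product measure is defined by integrating x-sections; Tonelli for the indicator of A
    provides the formula with y-sections. *)
Lemma product_measure_ysection_le (A : set (T1 * T2)) (B : set T2) (c : \bar R) :
  measurable A -> measurable B -> 0 <= c -> A `<=` setT `*` B ->
  (forall y, B y -> m1 (ysection A y) <= c) -> (m1 \x m2) A <= c * m2 B.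
Proof.
move=> mA mB c0 AB h.
have -> : (m1 \x m2) A = \int[m2]_y m1 (ysection A y).
  transitivity (\int[m1 \x m2]_z (\1_A z)%:E); first by rewrite integral_indic// setIT.
  rewrite (fubini_tonelli2 (EFin \o \1_A)); last 2 first.
  - by apply/measurable_EFinP; exact: measurable_indic.
  - by move=> z; rewrite /= lee_fin.
  by rewrite indic_fubini_tonelli_GE.
rewrite -integral_cst// [leRHS]integral_mkcond; apply: ge0_le_integral => //.
- exact: measurable_fun_ysection.
- by apply/(measurable_restrictT _ mB); exact: measurable_cst.
- move=> x _; rewrite patchE; case: ifPn => [/set_mem|/negP nB]; first exact: h.
  rewrite (_ : ysection A x = set0) ?measure0//; apply/seteqP; split=> // y.
  by rewrite /ysection/= inE => /AB[/= _ Bx]; case: nB; exact/mem_set.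
Qed.

End product_measure_bounds.

(** * Zeros and sign changes of A cos(w x) + B *)

Section cosine_zeros.
Context (R : realType).
Implicit Types (x y z : R).

(** Translations by multiples of pi, each flipping the sign of the cosine, reduce this to
    injectivity on [0, pi]; negative indices follow by evenness. *)
Lemma cos_half_period_inj (i : int) x y :
  i%:~R * pi <= x <= (i + 1)%:~R * pi -> i%:~R * pi <= y <= (i + 1)%:~R * pi ->
  cos x = cos y -> x = y.
Proof.
have nat_case (n : nat) (u v : R) : n%:R * pi <= u <= n.+1%:R * pi ->
    n%:R * pi <= v <= n.+1%:R * pi -> cos u = cos v -> u = v.
  move=> /andP[u1 u2] /andP[v1 v2] uv.
  have E (w : R) : cos w = (-1) ^+ n * cos (w - pi *+ n).
    by have := alternatingn (@cosDpi R) n (w - pi *+ n); rewrite subrK.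
  have S : n.+1%:R * pi = n%:R * pi + pi :> R by rewrite -natr1 mulrDl mul1r.
  apply: (@addIr _ (- (pi *+ n))); apply: cos_inj.
  - by rewrite in_itv/= -mulr_natl; apply/andP; split; lra.
  - by rewrite in_itv/= -mulr_natl; apply/andP; split; lra.
  - by move: uv; rewrite (E u) (E v) => /(mulfI _); apply; rewrite signr_eq0.
case: i => n; first by rewrite addrC -intS => a b; exact: (nat_case n).
rewrite NegzE => a b e; apply: oppr_inj; apply: (nat_case n); rewrite ?cosN //.
- move: a; rewrite intrD rmorphN/= -[n.+1%:~R]/(n.+1%:R) -natr1; lra.
- move: b; rewrite intrD rmorphN/= -[n.+1%:~R]/(n.+1%:R) -natr1; lra.
Qed.

Variables (A B w : R) (A0 : A != 0) (w0 : 0 < w).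

(** Each half-period has at most one zero; where there is none, the default 0 merely adds a point to
    the enumeration. *)
Definition cos_zero (i : int) : R :=
  xget 0 [set x | i%:~R * pi <= w * x <= (i + 1)%:~R * pi /\ A * cos (w * x) + B = 0].

Lemma cos_zeroE (i : int) x : i%:~R * pi <= w * x <= (i + 1)%:~R * pi ->
  A * cos (w * x) + B = 0 -> x = cos_zero i.
Proof.
move=> xi x0; rewrite /cos_zero; case: xgetP => [y -> [yi y0]|/(_ x)]; last by case.
apply: (mulfI (lt0r_neq0 w0)); apply: (cos_half_period_inj xi yi).
by apply: (mulfI A0); apply: (addIr B); rewrite x0 y0.
Qed.

Lemma cos_zeroP x : A * cos (w * x) + B = 0 -> x = cos_zero (Num.floor (w * x / pi)).
Proof.
move=> x0; apply: cos_zeroE => //.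
by have /andP[a b] := floor_itv (w * x / pi); rewrite -ler_pdivlMr ?pi_gt0// a -ler_pdivrMr ?pi_gt0// ltW.
Qed.

Lemma cos_level_null : lebesgue_measure [set x | A * cos (w * x) + B = 0] = 0%E.
Proof.
apply: countable_lebesgue_measure0.
apply: (@sub_countable _ _ _ (range cos_zero)).
  by apply: subset_card_le => x /= x0; exists (Num.floor (w * x / pi)) => //; rewrite -cos_zeroP.
by apply: card_le_trans (card_image_le _ _) _; exact: countableP.
Qed.

End cosine_zeros.

(** Serves to index the half-periods numbered from -K to K - 1 by naturals below 2 K. *)
Lemma absz_shift (i : int) (K : nat) : (- K%:Z <= i < K%:Z)%R ->
  (absz (i + K%:Z)%R < K + K)%N /\ (absz (i + K%:Z)%R)%:Z - K%:Z = i.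
Proof. by move=> /andP[]; lia. Qed.

Section sign_switches.
Context (R : realType).

(** Makes the set where two signs disagree the preimage of a point under a measurable product. *)
Lemma pm_neq (u v : R) : (pm u != pm v) = (pm u * pm v == -1).
Proof.
have n1 : (1 == -1 :> R) = false by apply/negbTE; rewrite -subr_eq0 opprK; apply: lt0r_neq0.
by rewrite /pm; case: ifP; case: ifP => _ _;
  rewrite ?eqxx ?mulr1 ?mulrN ?mulNr ?mulr1 ?opprK ?n1 ?eqxx// eq_sym n1.
Qed.

Lemma measurable_pm_neq d (T : measurableType d) (F G : T -> R) :
  measurable_fun setT F -> measurable_fun setT G ->
  measurable [set z | pm (F z) != pm (G z)].
Proof.
move=> mF mG.
rewrite (_ : [set z | _] = (fun z => pm (F z) * pm (G z)) @^-1` [set -1]).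
  rewrite -[X in measurable X]setTI; apply: measurable_funM => //;
    exact: (measurableT_comp (@measurable_pm R)).
by apply/seteqP; split=> z /=; rewrite pm_neq => /eqP.
Qed.

Let pm_switch_zero_le (f : R -> R) (x y : R) : continuous f -> x <= y ->
  pm (f x) != pm (f y) -> exists2 z, f z = 0 & x <= z <= y.
Proof.
move=> cf xy ne.
have [|z zi z0] := IVT xy (continuous_subspaceT cf) (v := 0); last by exists z.
rewrite ge_min le_max; move: ne; rewrite /pm.
case: ifPn => [fx|]; case: ifPn => [fy|]; rewrite ?eqxx// -leNgt => h _.
  by rewrite h orbT (ltW fx).
by rewrite h (ltW fy) orbT.
Qed.

Lemma pm_switch_zero (f : R -> R) (x h : R) : continuous f ->
  pm (f (x + h)) != pm (f x) -> exists2 z, f z = 0 & `|x - z| <= `|h|.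
Proof.
move=> cf; have [h0|h0] := leP 0 h.
  rewrite eq_sym => /(pm_switch_zero_le cf) [|z z0 /andP[a b]]; first by rewrite lerDl.
  by exists z => //; rewrite ler_norml ger0_norm//; lra.
move=> /(pm_switch_zero_le cf) [|z z0 /andP[a b]]; first by rewrite gerDl ltW.
by exists z => //; rewrite ler_norml ltr0_norm//; lra.
Qed.

(** A sign change between x and x + h forces a zero within |h| of x. For |h| <= 1 these zeros lie in
    [-(L+1), L+1], at most one per half-period, so the set is covered by 2 K intervals of length 2
    |h|. *)
Lemma switch_measure (A B w L h : R) : 1 <= w -> 0 <= L ->
  (lebesgue_measure [set x : R | (0 <= x < L)%R /\
     (pm (A * cos (w * (x + h)) + B) != pm (A * cos (w * x) + B))%R]
   <= (4 * w * (L + 3) * `|h|)%:E)%E.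
Proof.
move=> w1 L0; set S := (X in lebesgue_measure X).
have w0 : 0 < w by lra.
have h0 := normr_ge0 h.
have cf : continuous (fun x => A * cos (w * x) + B).
  apply: continuous_add; last exact: continuous_const.
  apply: continuous_mul; first exact: continuous_const.
  apply: (continuous_compr (@continuous_cos R)).
  by apply: continuous_mul; [exact: continuous_const|move=> x; exact: cvg_id].
have cfh : continuous (fun x => A * cos (w * (x + h)) + B).
  apply: (@continuous_compr _ _ (fun x => A * cos (w * x) + B) (fun x => x + h) cf).
  by apply: continuous_add; [move=> x; exact: cvg_id|exact: continuous_const].
have mS : measurable S.
  apply: (@measurableI _ _ [set x : R | 0 <= x < L]).
    rewrite (_ : [set x | _] = `[0, L[%classic); first exact: measurable_itv.
    by apply/seteqP; split=> x /=; rewrite in_itv.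
  by apply: measurable_pm_neq; exact: continuous_measurable_fun.
have [A0|A0] := eqVneq A 0.
  have -> : S = set0 by apply/seteqP; split=> x //= -[_]; rewrite A0 !mul0r eqxx.
  by rewrite measure0 lee_fin !mulr_ge0//; lra.
(* For |h| > 1 the bound exceeds the length L of the whole interval. *)
have [h1|h1] := ltP 1 `|h|.
  apply: (@le_trans _ _ (lebesgue_measure (`[0%R, L[%classic : set (measurableTypeR R)))).
    apply: le_measure; rewrite ?inE//.
    by move=> x /= []; rewrite in_itv.
  rewrite lebesgue_measure_itv/=; case: ifP => _; last by rewrite lee_fin !mulr_ge0//; lra.
  rewrite oppr0 adde0 lee_fin; have wh : 1 <= w * `|h| by nra.
  have -> : 4 * w * (L + 3) * `|h| = 4 * (w * `|h|) * (L + 3) by ring.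
  by nra.
(* [K] exceeds the number of half-periods that fit in [0, L + 1]; it is at most w (L + 2) because pi
   and w are at least 1. *)
pose K := (Num.trunc (w * (L + 1) / pi)).+1.
have p0 := @pi_gt0 R; have p2 := @pi_ge2 R.
have q0 : 0 <= w * (L + 1) / pi by rewrite divr_ge0 ?mulr_ge0//; lra.
have [K1 K2] : w * (L + 1) / pi < K%:R /\ K%:R <= w * (L + 2).
  have /andP[t1 t2] := truncn_itv q0; split=> //.
  rewrite /K -natr1.
  have wL : 0 <= w * (L + 1) by rewrite mulr_ge0//; lra.
  have : w * (L + 1) / pi <= w * (L + 1) by rewrite ler_pdivrMr// ler_peMr//; lra.
  lra.
pose c (j : nat) : R := cos_zero A B w (j%:Z - K%:Z).
pose F (j : nat) : set (measurableTypeR R) := `[c j - `|h|, c j + `|h|]%classic.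
have SF : S `<=` \big[setU/set0]_(j < (K + K)%N) F j.
  move=> x [/= xL].
  move=> /(@pm_switch_zero (fun x => A * cos (w * x) + B) x h cf)[z z0 xz].
  have zb : - (L + 1) <= z <= L + 1 by move: xz; rewrite ler_norml; lra.
  rewrite (cos_zeroP A0 w0 z0) in xz.
  set i := Num.floor _ in xz.
  have iK : (- K%:Z <= i < K%:Z)%R.
    rewrite -(ler_int R) -(ltr_int R) rmorphN/=.
    have /andP[i1 i2] := floor_itv (w * z / pi); rewrite -/i intrD in i1 i2.
    have zz : - (w * (L + 1) / pi) <= w * z / pi <= w * (L + 1) / pi.
      by rewrite -mulNr !ler_pM2r ?invr_gt0// -mulrN !ler_pM2l.
    apply/andP; split; last by apply: le_lt_trans K1; lra.
    rewrite -[leRHS]/(i%:~R) -(rmorphN (intmul 1)) ler_int.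
    rewrite -lerN2 opprK -ltzD1 -(ltr_int R) intrD rmorphN/=.
    by move: K1; rewrite -[K%:R]/(K%:~R); lra.
  rewrite -bigcup_mkord; exists (absz (i + K%:Z)%R).
    exact: (absz_shift iK).1.
  rewrite /F /c (absz_shift iK).2.
  by rewrite /= in_itv/=; move: xz; rewrite ler_norml; lra.
have FE j : lebesgue_measure (F j) = (`|h| *+ 2)%:E.
  rewrite /F lebesgue_measure_itv/= lte_fin; case: ltP => [_|le].
    by rewrite -EFinB; congr EFin; rewrite mulr2n; ring.
  by congr EFin; lra.
apply: (@le_trans _ _ (\sum_(j < (K + K)%N) lebesgue_measure (F j))%E).
  apply: (@content_subadditive _ _ _ (@lebesgue_measure R) S F) => // j _.
  exact: measurable_itv.
under eq_bigr do rewrite FE.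
rewrite sumEFin sumr_const card_ord lee_fin -mulrnA -[leLHS]mulr_natr natrM natrD.
by apply: (@le_trans _ _ (`|h| * (2 * (w * (L + 2) + w * (L + 2))))); nra.
Qed.

End sign_switches.

Lemma ae_of_null d (T : measurableType d) (R : realType) (mu : {measure set T -> \bar R})
    (N : set T) (P : T -> Prop) :
  measurable N -> mu N = 0%E -> (forall x, ~ N x -> P x) -> {ae mu, forall x, P x}.
Proof.
by move=> mN N0 h; exists N; split=> // x /= nP; apply: contrapT => /h.
Qed.

Section section_bounds.
Context (R : realType).
Local Open Scope ereal_scope.

Lemma leb2_xsection_le (A : set (plane R)) (B : set (measurableTypeR R)) (c : \bar R) :
  measurable A -> measurable B -> 0 <= c -> A `<=` B `*` setT ->
  (forall x, B x -> lebesgue_measure (xsection A x : set (measurableTypeR R)) <= c) ->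
  leb2 A <= c * lebesgue_measure B.
Proof. exact: (@product_measure_xsection_le _ _ _ _ R (@lebesgue_measure R) (@lebesgue_measure R)). Qed.

Lemma leb2_ysection_le (A : set (plane R)) (B : set (measurableTypeR R)) (c : \bar R) :
  measurable A -> measurable B -> 0 <= c -> A `<=` setT `*` B ->
  (forall y, B y -> lebesgue_measure (ysection A y : set (measurableTypeR R)) <= c) ->
  leb2 A <= c * lebesgue_measure B.
Proof. exact: (@product_measure_ysection_le _ _ _ _ R (@lebesgue_measure R) (@lebesgue_measure R)). Qed.

Lemma leb3_xsection_le (A : set (R_plane R)) (B : set (measurableTypeR R)) (c : \bar R) :
  measurable A -> measurable B -> 0 <= c -> A `<=` B `*` setT ->
  (forall t, B t -> leb2 (xsection A t : set (plane R)) <= c) ->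
  leb3 A <= c * lebesgue_measure B.
Proof. exact: (@product_measure_xsection_le _ _ _ _ R (@lebesgue_measure R) (@leb2 R)). Qed.

Lemma leb2_null_xsection (A : set (plane R)) : measurable A ->
  (forall x, lebesgue_measure (xsection A x : set (measurableTypeR R)) = 0) -> leb2 A = 0.
Proof.
move=> mA h; apply/eqP; rewrite eq_le measure_ge0 andbT -[leRHS](mul0e (@lebesgue_measure R setT)).
by apply: leb2_xsection_le => // x _; rewrite h.
Qed.

Lemma leb2_null_ysection (A : set (plane R)) : measurable A ->
  (forall y, lebesgue_measure (ysection A y : set (measurableTypeR R)) = 0) -> leb2 A = 0.
Proof.
move=> mA h; apply/eqP; rewrite eq_le measure_ge0 andbT -[leRHS](mul0e (@lebesgue_measure R setT)).
by apply: leb2_ysection_le => // x _; rewrite h.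
Qed.

Lemma leb3_null_xsection (A : set (R_plane R)) : measurable A ->
  (forall t, leb2 (xsection A t : set (plane R)) = 0) -> leb3 A = 0.
Proof.
move=> mA h; apply/eqP; rewrite eq_le measure_ge0 andbT -[leRHS](mul0e (@lebesgue_measure R setT)).
by apply: leb3_xsection_le => // x _; rewrite h.
Qed.

End section_bounds.

(** * Nodal sets of the phases are null *)

Section stripes_regularity.
Context (R : realType).
Variables (a b : R) (a0 : 0 < a) (b0 : 0 < b).

Lemma stripes_continuous v (k : R * (R * R) -> R) : continuous k ->
  continuous (fun z => stripes a b v (k z) z.2.1 z.2.2).
Proof.
move=> ck; have cc r : continuous (fun _ : R * (R * R) => r : R) by exact: continuous_const.
have c21 : continuous (fun z : R * (R * R) => z.2.1).
  by move=> z; apply: (@continuous_comp _ _ _ snd fst); [exact: cvg_snd|exact: cvg_fst].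
have c22 : continuous (fun z : R * (R * R) => z.2.2).
  by move=> z; apply: (@continuous_comp _ _ _ snd snd); exact: cvg_snd.
have ca := continuous_compr (@continuous_cos R) (continuous_mul (cc a) c21).
have cb := continuous_compr (@continuous_cos R) (continuous_mul (cc b) c22).
by case: v; apply: continuous_add; apply: continuous_mul.
Qed.

Lemma stripes_continuous2 v k : continuous (fun w : R * R => stripes a b v k w.1 w.2).
Proof.
have := @stripes_continuous v (fun=> k) (@continuous_const _ _ k).
by move/(continuous_pairr (x := 0)).
Qed.

Lemma measurable_zero_set d (T : measurableType d) (f : T -> R) :
  measurable_fun setT f -> measurable [set x | f x = 0].
Proof. by move=> mf; rewrite -[X in measurable X]setTI; exact: (mf measurableT [set 0]). Qed.

(** Sections are taken along the coordinate whose wave has amplitude 1, so that each is the zero set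
    of a nondegenerate cosine plus a constant even when k = 0. *)
Lemma stripes_null2 v k : leb2 ([set w | stripes a b v k w.1 w.2 = 0] : set (plane R)) = 0%E.
Proof.
have mN : measurable ([set w | stripes a b v k w.1 w.2 = 0] : set (plane R)).
  by apply: measurable_zero_set; apply: measurable_continuous2; exact: stripes_continuous2.
case: v mN => mN.
  apply: (leb2_null_xsection mN) => x.
  rewrite -(@cos_level_null R 1 (k * cos (a * x)) b (oner_neq0 _) b0).
  rewrite (_ : xsection _ x = [set y | 1 * cos (b * y) + k * cos (a * x) = 0])//.
  by apply/seteqP; split=> y /=; rewrite /xsection/= inE /stripes/= addrC.
apply: (leb2_null_ysection mN) => y.
rewrite -(@cos_level_null R 1 (k * cos (b * y)) a (oner_neq0 _) a0).
rewrite (_ : ysection _ y = [set x | 1 * cos (a * x) + k * cos (b * y) = 0])//.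
by apply/seteqP; split=> x /=; rewrite /ysection/= inE /stripes.
Qed.

Lemma stripes_ae_neq0 v k : {ae (@leb2 R), forall w, stripes a b v k w.1 w.2 != 0}.
Proof.
apply: (@ae_of_null _ (plane R) R (@leb2 R) [set w | stripes a b v k w.1 w.2 = 0]).
- by apply: measurable_zero_set; apply: measurable_continuous2; exact: stripes_continuous2.
- exact: stripes_null2.
- by move=> w /= /eqP.
Qed.

Lemma stripes_ae_neq0_time v (k : R -> R) : continuous k ->
  {ae (@leb3 R), forall z, stripes a b v (k z.1) z.2.1 z.2.2 != 0}.
Proof.
move=> ck; have cF : continuous (fun z : R * (R * R) => stripes a b v (k z.1) z.2.1 z.2.2).
  by apply: stripes_continuous; apply: (continuous_compr ck) => z; exact: cvg_fst.
have mN : measurable ([set z | stripes a b v (k z.1) z.2.1 z.2.2 = 0] : set (R_plane R)).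
  by apply: measurable_zero_set; exact: measurable_continuous3.
apply: (@ae_of_null _ (R_plane R) R (@leb3 R) _ _ mN) => [|z /= /eqP//].
apply: (leb3_null_xsection mN) => t; rewrite -(stripes_null2 v (k t)).
rewrite (_ : xsection _ t = [set w | stripes a b v (k t) w.1 w.2 = 0])//.
by apply/seteqP; split=> x /=; rewrite /xsection/= inE.
Qed.

End stripes_regularity.

(** * Timing, amplitudes and frequencies of the stages *)

Section schedule.
Context (R : realType).
Variables (rho : R) (g : nat).
Hypotheses (rho01 : 0 < rho < 1) (g0 : (0 < g)%N).

(** Stages shrink geometrically and accumulate at 1/2, the time of dissipation. *)
Definition tau (n : nat) : R := (1 - rho ^+ n) / 2.
Definition dur (n : nat) : R := rho ^+ n * (1 - rho) / 2.

(* [gap] runs over [0, 1], with 0 at the time of the change of topology. *)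
Definition gap (n : nat) (t : R) : R :=
  (if odd n then t - tau n else tau n.+1 - t) / dur n.
Definition dgap (n : nat) : R := (if odd n then 1 else -1) / dur n.
(** The amplitude is flat of order 2 g at the value 1, where the shear profile degenerates. *)
Definition kap n t : R := 1 - gap n t ^+ g.*2.
Definition dkap n t : R := - (g.*2%:R * gap n t ^+ g.*2.-1 * dgap n).
(** Each frequency doubles every four stages, two stages apart from the other, so both grow like
    2^(n/4). Their ratio alternates between sqrt 2 and 1 / sqrt 2, which makes the construction
    self-similar. *)
Definition freqx (n : nat) : R := pi *+ 2 * Num.sqrt 2 * 2 ^+ (n %/ 4).
Definition freqy (n : nat) : R := pi *+ 2 * 2 ^+ ((n + 2) %/ 4).
(** In a cycle of four stages the wave in x appears, the wave in y fades, the wave in y reappears at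
    double frequency, and the wave in x fades; the x amplitude varies in the first and the last. *)
Definition along_x (n : nat) : bool := (n %% 4 == 0)%N || (n %% 4 == 3)%N.
(** The sign is the one required by [stripes_transport]. *)
Definition speed n t : R := if along_x n then dkap n t else - dkap n t.

Lemma durE n : tau n.+1 - tau n = dur n.
Proof. by rewrite /tau /dur exprS; field. Qed.

Lemma dur_gt0 n : 0 < dur n.
Proof. by case/andP: rho01 => r0 r1; rewrite /dur divr_gt0// mulr_gt0 ?exprn_gt0//; lra. Qed.

Lemma tau_lt n : tau n < tau n.+1.
Proof. by rewrite -subr_gt0 durE dur_gt0. Qed.

Lemma tau0 : tau 0 = 0. Proof. by rewrite /tau expr0 subrr mul0r. Qed.

Lemma tau_le m n : (m <= n)%N -> tau m <= tau n.
Proof.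
by case/andP: rho01 => r0 r1 mn; rewrite /tau ler_pM2r// lerB// ler_wiXn2l// ltW.
Qed.

Lemma tau_ge0 n : 0 <= tau n. Proof. by rewrite -tau0 tau_le. Qed.

Lemma tau_lt_half n : tau n < 1 / 2.
Proof. by case/andP: rho01 => r0 _; rewrite /tau ltr_pM2r// gtrBl exprn_gt0. Qed.

Lemma cvg_tau : tau n @[n --> \oo] --> (1 / 2 : R).
Proof.
case/andP: rho01 => r0 r1.
have c : (1 - rho ^+ n) / 2 @[n --> \oo] --> ((1 - 0) / 2 : R).
  apply: cvgMr_tmp; apply: cvgB; first exact: cvg_cst.
  by apply: cvg_expr; rewrite ger0_norm// ltW.
by rewrite subr0 in c.
Qed.

Lemma stage_exists t : 0 <= t < 1 / 2 -> exists n, tau n <= t < tau n.+1.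
Proof.
move=> /andP[t0 t1].
have [N _ hN] : \forall n \near \oo, t < tau n.
  exact: (cvgr_gt _ cvg_tau _ t1).
have ex : exists n, t < tau n by exists N; exact: hN N (leqnn N).
case: (ex_minnP ex) => -[|m]; first by rewrite tau0 ltNge t0.
move=> tm min; exists m; rewrite tm andbT leNgt; apply/negP => /min.
by rewrite ltnn.
Qed.

Lemma stage_unique t m n : tau m <= t < tau m.+1 -> tau n <= t < tau n.+1 -> m = n.
Proof.
move=> /andP[a b] /andP[c d]; apply/eqP; rewrite eqn_leq; apply/andP; split.
  by rewrite leqNgt; apply/negP => /tau_le h; have := le_lt_trans a d; rewrite ltNge h.
by rewrite leqNgt; apply/negP => /tau_le h; have := le_lt_trans c b; rewrite ltNge h.
Qed.

Lemma gap_in n t : tau n <= t <= tau n.+1 -> 0 <= gap n t <= 1.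
Proof.
move=> /andP[a b]; have d0 := dur_gt0 n; have e := durE n.
by rewrite /gap; case: ifP => _; rewrite divr_ge0/= ?ler_pdivrMr// ?mul1r; lra.
Qed.

Lemma gap_gt0 n t : tau n < t < tau n.+1 -> 0 < gap n t.
Proof.
move=> /andP[a b]; have d0 := dur_gt0 n.
by rewrite /gap; case: ifP => _; rewrite divr_gt0//; lra.
Qed.

Lemma kap_in n t : tau n <= t <= tau n.+1 -> 0 <= kap n t <= 1.
Proof.
move=> /gap_in /andP[a b]; rewrite /kap subr_ge0 exprn_ile1//= gerBl exprn_ge0//.
Qed.

Lemma kap_lt1 n t : 0 < gap n t -> kap n t < 1.
Proof. by move=> w; rewrite /kap gtrBl exprn_gt0. Qed.

Lemma is_derive_gap n (t : R) : is_derive t 1 (gap n) (dgap n).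
Proof.
have did := is_derive_id t (1 : R).
rewrite /gap /dgap; case: ifP => _.
  apply: is_derive1_eq (is_derive1M (is_derive1D did (is_derive1_cst t (- tau n))) (is_derive1_cst t (dur n)^-1)) _.
  by ring.
apply: is_derive1_eq (is_derive1M (is_derive1D (is_derive1_cst t (tau n.+1)) (is_derive1N did)) (is_derive1_cst t (dur n)^-1)) _.
by ring.
Qed.

Lemma is_derive_expn (f : R -> R) (x a : R) (n : nat) : is_derive x 1 f a ->
  is_derive x 1 (fun y => f y ^+ n) (n%:R * f x ^+ n.-1 * a).
Proof.
move=> df; elim: n => [|n IH].
  by apply: (is_derive1_ext (f := fun=> 1)) => [y|]; [rewrite expr0|rewrite !mul0r; exact: is_derive1_cst].
apply: (is_derive1_ext (f := fun y => f y * f y ^+ n)) => [y|]; first by rewrite exprS.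
apply: is_derive1_eq (is_derive1M df IH) _.
by case: n {IH} => [|n] /=; rewrite ?expr0 ?exprS -?[n.+2%:R]natr1 -?[n.+1%:R]natr1; ring.
Qed.

Lemma is_derive_kap n (t : R) : is_derive t 1 (kap n) (dkap n t).
Proof.
apply: is_derive1_eq (is_derive1D (is_derive1_cst t 1) (is_derive1N (is_derive_expn g.*2 (is_derive_gap n t)))) _.
by rewrite add0r.
Qed.

Lemma continuous_kap n : continuous (kap n).
Proof. by apply: (@is_derive1_continuous R _ (dkap n)) => t; exact: is_derive_kap. Qed.

Lemma continuous_dkap n : continuous (dkap n).
Proof.
apply: continuous_opp; apply: continuous_mul; last exact: continuous_const.
apply: continuous_mul; first exact: continuous_const.
apply: (@is_derive1_continuous R _ (fun t => g.*2.-1%:R * gap n t ^+ g.*2.-1.-1 * dgap n)) => t.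
exact: (is_derive_expn _ (is_derive_gap n t)).
Qed.

Lemma freqx_gt0 n : 0 < freqx n.
Proof.
apply: mulr_gt0; last by rewrite exprn_gt0.
by apply: mulr_gt0; [rewrite pmulrn_lgt0 ?pi_gt0|exact: sqrt2_gt0].
Qed.

Lemma freqy_gt0 n : 0 < freqy n.
Proof. by apply: mulr_gt0; [rewrite pmulrn_lgt0 ?pi_gt0|rewrite exprn_gt0]. Qed.

Lemma freqx_period n : freqx n * Num.sqrt 2 = pi *+ 2 *+ (2 ^ (n %/ 4).+1).
Proof.
rewrite /freqx -[RHS]mulr_natr natrX exprS.
have s : Num.sqrt 2 * Num.sqrt 2 = 2 :> R by rewrite -expr2 sqr_sqrtr.
transitivity (pi *+ 2 * (Num.sqrt 2 * Num.sqrt 2) * 2 ^+ (n %/ 4) : R); first by ring.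
by rewrite s; ring.
Qed.

Lemma freqy_period n : freqy n = pi *+ 2 *+ (2 ^ ((n + 2) %/ 4)) :> R.
Proof. by rewrite /freqy -[RHS]mulr_natr natrX. Qed.

End schedule.

(** * Measurability of the profile and convergence of signs *)

Section more_measurability.
Context (R : realType).

Lemma measurable_invr : measurable_fun setT (fun x : R => x^-1).
Proof.
have -> : [set: R] = [set~ 0] `|` [set 0] by rewrite setUC setUv.
apply/measurable_funU => //; first exact: measurableC.
split; last exact: measurable_fun_set1.
apply: open_continuous_measurable_fun; first by apply: closed_openC; apply: accessible_closed_set1; apply: hausdorff_accessible; exact: Rhausdorff.
by move=> x /set_mem /= /eqP x0; exact: inv_continuous.
Qed.

Lemma measurable_shear d (T : measurableType d) (k z : T -> R) :
  measurable_fun setT k -> measurable_fun setT z ->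
  measurable_fun setT (fun x => shear (k x) (z x)).
Proof.
move=> mk mz; have ms := measurableT_comp (continuous_measurable_fun (@continuous_sin R)) mz.
have mc := measurableT_comp (continuous_measurable_fun (@continuous_cos R)) mz.
apply: measurable_funM => //; apply: measurable_funM => //.
apply: (measurableT_comp measurable_invr); apply: measurable_funD => //.
exact: measurable_funM.
Qed.

Lemma leb3_ae_time (s : R) : {ae (@leb3 R), forall z, z.1 != s}.
Proof.
have mS : measurable ([set s] `*` setT : set (R_plane R)) by exact: measurableX.
apply: (@ae_of_null _ (R_plane R) R (@leb3 R) _ _ mS) => [|z /= h]; last first.
  by apply/eqP => e; apply: h; split.
apply/eqP; rewrite eq_le measure_ge0 andbT.
have h : (leb3 ([set s] `*` setT : set (R_plane R)) <= +oo * lebesgue_measure [set s])%E.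
  by apply: leb3_xsection_le => // t _; rewrite leey.
by apply: le_trans h _; rewrite lebesgue_measure_set1 mule0.
Qed.

Lemma cvg_pm (u : nat -> R) (l : R) : l != 0 -> u n @[n --> \oo] --> l ->
  pm (u n) @[n --> \oo] --> pm l.
Proof.
move=> l0 ul; apply: cvg_near_cst; rewrite /pm.
have [lp|ln] := ltP 0 l.
  by near=> n; rewrite ifT//; near: n; exact: (cvgr_gt _ ul).
have {}ln : l < 0 by rewrite lt_neqAle l0.
by near=> n; rewrite ifF//; apply/negbTE; rewrite -leNgt ltW//; near: n; exact: (cvgr_lt _ ul).
Unshelve. all: by end_near. Qed.

End more_measurability.

(** * One stage: bounds on the velocity and transport of the sign *)

Section stage.
Context (R : realType).
Variables (rho : R) (g : nat).
Hypotheses (rho01 : 0 < rho < 1) (g0 : (0 < g)%N).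
Variable n : nat.

Notation tau := (tau rho).
Notation dur := (dur rho).
Notation gap := (gap rho).
Notation kap := (kap rho g).
Notation dkap := (dkap rho g).
Notation speed := (speed rho g).
Notation a := (freqx R n).
Notation b := (freqy R n).
Notation v := (along_x n).

Definition phase (z : R * (R * R)) : R := stripes a b v (kap n z.1) z.2.1 z.2.2.
Definition drift1 (z : R * (R * R)) : R := vel1 a b (kap n z.1) (speed n z.1) z.2.1 z.2.2.
Definition drift2 (z : R * (R * R)) : R := vel2 a b (kap n z.1) (speed n z.1) z.2.1 z.2.2.

Let phase_t (z : R * (R * R)) : R :=
  dkap n z.1 * (if v then cos (a * z.2.1) else cos (b * z.2.2)).
Let phase_x (z : R * (R * R)) : R :=
  (if v then kap n z.1 else 1) * (- sin (a * z.2.1) * a).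
Let phase_y (z : R * (R * R)) : R :=
  (if v then 1 else kap n z.1) * (- sin (b * z.2.2) * b).

Let a0 : 0 < a := freqx_gt0 R n.
Let b0 : 0 < b := freqy_gt0 R n.

Let c1 : continuous (fun z : R * (R * R) => z.1).
Proof. by move=> z; exact: cvg_fst. Qed.
Let c21 : continuous (fun z : R * (R * R) => z.2.1).
Proof. by move=> z; apply: (@continuous_comp _ _ _ snd fst); [exact: cvg_snd|exact: cvg_fst]. Qed.
Let c22 : continuous (fun z : R * (R * R) => z.2.2).
Proof. by move=> z; apply: (@continuous_comp _ _ _ snd snd); exact: cvg_snd. Qed.
Let cc (r : R) : continuous (fun _ : R * (R * R) => r). Proof. exact: continuous_const. Qed.

Lemma continuous_phase : continuous phase.
Proof. exact: (stripes_continuous (continuous_compr (@continuous_kap R rho g n) c1)). Qed.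

Lemma C1_phase : C1_cell_periodic phase phase_t phase_x phase_y.
Proof.
have ck := continuous_compr (@continuous_kap R rho g n) c1.
have cdk := continuous_compr (@continuous_dkap R rho g n) c1.
have cca := continuous_compr (@continuous_cos R) (continuous_mul (@cc a) c21).
have ccb := continuous_compr (@continuous_cos R) (continuous_mul (@cc b) c22).
have csa := continuous_compr (@continuous_sin R) (continuous_mul (@cc a) c21).
have csb := continuous_compr (@continuous_sin R) (continuous_mul (@cc b) c22).
have cxa := continuous_mul (continuous_opp csa) (@cc a).
have cxb := continuous_mul (continuous_opp csb) (@cc b).
have dca (r x : R) : is_derive x 1 (fun x => cos (r * x)) (- sin (r * x) * r).
  exact: (@is_derive1_compf R cos (fun x => r * x) x _ _ (is_derive_cos (r * x)) (is_derive1_scale r x)).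
split.
- exact: continuous_phase.
- by rewrite /phase_t; case: v; exact: continuous_mul.
- by rewrite /phase_x; case: v; exact: continuous_mul.
- by rewrite /phase_y; case: v; exact: continuous_mul.
- move=> t [x y]; rewrite /phase /phase_t /stripes /=; case: v.
    apply: is_derive1_eq (is_derive1D (is_derive1M (is_derive_kap rho g n t) (is_derive1_cst t (cos (a * x)))) (is_derive1_cst t (1 * cos (b * y)))) _.
    by ring.
  apply: is_derive1_eq (is_derive1D (is_derive1_cst t (1 * cos (a * x))) (is_derive1M (is_derive_kap rho g n t) (is_derive1_cst t (cos (b * y))))) _.
  by ring.
- move=> t x y; rewrite /phase /phase_x /stripes /=.
  apply: is_derive1_eq (is_derive1D (is_derive1Ml _ (dca a x)) (is_derive1_cst x _)) _.
  by rewrite addr0.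
- move=> t x y; rewrite /phase /phase_y /stripes /=.
  apply: is_derive1_eq (is_derive1D (is_derive1_cst y _) (is_derive1Ml _ (dca b y))) _.
  by rewrite add0r.
- by move=> t y; apply: (stripes_periodic_x _ (freqx_period R n)).
- by move=> t x; apply: (stripes_periodic_y _ (freqy_period R n)).
Qed.

Let mk : measurable_fun [set: R_plane R] (fun z => kap n z.1).
Proof. exact: measurable_continuous3 (continuous_compr (@continuous_kap R rho g n) c1). Qed.

Let ms : measurable_fun [set: R_plane R] (fun z => speed n z.1).
Proof.
have m := measurable_continuous3 (continuous_compr (@continuous_dkap R rho g n) c1).
rewrite /speed; case: v => //; exact: measurable_funN.
Qed.

Let mph1 : measurable_fun [set: R_plane R] (fun z => a * z.2.1 - b * z.2.2).
Proof.
apply: measurable_continuous3.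
exact: (continuous_add (continuous_mul (@cc a) c21) (continuous_opp (continuous_mul (@cc b) c22))).
Qed.

Let mph2 : measurable_fun [set: R_plane R] (fun z => a * z.2.1 + b * z.2.2).
Proof.
apply: measurable_continuous3.
exact: (continuous_add (continuous_mul (@cc a) c21) (continuous_mul (@cc b) c22)).
Qed.

Lemma measurable_drift1 : measurable_fun [set: R_plane R] drift1.
Proof.
apply: measurable_funM; first exact: measurable_funM.
by apply: measurable_funD; exact: measurable_shear.
Qed.

Lemma measurable_drift2 : measurable_fun [set: R_plane R] drift2.
Proof.
apply: measurable_funM; first exact: measurable_funM.
by apply: measurable_funB; exact: measurable_shear.
Qed.

Lemma normr_dkap t : 0 <= gap n t ->
  `|dkap n t| = g.*2%:R * gap n t ^+ g.*2.-1 / dur n.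
Proof.
move=> w0; rewrite /dkap /= normrN normrM normrM /dgap normrM normfV.
rewrite (gtr0_norm (dur_gt0 rho01 n)) normr_nat (ger0_norm (exprn_ge0 _ w0)).
by case: ifP; rewrite ?normrN normr1 mul1r.
Qed.

Lemma normr_speed t : `|speed n t| = `|dkap n t|.
Proof. by rewrite /speed; case: v => //; rewrite normrN. Qed.

Lemma dkap_le t : tau n <= t <= tau n.+1 -> `|dkap n t| <= g.*2%:R / dur n.
Proof.
move=> /(gap_in rho01)/andP[w0 w1]; rewrite normr_dkap// ler_pM2r ?invr_gt0 ?dur_gt0//.
by rewrite ler_piMr// exprn_ile1.
Qed.

(** Through this factor the velocity vanishes at the instant where the shear profile is singular. *)
Lemma speed_gap0 t : gap n t = 0 -> speed n t = 0.
Proof.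
move=> w; have g2 : (0 < g.*2.-1)%N by case: g g0.
have d0 : dkap n t = 0 by rewrite /dkap w expr0n gtn_eqF// mulr0 mul0r oppr0.
by rewrite /speed d0 oppr0; case: v.
Qed.

Let gap_factor t : 0 < gap n t -> `|speed n t| = g.*2%:R / dur n * gap n t ^+ g.-1 * gap n t ^+ g.
Proof.
move=> w0; rewrite normr_speed normr_dkap ?(ltW w0)//.
have -> : g.*2.-1 = (g.-1 + g)%N by move: g0; lia.
by rewrite exprD; ring.
Qed.

Let kap_sq t : 1 - kap n t = (gap n t ^+ g) ^+ 2.
Proof. by rewrite /kap subKr -exprM muln2. Qed.

(* The velocity blows up like [gap ^ - g] relative to [speed]; the flat profile of [kap] compensates this. *)
Lemma drift1_bound t x y : tau n <= t <= tau n.+1 ->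
  `|drift1 (t, (x, y))| <= g.*2%:R / dur n * gap n t ^+ g.-1 / a.
Proof.
move=> tn; have /andP[w0 w1] := gap_in rho01 tn; have d0 := dur_gt0 rho01 n.
have [w|wn] := eqVneq (gap n t) 0.
  rewrite /drift1 /vel1 /= (speed_gap0 w) !mul0r normr0.
  apply: divr_ge0; last exact: ltW.
  by apply: mulr_ge0; [apply: divr_ge0; [exact: ler0n|exact: ltW]|exact: exprn_ge0].
have {wn}wp : 0 < gap n t by rewrite lt_neqAle eq_sym wn.
have kb : 0 <= kap n t < 1 by rewrite kap_lt1// andbT; case/andP: (kap_in g rho01 tn).
apply: le_trans (vel1_bound b a0 (speed n t) x y kb (exprn_gt0 g wp) _) _; first by rewrite kap_sq.
rewrite gap_factor// le_eqVlt; apply/orP; left; apply/eqP; field.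
by rewrite !gt_eqF ?exprn_gt0.
Qed.

Lemma drift2_bound t x y : tau n <= t <= tau n.+1 ->
  `|drift2 (t, (x, y))| <= g.*2%:R / dur n * gap n t ^+ g.-1 / b.
Proof.
move=> tn; have /andP[w0 w1] := gap_in rho01 tn; have d0 := dur_gt0 rho01 n.
have [w|wn] := eqVneq (gap n t) 0.
  rewrite /drift2 /vel2 /= (speed_gap0 w) !mul0r normr0.
  apply: divr_ge0; last exact: ltW.
  by apply: mulr_ge0; [apply: divr_ge0; [exact: ler0n|exact: ltW]|exact: exprn_ge0].
have {wn}wp : 0 < gap n t by rewrite lt_neqAle eq_sym wn.
have kb : 0 <= kap n t < 1 by rewrite kap_lt1// andbT; case/andP: (kap_in g rho01 tn).
apply: le_trans (vel2_bound a b0 (speed n t) x y kb (exprn_gt0 g wp) _) _; first by rewrite kap_sq.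
rewrite gap_factor// le_eqVlt; apply/orP; left; apply/eqP; field.
by rewrite !gt_eqF ?exprn_gt0.
Qed.

Lemma drift1_lipschitz t x y x' y' : 0 < gap n t -> 0 <= kap n t ->
  `|drift1 (t, (x, y)) - drift1 (t, (x', y'))| <=
  g.*2%:R / dur n * (gap n t)^-1 / a * (a * `|x - x'| + b * `|y - y'|).
Proof.
move=> wp k0; have d0 := dur_gt0 rho01 n.
have kb : 0 <= kap n t < 1 by rewrite k0 kap_lt1.
apply: le_trans (vel1_lipschitz a0 b0 (speed n t) x y x' y' kb) _.
rewrite kap_sq gap_factor// le_eqVlt; apply/orP; left; apply/eqP.
have -> : gap n t ^+ g = gap n t * gap n t ^+ g.-1 by rewrite -exprS prednK.
by field; rewrite !gt_eqF ?exprn_gt0.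
Qed.

Lemma drift2_lipschitz t x y x' y' : 0 < gap n t -> 0 <= kap n t ->
  `|drift2 (t, (x, y)) - drift2 (t, (x', y'))| <=
  g.*2%:R / dur n * (gap n t)^-1 / b * (a * `|x - x'| + b * `|y - y'|).
Proof.
move=> wp k0; have d0 := dur_gt0 rho01 n.
have kb : 0 <= kap n t < 1 by rewrite k0 kap_lt1.
apply: le_trans (vel2_lipschitz a0 b0 (speed n t) x y x' y' kb) _.
rewrite kap_sq gap_factor// le_eqVlt; apply/orP; left; apply/eqP.
have -> : gap n t ^+ g = gap n t * gap n t ^+ g.-1 by rewrite -exprS prednK.
by field; rewrite !gt_eqF ?exprn_gt0.
Qed.

Lemma solenoidal_drift t : 0 <= kap n t < 1 -> exists v1x v2y,
  solenoidal_cell (fun w => drift1 (t, w)) (fun w => drift2 (t, w)) v1x v2y.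
Proof.
move=> kb.
exact: (@solenoidal_vel R a b _ _ a0 b0 (freqx_period R n) (freqy_period R n) (kap n t) (speed n t) kb).
Qed.

Lemma drift_bounded : exists V, forall z, slab (tau n) (tau n.+1) z ->
  `|drift1 z| <= V /\ `|drift2 z| <= V.
Proof.
have d0 := dur_gt0 rho01 n.
exists (g.*2%:R / dur n / a + g.*2%:R / dur n / b) => -[t [x y]] /slab_box[/= /andP[t1 t2] _ _].
have tn : tau n <= t <= tau n.+1 by rewrite t1 ltW.
have /andP[w0 w1] := gap_in rho01 tn.
have q0 : 0 <= g.*2%:R / dur n by apply: divr_ge0; [exact: ler0n|exact: ltW].
have A0 : 0 <= g.*2%:R / dur n / a by apply: divr_ge0 => //; exact: ltW.
have B0 : 0 <= g.*2%:R / dur n / b by apply: divr_ge0 => //; exact: ltW.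
have w : g.*2%:R / dur n * gap n t ^+ g.-1 <= g.*2%:R / dur n by rewrite ler_piMr// exprn_ile1.
split.
  apply: le_trans (drift1_bound x y tn) _; apply: (@le_trans _ _ (g.*2%:R / dur n / a)); last by rewrite lerDl.
  by rewrite ler_pM2r// invr_gt0.
apply: le_trans (drift2_bound x y tn) _; apply: (@le_trans _ _ (g.*2%:R / dur n / b)); last by rewrite lerDr.
by rewrite ler_pM2r// invr_gt0.
Qed.

Section weak.
Variable phi : R * (R * R) -> R.
Hypothesis test_phi : test_function phi.

Let phit := d_t phi.
Let phix := partial (inord 1) phi.
Let phiy := partial (inord 2) phi.

Definition slice_int (t : R) : R := \int[@leb2 R]_(w in @cell R) (pm (phase (t, w)) * phi (t, w)).

(** Away from the ends of the stage [gap] is at least some m > 0, so the amplitude stays below K < 1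
    and the growth rate of the phase is bounded, as [transport_sign] demands. *)
Lemma transport_inner t1 t2 : tau n < t1 -> t1 < t2 -> t2 < tau n.+1 ->
  \int[@leb3 R]_(z in slab t1 t2) (pm (phase z) * material drift1 drift2 phit phix phiy z) =
  slice_int t2 - slice_int t1.
Proof.
move=> nt1 t12 t2n; have d0 := dur_gt0 rho01 n; have e := durE rho n.
have [V hV] := drift_bounded.
have sub z : slab t1 t2 z -> slab (tau n) (tau n.+1) z.
  by move=> [/=]; rewrite !in_itv/= => /andP[h1 h2] cz; split=> //=; rewrite in_itv/=; apply/andP; split; lra.
pose m := Num.min (t1 - tau n) (tau n.+1 - t2) / dur n.
have m0 : 0 < m by rewrite divr_gt0// lt_min !subr_gt0 nt1.
have gm t : t1 <= t < t2 -> m <= gap n t.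
  move=> /andP[h1 h2]; rewrite /m /gap; case: ifP => _; rewrite ler_pM2r ?invr_gt0// ge_min; apply/orP.
    by left; lra.
  by right; lra.
pose K := 1 - m ^+ g.*2.
have K1 : K < 1 by rewrite /K gtrBl exprn_gt0.
have kK t : t1 <= t < t2 -> 0 <= kap n t <= K.
  move=> tt; have /andP[h1 h2] := tt.
  have tn : tau n <= t <= tau n.+1 by apply/andP; split; lra.
  have /andP[-> _] := kap_in g rho01 tn; rewrite /K lerB// lerXn2r ?gm// nnegrE ?(ltW m0)//.
  by case/andP: (gap_in rho01 tn).
pose h z := dkap n z.1 * stripes_rate a b v (kap n z.1) z.2.1 z.2.2.
apply: (@transport_sign _ t1 t2 drift1 drift2 V t12 _ _ _ _ _ _ phase_t phase_x phase_y C1_phase h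
  (g.*2%:R / dur n * (2 / (1 - K) ^+ 2))) => //.
- by apply: measurable_funTS; exact: measurable_drift1.
- by apply: measurable_funTS; exact: measurable_drift2.
- by move=> z /sub /hV[].
- by move=> z /sub /hV[].
- by move=> t tt; apply: solenoidal_drift; case/andP: (kK t tt) => -> /le_lt_trans; apply.
- move=> -[t [x y]] /slab_box[/= tt _ _].
  have kb : 0 <= kap n t < 1 by case/andP: (kK t tt) => -> /le_lt_trans; apply.
  exact: (stripes_transport a0 b0 v (dkap n t) x y kb).
- move=> -[t [x y]] sz; have /slab_box[/= tt _ _] := sz; rewrite normrM ler_pM//.
    by apply: dkap_le => /=; move: tt => /andP[h1 h2]; apply/andP; split; lra.
  by apply: stripes_rate_bound => //; exact: kK.
- by apply: ae_sub (stripes_ae_neq0_time a0 b0 v (@continuous_kap R rho g n)).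
- by apply: ae_sub (stripes_ae_neq0 a0 b0 v (kap n t1)).
- by apply: ae_sub (stripes_ae_neq0 a0 b0 v (kap n t2)).
Qed.

(** The nodal set at time [t] is null for every amplitude, including k = 1, and off it the sign is
    locally constant in time. The ends of the stage are thus included. *)
Lemma cvg_slice_int (s : nat -> R) (t : R) : (forall j, 0 <= s j <= 1) ->
  s j @[j --> \oo] --> t -> slice_int (s j) @[j --> \oo] --> slice_int t.
Proof.
move=> s01 st; have cp := test_function_continuous test_phi.
have [M M0 hM] := bounded_box3 0 1 0 (Num.sqrt 2) 0 1 cp.
have cF := continuous_phase.
have mslice r : measurable_fun (@cell R : set (plane R)) (fun w => pm (phase (r, w)) * phi (r, w)).
  apply: measurable_funTS; apply: measurable_funM; last exact: measurable_continuous2 (continuous_pairr cp).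
  apply: (measurableT_comp (@measurable_pm R)).
  exact: measurable_continuous2 (continuous_pairr cF).
have cs w (G : R * (R * R) -> R) : continuous G -> G (s j, w) @[j --> \oo] --> G (t, w).
  by move=> cG; apply: (@cvg_comp _ _ _ s (fun r => G (r, w)) _ _ _ st); exact: (continuous_pairl (y := w) cG).
apply: (@cvg_Rintegral_bounded _ _ _ _ _ _ _ M) => //.
- exact: measurable_cell.
- exact: leb2_cell_lty.
- move=> j [x y] /cell_box[/= xb yb]; rewrite normrM normr_pm mul1r; exact: hM.
- apply: ae_sub (stripes_ae_neq0 a0 b0 v (kap n t)) => w nz _.
  by apply: cvgM; [apply: cvg_pm => //; exact: cs|exact: cs].
Qed.

End weak.

End stage.

(** * Transport up to the ends of a stage, by exhaustion from inside *)

Section slab_limits.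
Context (R : realType).

Lemma cvg_slab_inner (t1 t2 : R) (s1 s2 : nat -> R) (h : R * (R * R) -> R) (M : R) :
  measurable_fun (slab t1 t2) h -> (forall z, slab t1 t2 z -> `|h z| <= M) ->
  (forall j, t1 <= s1 j) -> (forall j, s2 j <= t2) ->
  s1 j @[j --> \oo] --> t1 -> s2 j @[j --> \oo] --> t2 ->
  \int[@leb3 R]_(z in slab (s1 j) (s2 j)) h z @[j --> \oo] -->
  \int[@leb3 R]_(z in slab t1 t2) h z.
Proof.
move=> mh hM s1t s2t c1 c2.
have sub j : slab (s1 j) (s2 j) `<=` slab t1 t2.
  move=> z [/=]; rewrite in_itv/= => /andP[a b] c; split=> //=; rewrite in_itv/=.
  by rewrite (le_trans (s1t j) a) (lt_le_trans b (s2t j)).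
rewrite (_ : (fun j => _) = (fun j => \int[@leb3 R]_(z in slab t1 t2) ((h \_ (slab (s1 j) (s2 j))) z))); last first.
  apply/funext => j; rewrite -{1}(setIidr (@sub j)) Rintegral_mkcondr//; exact: measurable_slab.
apply: (@cvg_Rintegral_bounded _ _ _ _ _ _ _ `|M|).
- exact: measurable_slab.
- exact: leb3_slab_lty.
- move=> j; apply/(measurable_restrict _ (measurable_slab _ _) (measurable_slab _ _)).
  by rewrite setIidr//; apply: measurable_funS mh => //; exact: measurable_slab.
- exact: mh.
- move=> j z sz; rewrite patchE; case: ifP => _; last by rewrite normr0.
  exact: le_trans (hM _ sz) (ler_norm _).
- apply: ae_sub (leb3_ae_time t1) => -[t w] /= tne sz.
  have [/= ti cw] := sz; rewrite in_itv/= in ti.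
  have /andP[ta tb] : t1 < t < t2 by move: ti => /andP[a ->]; rewrite lt_neqAle eq_sym tne a.
  apply: cvg_near_cst; near=> j.
  rewrite patchE mem_set//; split=> //=; rewrite in_itv/=; apply/andP; split.
    by apply: ltW; near: j; exact: (cvgr_lt _ c1).
  by near: j; exact: (cvgr_gt _ c2).
Unshelve. all: by end_near. Qed.

Lemma cvg_endpoints (t d : R) : (t + d / j.+3%:R) @[j --> \oo] --> t.
Proof.
have c : (j.+3%:R^-1 * d : R) @[j --> \oo] --> (0 : R).
  apply: cvg_mul0; rewrite (_ : (fun j => _) = (fun j => (j + 2).+1%:R^-1 : R)).
    by rewrite (cvg_shiftn 2 (fun j => j.+1%:R^-1 : R)); exact: cvg_harmonic0.
  by apply/funext => j; rewrite addn2.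
have : (t + j.+3%:R^-1 * d) @[j --> \oo] --> t + 0 by apply: cvgD => //; exact: cvg_cst.
by rewrite addr0; under eq_fun do rewrite mulrC.
Qed.

End slab_limits.

Section stage_transport.
Context (R : realType).
Variables (rho : R) (g : nat).
Hypotheses (rho01 : 0 < rho < 1) (g0 : (0 < g)%N).

Lemma transport_stage n phi : test_function phi ->
  \int[@leb3 R]_(z in slab (tau rho n) (tau rho n.+1))
     (pm (phase rho g n z) * material (drift1 rho g n) (drift2 rho g n)
        (d_t phi) (partial (inord 1) phi) (partial (inord 2) phi) z) =
  slice_int rho g n phi (tau rho n.+1) - slice_int rho g n phi (tau rho n).
Proof.
move=> test_phi; have d0 := dur_gt0 rho01 n; have e := durE rho n.
(* With [j.+3] each end moves by at most a third of the duration, which keeps [s1 j] before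
   [s2 j]. *)
pose s1 j : R := tau rho n + dur rho n / j.+3%:R.
pose s2 j : R := tau rho n.+1 + - dur rho n / j.+3%:R.
have j3 j : 0 < dur rho n / j.+3%:R <= dur rho n / 3.
  rewrite divr_gt0//= ler_pM2l// lef_pV2 ?posrE// ler_nat//.
have s1b j : tau rho n < s1 j /\ s1 j < s2 j.
  by rewrite /s1 /s2 mulNr; move: (_ / j.+3%:R) (j3 j) => x /andP[a b]; split; lra.
have s2b j : s2 j < tau rho n.+1.
  by rewrite /s2 mulNr; move: (_ / j.+3%:R) (j3 j) => x /andP[a b]; lra.
have t0 := tau_ge0 rho01 n; have t1 := tau_lt_half rho01 n.+1.
have c1 : s1 j @[j --> \oo] --> tau rho n by exact: cvg_endpoints.
have c2 : s2 j @[j --> \oo] --> tau rho n.+1 by exact: cvg_endpoints.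
have I j := transport_inner rho01 g0 test_phi (s1b j).1 (s1b j).2 (s2b j).
have [V hV] := drift_bounded rho01 g0 n.
have [_ cpt cpx cpy _ _ _ _ _] := C1_test_function test_phi.
have mm : measurable_fun (slab (tau rho n) (tau rho n.+1)) (material (drift1 rho g n) (drift2 rho g n)
        (d_t phi) (partial (inord 1) phi) (partial (inord 2) phi)).
  by apply: measurable_material => //; apply: measurable_funTS;
    [exact: measurable_drift1|exact: measurable_drift2].
have [N N0 hN] := bounded_material (fun z s => (hV z s).1) (fun z s => (hV z s).2) cpt cpx cpy.
set J := (fun z => pm (phase rho g n z) * _) in I *.
have c0 : \int[@leb3 R]_(z in slab (s1 j) (s2 j)) J z @[j --> \oo] -->
    \int[@leb3 R]_(z in slab (tau rho n) (tau rho n.+1)) J z.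
  apply: (@cvg_slab_inner _ _ _ _ _ _ N) => //.
  - apply: measurable_funM => //; apply: measurable_funTS.
    apply: (measurableT_comp (@measurable_pm R)); exact: (measurable_continuous3 (@continuous_phase R rho g n)).
  - by move=> z sz; rewrite normrM normr_pm mul1r hN.
  - by move=> j; apply: ltW; exact: (s1b j).1.
  - by move=> j; apply: ltW.
have q1 : slice_int rho g n phi (s1 j) @[j --> \oo] --> slice_int rho g n phi (tau rho n).
  apply: cvg_slice_int => // j; have [a b] := s1b j; have c := s2b j.
  by apply/andP; split; lra.
have q2 : slice_int rho g n phi (s2 j) @[j --> \oo] --> slice_int rho g n phi (tau rho n.+1).
  apply: cvg_slice_int => // j; have [a b] := s1b j; have c := s2b j.
  by apply/andP; split; lra.
have z0 : (fun=> 0 : R) j @[j --> \oo] --> (0 : R) by exact: cvg_cst.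
have := cvg_balance c0 z0 q2 q1; rewrite addr0; apply => j.
by rewrite addr0 -I.
Qed.

End stage_transport.

(** * Both frequencies are comparable to gam^n *)

Section frequency_rates.
Context (R : realType).
Variable gam : R.
Hypotheses (gam1 : 1 < gam) (gam4 : gam ^+ 4 = 2).

Lemma sqrt2_bounds : 1 <= (Num.sqrt 2 : R) <= 3 / 2.
Proof.
have s0 : 0 <= Num.sqrt 2 :> R by exact: sqrtr_ge0.
have s : Num.sqrt 2 ^+ 2 = 2 :> R by rewrite sqr_sqrtr.
by apply/andP; split; nra.
Qed.

Lemma pow2_gam m : 2 ^+ m = gam ^+ (4 * m)%N.
Proof. by rewrite exprM gam4. Qed.

Let gamX_ge k l : (k <= l)%N -> gam ^+ k <= gam ^+ l.
Proof. by move=> kl; rewrite ler_weXn2l// ltW. Qed.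

Let gamX_gt0 k : 0 < gam ^+ k.
Proof. by rewrite exprn_gt0// (lt_trans ltr01). Qed.

Let gam3 : gam ^+ 3 <= 2.
Proof. by rewrite -gam4; exact: gamX_ge. Qed.

(** Rounding n down to a multiple of 4 loses a factor of at most gam^3 <= 2, and the prefactor 2 pi
    sqrt 2 lies between 2 and 12. *)
Lemma freqx_rate n : gam ^+ n <= freqx R n <= 12 * gam ^+ n.
Proof.
have /andP[s1 s2] := sqrt2_bounds; have p1 := @pi_ge2 R; have p2 := pihalf_lt2 R.
have := divn_eq n 4; have := ltn_pmod n (isT : (0 < 4)%N).
rewrite /freqx pow2_gam; move: (n %/ 4)%N (n %% 4)%N => m r r4 nE.
have l1 : gam ^+ n <= gam ^+ (4 * m) * gam ^+ 3 by rewrite -exprD; apply: gamX_ge; lia.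
have l2 : gam ^+ (4 * m) <= gam ^+ n by apply: gamX_ge; lia.
have P : 2 <= (pi *+ 2 * Num.sqrt 2 : R) <= 12.
  rewrite mulr2n; move: (pi : R) (Num.sqrt 2 : R) p1 p2 s1 s2 => p s p1 p2 s1 s2.
  have p4 : 0 <= 4 - p by lra.
  have := mulr_ge0 p4 (_ : 0 <= s - 1); have := mulr_ge0 (_ : 0 <= p - 2) (_ : 0 <= s - 1).
  by move=> h1 h2; apply/andP; split; [have := h1|have := h2]; lra.
have /andP[P1 P2] := P; move: (gamX_gt0 (4 * m)) (gamX_gt0 3) gam3 => ? ? ?.
by apply/andP; split; nra.
Qed.

Lemma freqy_rate n : gam ^+ n <= freqy R n <= 12 * gam ^+ n.
Proof.
have p1 := @pi_ge2 R; have p2 := pihalf_lt2 R.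
have := divn_eq (n + 2) 4; have := ltn_pmod (n + 2) (isT : (0 < 4)%N).
rewrite /freqy pow2_gam; move: ((n + 2) %/ 4)%N ((n + 2) %% 4)%N => m r r4 nE.
have l1 : gam ^+ n <= gam ^+ (4 * m) * gam ^+ 1 by rewrite -exprD; apply: gamX_ge; lia.
have l2 : gam ^+ (4 * m) <= gam ^+ n * gam ^+ 2 by rewrite -exprD; apply: gamX_ge; lia.
have g2 : gam ^+ 2 <= 3 / 2.
  have : (gam ^+ 2) ^+ 2 = 2 by rewrite -exprM gam4.
  by have := gamX_gt0 2; nra.
have g1 : gam ^+ 1 <= 2 by apply: le_trans gam3; exact: gamX_ge.
have P : 2 <= (pi *+ 2 : R) <= 8 by rewrite mulr2n; apply/andP; split; lra.
have /andP[P1 P2] := P; move: (gamX_gt0 (4 * m)) (gamX_gt0 n) => ? ?.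
by apply/andP; split; nra.
Qed.

End frequency_rates.

(** * The scalar and the velocity on the whole time axis *)

Section global_fields.
Context (R : realType).
Variables (rho : R) (g : nat).
Hypotheses (rho01 : 0 < rho < 1) (g0 : (0 < g)%N).

Notation tau := (tau rho).

(** The default 0 concerns inactive times only, at which both fields are set to 0 without reading
    the stage. *)
Definition stage (t : R) : nat := xget 0%N [set n | tau n <= t < tau n.+1].
Definition active (t : R) : bool := 0 <= t < 1 / 2.

Definition theta (t : R) (x : R * R) : R :=
  if active t then pm (phase rho g (stage t) (t, x)) else 0.

Definition vel (t : R) (x : R * R) : R * R :=
  if active t then (drift1 rho g (stage t) (t, x), drift2 rho g (stage t) (t, x))
  else (0, 0).

Lemma stageE n t : tau n <= t < tau n.+1 -> stage t = n.
Proof.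
move=> tn; rewrite /stage; case: xgetP => [m -> /= tm|/(_ n)//].
exact: (stage_unique rho01 tm tn).
Qed.

Lemma stageP t : active t -> tau (stage t) <= t < tau (stage t).+1.
Proof. by move=> /(stage_exists rho01)[n tn]; rewrite (stageE tn). Qed.

Lemma active_stage n t : tau n <= t < tau n.+1 -> active t.
Proof.
move=> /andP[a b]; rewrite /active (le_trans (tau_ge0 rho01 n) a)/=.
exact: lt_trans b (tau_lt_half rho01 _).
Qed.

Lemma measurable_by_stage (F : nat -> R * (R * R) -> R) :
  (forall n, measurable_fun [set: R_plane R] (F n)) ->
  measurable_fun [set: R_plane R] (fun z => if active z.1 then F (stage z.1) z else 0).
Proof.
move=> mF.
pose E n : set (R_plane R) := if n is m.+1 then `[tau m, tau m.+1[%classic `*` setT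
  else [set t | ~~ active t] `*` setT.
have mE n : measurable (E n).
  case: n => [|n]; apply: measurableX => //.
  rewrite (_ : [set t | ~~ active t] = ~` `[0, 1 / 2[%classic).
    by apply: measurableC; exact: measurable_itv.
  by apply/seteqP; split=> t /=; rewrite in_itv => /negP.
have -> : [set: R_plane R] = \bigcup_n E n.
  apply/seteqP; split=> // -[t w] _; have [at_|nat_] := boolP (active t).
    by exists (stage t).+1 => //; split=> //=; rewrite in_itv/=; exact: stageP.
  by exists 0%N.
apply/measurable_fun_bigcup => // -[|n].
  apply: (@eq_measurable_fun _ _ _ _ _ (fun=> 0 : R)); last exact: measurable_cst.
  by move=> [t w] /set_mem[/= /negbTE-> _].
apply: (@eq_measurable_fun _ _ _ _ _ (F n)); last by apply: measurable_funTS; exact: mF.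
move=> [t w] /set_mem[/=]; rewrite in_itv/= => tn _.
by rewrite (active_stage tn) (stageE tn).
Qed.

Lemma measurable_theta : measurable_fun [set: R_plane R] (fun z => theta z.1 z.2).
Proof.
apply: (@eq_measurable_fun _ _ _ _ _ (fun z => if active z.1 then pm (phase rho g (stage z.1) z) else 0)).
  by move=> [t w].
apply: (@measurable_by_stage (fun n z => pm (phase rho g n z))) => n.
apply: (measurableT_comp (@measurable_pm R)).
exact: (measurable_continuous3 (@continuous_phase R rho g n)).
Qed.

Lemma measurable_vel1 : measurable_fun [set: R_plane R] (fun z => (vel z.1 z.2).1).
Proof.
apply: (@eq_measurable_fun _ _ _ _ _ (fun z => if active z.1 then drift1 rho g (stage z.1) z else 0)).
  by move=> [t w] _; rewrite /vel /=; case: ifP.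
by apply: measurable_by_stage => n; exact: measurable_drift1.
Qed.

Lemma measurable_vel2 : measurable_fun [set: R_plane R] (fun z => (vel z.1 z.2).2).
Proof.
apply: (@eq_measurable_fun _ _ _ _ _ (fun z => if active z.1 then drift2 rho g (stage z.1) z else 0)).
  by move=> [t w] _; rewrite /vel /=; case: ifP.
by apply: measurable_by_stage => n; exact: measurable_drift2.
Qed.

Lemma theta_le1 t x : `|theta t x| <= 1.
Proof. by rewrite /theta; case: ifP => _; rewrite ?normr_pm ?normr0. Qed.

Lemma theta_sqr t x : theta t x ^+ 2 = (active t)%:R.
Proof. by rewrite /theta; case: ifP => _; rewrite ?pm_sqr ?expr0n. Qed.

Variable gam : R.
Hypotheses (gam1 : 1 < gam) (gam4 : gam ^+ 4 = 2).
Hypothesis rho_gam : 1 <= rho * gam.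

Definition vel_const : R := g.*2%:R * 2 / (1 - rho).

Lemma vel_const_ge0 : 0 <= vel_const.
Proof. by case/andP: rho01 => r0 r1; rewrite /vel_const divr_ge0 ?mulr_ge0//; lra. Qed.

Lemma dur_coef n : g.*2%:R / dur rho n = vel_const / rho ^+ n.
Proof.
have r0 : rho != 0 by rewrite gt_eqF//; case/andP: rho01; lra.
have r1 : 1 - rho != 0 by rewrite gt_eqF//; case/andP: rho01; lra.
by rewrite /vel_const /dur; field; rewrite ?r0 ?r1 ?expf_neq0.
Qed.

Lemma vel_stage_bound t x : active t ->
  `|(vel t x).1| <= vel_const / rho ^+ stage t * gap rho (stage t) t ^+ g.-1 / gam ^+ stage t /\
  `|(vel t x).2| <= vel_const / rho ^+ stage t * gap rho (stage t) t ^+ g.-1 / gam ^+ stage t.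
Proof.
move=> at_; have /andP[t1 t2] := stageP at_; rewrite /vel at_ /=; set n := stage t in t1 t2 *.
have tn : tau n <= t <= tau n.+1 by rewrite t1 ltW.
have /andP[w0 w1] := gap_in rho01 tn.
have r0 : 0 < rho ^+ n by rewrite exprn_gt0//; case/andP: rho01; lra.
have q0 : 0 <= vel_const / rho ^+ n * gap rho n t ^+ g.-1.
  by rewrite mulr_ge0 ?exprn_ge0// divr_ge0 ?vel_const_ge0// ltW.
have gn : 0 < gam ^+ n by rewrite exprn_gt0//; exact: lt_trans gam1.
have fx : gam ^+ n <= freqx R n by case/andP: (freqx_rate gam1 gam4 n).
have fy : gam ^+ n <= freqy R n by case/andP: (freqy_rate gam1 gam4 n).
case: x => x y; split.
  apply: le_trans (drift1_bound rho01 g0 x y tn) _; rewrite dur_coef ler_wpM2l//.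
  by rewrite lef_pV2// posrE; exact: lt_le_trans gn _.
apply: le_trans (drift2_bound rho01 g0 x y tn) _; rewrite dur_coef ler_wpM2l//.
by rewrite lef_pV2// posrE; exact: lt_le_trans gn _.
Qed.

Lemma rho_gamX n : 1 <= rho ^+ n * gam ^+ n.
Proof. by rewrite -exprMn exprn_ege1. Qed.

(** The short duration costs rho^(-n), the high frequency gains gam^(-n), and rho gam >= 1. *)
Lemma vel_bound t x : `|(vel t x).1| <= vel_const /\ `|(vel t x).2| <= vel_const.
Proof.
have [at_|/negbTE nat_] := boolP (active t); last first.
  by rewrite /vel nat_ /= normr0 vel_const_ge0.
have /andP[t1 t2] := stageP at_; have [b1 b2] := vel_stage_bound x at_; set n := stage t in t1 t2 b1 b2.
have tn : tau n <= t <= tau n.+1 by rewrite t1 ltW.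
have /andP[w0 w1] := gap_in rho01 tn.
have r0 : 0 < rho ^+ n by rewrite exprn_gt0//; case/andP: rho01; lra.
have gn : 0 < gam ^+ n by rewrite exprn_gt0//; exact: lt_trans gam1.
have le : vel_const / rho ^+ n * gap rho n t ^+ g.-1 / gam ^+ n <= vel_const.
  have -> : vel_const / rho ^+ n * gap rho n t ^+ g.-1 / gam ^+ n =
      vel_const * (gap rho n t ^+ g.-1 / (rho ^+ n * gam ^+ n)).
    by field; rewrite !gt_eqF.
  rewrite ler_piMr ?vel_const_ge0// ler_pdivrMr ?mulr_gt0// mul1r.
  by apply: le_trans (rho_gamX n); rewrite exprn_ile1.
by split; [exact: le_trans b1 le|exact: le_trans b2 le].
Qed.

End global_fields.

(** * Cutting space-time integrals into slabs *)

Section spacetime_integrals.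
Context (R : realType).

Lemma slab_union (t1 t2 t3 : R) : t1 <= t2 -> t2 <= t3 ->
  slab t1 t3 = slab t1 t2 `|` slab t2 t3.
Proof.
move=> t12 t23; apply/seteqP; split=> -[t w] /=.
  move=> [/=]; rewrite in_itv/= => /andP[a b] c; have [d|d] := ltP t t2.
    by left; split=> //=; rewrite in_itv/= a d.
  by right; split=> //=; rewrite in_itv/= d b.
move=> [] [/=]; rewrite in_itv/= => /andP[a b] c; split=> //=; rewrite in_itv/=.
  by rewrite a (lt_le_trans b).
by rewrite b (le_trans t12).
Qed.

Lemma Rintegral_slab_split (t1 t2 t3 : R) (h : R * (R * R) -> R) (M : R) :
  t1 <= t2 -> t2 <= t3 -> measurable_fun (slab t1 t3) h ->
  (forall z, slab t1 t3 z -> `|h z| <= M) ->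
  \int[@leb3 R]_(z in slab t1 t3) h z =
  \int[@leb3 R]_(z in slab t1 t2) h z + \int[@leb3 R]_(z in slab t2 t3) h z.
Proof.
move=> t12 t23 mh hM; have i := integrable_slab mh hM.
rewrite (slab_union t12 t23) in i *; rewrite Rintegral_setU//; try exact: measurable_slab.
apply/disj_setPS => -[t w] [[/= + _] [/= + _]]; rewrite !in_itv/= => /andP[_ a] /andP[b _].
by have := lt_le_trans a b; rewrite ltxx.
Qed.

Lemma spacetime_slab : @spacetime R `<=` slab 0 1.
Proof.
move=> -[t w] [/=]; rewrite in_itv/= => /andP[a b] c; split=> //=.
by rewrite in_itv/= ltW.
Qed.

Lemma measurable_spacetime : measurable (@spacetime R : set (R_plane R)).
Proof. by apply: measurableX; [exact: measurable_itv|exact: measurable_cell]. Qed.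

Lemma leb3_spacetime_lty : (leb3 (@spacetime R : set (R_plane R)) < +oo)%E.
Proof.
apply: le_lt_trans (leb3_slab_lty 0 1); apply: le_measure; rewrite ?inE.
- exact: measurable_spacetime.
- exact: measurable_slab.
- exact: spacetime_slab.
Qed.

(** The open time interval of [spacetime] and the half-open one of [slab] differ by the null slice t
    = 0. *)
Lemma Rintegral_spacetime (h : R * (R * R) -> R) (M : R) :
  measurable_fun (slab 0 1) h -> (forall z, slab 0 1 z -> `|h z| <= M) ->
  \int[@leb3 R]_(z in @spacetime R) h z = \int[@leb3 R]_(z in slab 0 1) h z.
Proof.
move=> mh hM.
have zE : slab 0 1 = @spacetime R `|` ([set 0] `*` @cell R).
  apply/seteqP; split=> -[t w] /=.
    move=> [/=]; rewrite in_itv/= le_eqVlt => /andP[/orP[/eqP<-|a] b] c; first by right.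
    by left; split=> //=; rewrite in_itv/= a b.
  by move=> [/spacetime_slab//|[/= -> c]]; split=> //=; rewrite in_itv/= lexx ltr01.
have mz : measurable ([set 0] `*` @cell R : set (R_plane R)).
  by apply: measurableX => //; exact: measurable_cell.
have n0 : leb3 ([set 0] `*` @cell R : set (R_plane R)) = 0%E.
  apply: (@subset_measure0 _ _ _ (@leb3 R) _ ([set 0] `*` setT)) => //.
  - exact: measurableX.
  - by move=> z [].
  - apply/eqP; rewrite eq_le measure_ge0 andbT.
    have q : (leb3 ([set 0%R] `*` setT : set (R_plane R)) <= +oo * lebesgue_measure [set (0 : R)%R])%E.
      by apply: leb3_xsection_le => // [|t _]; [exact: measurableX|rewrite leey].
    by apply: le_trans q _; rewrite lebesgue_measure_set1 mule0.
have i := integrable_slab mh hM.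
rewrite zE Rintegral_setU//.
- have l := @le_Rintegral_bounded _ _ _ (@leb3 R) _ h M 0 mz n0.
  move: l; rewrite mulr0 normr_le0 => l.
  rewrite (eqP (l _ _)) ?addr0//.
    by apply: measurable_funS mh; [exact: measurable_slab|rewrite zE; exact: subsetUr].
  by move=> z sz; apply: hM; rewrite zE; right.
- exact: measurable_spacetime.
- by rewrite -zE.
- apply/disj_setPS => -[t w] [[/= ti _] [/= t0 _]]; by move: ti; rewrite in_itv/= t0 ltxx.
Qed.

End spacetime_integrals.

(** * Glueing consecutive stages *)

Lemma quarters (m r : nat) : (r < 4)%N -> let n := (m * 4 + r)%N in
  [/\ (n %/ 4 = m)%N, (n %% 4 = r)%N & ((n + 2) %/ 4 = m + (1 < r))%N] /\
  [/\ (n.+1 %/ 4 = m + (r == 3))%N, (n.+1 %% 4 = if r == 3 then 0 else r.+1)%N &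
      ((n.+1 + 2) %/ 4 = m + (0 < r))%N].
Proof. by case: r => [|[|[|[|]]]]//= _; split; split; lia. Qed.

Section glueing.
Context (R : realType).
Variables (rho : R) (g : nat).
Hypotheses (rho01 : 0 < rho < 1) (g0 : (0 < g)%N).

Lemma gap_end n : gap rho n (tau rho n.+1) = (odd n)%:R.
Proof.
rewrite /gap; case: ifP => _; last by rewrite subrr mul0r.
by rewrite durE divff// gt_eqF// dur_gt0.
Qed.

Lemma gap_start n : gap rho n (tau rho n) = (~~ odd n)%:R.
Proof.
rewrite /gap; case: ifP => _; first by rewrite subrr mul0r.
by rewrite durE divff// gt_eqF// dur_gt0.
Qed.

Let g2 : (0 < g.*2)%N. Proof. by rewrite double_gt0. Qed.

Lemma kap_end n : kap rho g n (tau rho n.+1) = (~~ odd n)%:R.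
Proof. by rewrite /kap gap_end; case: odd; rewrite ?expr1n ?expr0n ?subrr ?gtn_eqF//= subr0. Qed.

Lemma kap_start n : kap rho g n (tau rho n) = (odd n)%:R.
Proof. by rewrite /kap gap_start; case: odd; rewrite ?expr1n ?expr0n ?subrr ?gtn_eqF//= subr0. Qed.

(** At the common instant both amplitudes are 1 or both are 0. At 1 the roles of the two waves are
    interchangeable and the frequencies agree; at 0 the only frequency that changes belongs to the
    absent wave. *)
Lemma phase_glue n w : phase rho g n (tau rho n.+1, w) = phase rho g n.+1 (tau rho n.+1, w).
Proof.
rewrite /phase /= kap_end kap_start /= /stripes /along_x /freqx /freqy.
have nE := divn_eq n 4; have r4 := ltn_pmod n (isT : (0 < 4)%N).
rewrite nE; move: (n %/ 4)%N (n %% 4)%N r4 => m r r4 {nE}.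
have [[-> -> ->] [-> -> ->]] := quarters m r4.
rewrite /= oddD oddM andbF /=.
by case: r r4 => [|[|[|[|]]]]//= _; rewrite ?addn0 ?mul0r ?mul1r.
Qed.

Lemma slice_int_glue n phi :
  slice_int rho g n phi (tau rho n.+1) = slice_int rho g n.+1 phi (tau rho n.+1).
Proof. by apply: eq_Rintegral => w _; rewrite phase_glue. Qed.

Lemma phase_start n w : (n %% 4 = 0)%N ->
  phase rho g n (tau rho n, w) = cos (pi *+ 2 * 2 ^+ (n %/ 4) * w.2).
Proof.
move=> n4; have nE := divn_eq n 4; rewrite n4 addn0 in nE.
have on : odd n = false by rewrite nE oddM andbF.
have e : ((n + 2) %/ 4 = n %/ 4)%N by move: n4; clear; lia.
by rewrite /phase /= kap_start /stripes /along_x n4 /= on mul0r add0r mul1r /freqy e.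
Qed.

End glueing.

(** * Rapidly oscillating signs have small averages *)

Section oscillation.
Context (R : realType).
Variables (b : R) (N : nat).
Hypotheses (b0 : 0 < b) (bN : b = pi *+ 2 *+ N).

(** An approximation of the sign of cos(b y) as c increases to 1, with the explicit primitive
    [prim c], of size at most pi / (2 b). *)
Let osc c (y : R) : R := c * cos (b * y) / Num.sqrt (1 - (c * sin (b * y)) ^+ 2).
Let prim c (y : R) : R := asin (c * sin (b * y)) / b.

Let arg_lt1 c y : 0 <= c < 1 -> -1 < c * sin (b * y) < 1.
Proof.
move=> /andP[c0 c1]; have s1 := sin_geN1 (b * y); have s2 := sin_le1 (b * y).
by apply/andP; split; nra.
Qed.

Let den_gt0 c y : 0 <= c < 1 -> 0 < 1 - (c * sin (b * y)) ^+ 2.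
Proof.
by move=> /(arg_lt1 y); move: (c * sin _) => s /andP[s1 s2]; nra.
Qed.

Let dsin (y : R) : is_derive y 1 (fun y => sin (b * y)) (cos (b * y) * b).
Proof. exact: (@is_derive1_compf R sin (fun x => b * x) y _ _ (is_derive_sin (b * y)) (is_derive1_scale b y)). Qed.

Let dprim c (y : R) : 0 <= c < 1 -> is_derive y 1 (prim c) (osc c y).
Proof.
move=> cb; have db := is_derive1Ml c (dsin y).
have d := @is_derive1_compf R asin (fun y => c * sin (b * y)) y _ _ (is_derive1_asin (arg_lt1 y cb)) db.
apply: is_derive1_eq (is_derive1M d (is_derive1_cst y b^-1)) _.
have := den_gt0 y cb; rewrite -sqrtr_gt0 => s0.
by rewrite /osc; field; rewrite !gt_eqF.
Qed.

Let cbz : continuous (fun z : R * R => b * z.2).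
Proof. by apply: continuous_mul; [exact: continuous_const|move=> z; exact: cvg_snd]. Qed.

Let continuous_osc c : 0 <= c < 1 -> continuous (fun z : R * R => osc c z.2).
Proof.
move=> cb; have cC := continuous_compr (@continuous_cos R) cbz.
have cS := continuous_compr (@continuous_sin R) cbz.
have cq : continuous (fun z : R * R => c * sin (b * z.2)).
  by apply: continuous_mul => //; exact: continuous_const.
have cr : continuous (fun z : R * R => Num.sqrt (1 - (c * sin (b * z.2)) ^+ 2)).
  apply: (continuous_compr (@sqrt_continuous R)).
  by apply: continuous_add; [exact: continuous_const|apply: continuous_opp; exact: continuous_mul].
apply: continuous_mul; first by apply: continuous_mul => //; exact: continuous_const.
by apply: continuous_inv => // z; rewrite gt_eqF// sqrtr_gt0 den_gt0.
Qed.

Let continuous_prim c : 0 <= c < 1 -> continuous (fun z : R * R => prim c z.2).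
Proof.
move=> cb; have cp : continuous (prim c).
  by apply: (@is_derive1_continuous R _ (osc c)) => y; exact: dprim.
by apply: (continuous_compr cp) => z; exact: cvg_snd.
Qed.

Let osc_le1 c y : 0 <= c < 1 -> `|osc c y| <= 1.
Proof.
move=> cb; have d0 := den_gt0 y cb; have /andP[c0 c1] := cb.
rewrite /osc normrM normfV (ger0_norm (sqrtr_ge0 _)) ler_pdivrMr ?sqrtr_gt0// mul1r.
rewrite -sqrtr_sqr ler_wsqrtr// !exprMn sin2cos2; nra.
Qed.

Let cvg_osc y : cos (b * y) != 0 -> osc (1 - j.+1%:R^-1) y @[j --> \oo] --> pm (cos (b * y)).
Proof.
move=> c0; have -> : pm (cos (b * y)) = osc (1 - 0) y.
  rewrite /osc subr0 !mul1r -cos2sin2 sqrtr_sqr /pm; case: ifPn => [h|].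
    by rewrite gtr0_norm// divff.
  by rewrite -leNgt => h; rewrite ler0_norm// invrN mulrN divff.
have cc : (1 - j.+1%:R^-1 : R) @[j --> \oo] --> (1 - 0 : R).
  by apply: cvgB; [exact: cvg_cst|exact: cvg_harmonic0].
apply: cvgM; first by apply: cvgMr_tmp.
apply: cvgV; first by rewrite subr0 !mul1r -cos2sin2 sqrtr_sqr normr_eq0.
apply: (@cvg_comp _ _ _ (fun j => 1 - ((1 - j.+1%:R^-1) * sin (b * y)) ^+ 2) Num.sqrt _ (nbhs (1 - ((1 - 0) * sin (b * y)) ^+ 2))); last exact: sqrt_continuous.
apply: cvgB; first exact: cvg_cst.
by apply: cvgM; apply: cvgMr_tmp.
Qed.

(** The sign of cos(b y) is the derivative of asin(sin(b y)) / b, so an integration by parts in y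
    gains a factor 1/b. The kinks of this primitive are avoided by working with [osc c] for c < 1
    and letting c tend to 1. *)
Lemma oscillation_small (G Gy : R * R -> R) (L : R) : continuous G -> continuous Gy ->
  (forall x y : R, is_derive y 1 (fun y => G (x, y)) (Gy (x, y))) ->
  (forall x, G (x, 1) = G (x, 0)) -> (forall z, @cell R z -> `|Gy z| <= L) ->
  `|\int[@leb2 R]_(z in @cell R) (pm (cos (b * z.2)) * G z)| <= pi / 2 / b * L * Num.sqrt 2.
Proof.
move=> cG cGy dG pG hL.
have cj j : 0 <= (1 - j.+1%:R^-1 : R) < 1.
  by rewrite subr_ge0 invf_le1// ler1n /= gtrBl invr_gt0.
have bound c : 0 <= c < 1 -> `|\int[@leb2 R]_(z in @cell R) (osc c z.2 * G z)| <= pi / 2 / b * L * Num.sqrt 2.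
  move=> cb; have co := continuous_osc cb; have cp := continuous_prim cb.
  have c1 := continuous_mul co cG; have c2 := continuous_mul cp cGy.
  have E : \int[@leb2 R]_(z in @cell R) (osc c z.2 * G z) + \int[@leb2 R]_(z in @cell R) (prim c z.2 * Gy z) = 0.
    rewrite -RintegralD; [|exact: measurable_cell|exact: integrable_cell c1|exact: integrable_cell c2].
    rewrite (Rintegral_cell12 (continuous_add c1 c2)).
    rewrite (_ : (fun x : R => _) = cst 0) ?Rintegral_cst ?mul0r//.
    apply/funext => x; apply: (Rintegral_FTC0 (F := fun y => prim c y * G (x, y))).
    - exact: ltr01.
    - by move=> y; exact: (is_derive1M (dprim y cb) (dG x y)).
    - exact: (continuous_pairr (x := x) (continuous_add c1 c2)).
    - by rewrite /prim mulr0 mulr1 {2}bN -[pi *+ 2 *+ N]add0r sinDn pG.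
  rewrite -normrN (addr0_eq E); apply: le_Rintegral_bounded.
  - exact: measurable_cell.
  - exact: leb2_cell.
  - by apply: measurable_funTS; exact: measurable_continuous2.
  - move=> z cz; rewrite normrM ler_pM ?hL//.
    rewrite /prim normrM normfV (gtr0_norm b0) ler_pM2r ?invr_gt0// ler_norml.
    have /andP[a1 a2] := arg_lt1 z.2 cb.
    by rewrite asin_geNpi2 ?asin_lepi2//; apply/andP; split; exact: ltW.
have cv : \int[@leb2 R]_(z in @cell R) (osc (1 - j.+1%:R^-1) z.2 * G z) @[j --> \oo] -->
    \int[@leb2 R]_(z in @cell R) (pm (cos (b * z.2)) * G z).
  have [M M0 hM] := bounded_box2 0 (Num.sqrt 2) 0 1 cG.
  apply: (@cvg_Rintegral_bounded _ _ _ _ _ _ _ M).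
  - exact: measurable_cell.
  - exact: leb2_cell_lty.
  - move=> j; apply: measurable_funTS; apply: measurable_continuous2.
    by apply: continuous_mul => //; exact: continuous_osc.
  - apply: measurable_funTS; apply: measurable_funM; last exact: measurable_continuous2.
    apply: (measurableT_comp (@measurable_pm R)).
    exact: (measurable_continuous2 (continuous_compr (@continuous_cos R) cbz)).
  - move=> j [x y] /cell_box[/= xb yb]; rewrite normrM -[M]mul1r ler_pM//.
      exact: osc_le1.
    exact: hM.
  - apply: (ae_sub _ (stripes_ae_neq0 b0 b0 true 0)) => w; rewrite /stripes mul0r add0r mul1r => nz _.
    by apply: cvgMr_tmp; exact: cvg_osc.
set B := _ * Num.sqrt 2 in bound *.
have cB : (fun=> B) j @[j --> \oo] --> B by exact: cvg_cst.
have cn : `|\int[@leb2 R]_(z in @cell R) (osc (1 - j.+1%:R^-1) z.2 * G z)| @[j --> \oo] -->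
    `|\int[@leb2 R]_(z in @cell R) (pm (cos (b * z.2)) * G z)| by apply: cvg_norm.
by apply: (ler_cvg_to cn cB); apply: nearW => j; exact: bound.
Qed.

End oscillation.

Lemma Rintegral0_eq d (T : measurableType d) (R : realType) (mu : {measure set T -> \bar R})
    (D : set T) (f : T -> R) : (forall x, D x -> f x = 0) -> \int[mu]_(x in D) f x = 0.
Proof. by move=> f0; rewrite /Rintegral integral0_eq// => x /f0 ->. Qed.

(* Unification otherwise unfolds [partial] to the limit defining the derivative. *)
#[local] Opaque partial.

(** * The weak equation across t = 1/2 and the dissipation *)

Section weak_formulation.
Context (R : realType).
Variables (rho : R) (g : nat) (gam : R).
Hypotheses (rho01 : 0 < rho < 1) (g0 : (0 < g)%N).
Hypotheses (gam1 : 1 < gam) (gam4 : gam ^+ 4 = 2).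
Hypothesis rho_gam : 1 <= rho * gam.

Notation tau := (tau rho).
Notation theta := (theta rho g).
Notation vel := (vel rho g).
Notation stage := (stage rho).

Let vel_bd := vel_bound rho01 g0 gam1 gam4 rho_gam.

Section with_test.
Variable phi : R * (R * R) -> R.
Hypothesis test_phi : test_function phi.

Let cp := test_function_continuous test_phi.
Let cpt : continuous (d_t phi) := @test_function_continuous_partial R phi test_phi (inord 0).
Let cpx := @test_function_continuous_partial R phi test_phi (inord 1).
Let cpy := @test_function_continuous_partial R phi test_phi (inord 2).

Lemma measurable_u_dot_grad : measurable_fun [set: R_plane R] (u_dot_grad vel phi).
Proof.
apply: measurable_funD; apply: measurable_funM.
- exact: measurable_vel1.
- exact: measurable_continuous3.
- exact: measurable_vel2.
- exact: measurable_continuous3.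
Qed.

Lemma bounded_u_dot_grad t1 t2 : exists2 M, 0 <= M &
  forall z, slab t1 t2 z -> `|u_dot_grad vel phi z| <= M.
Proof.
have [A A0 hA] := bounded_slab t1 t2 cpx; have [B B0 hB] := bounded_slab t1 t2 cpy.
have C0 := vel_const_ge0 g rho01.
exists (vel_const rho g * A + vel_const rho g * B) => [|z sz]; first by apply: addr_ge0; exact: mulr_ge0.
have [] := vel_bd z.1 z.2; rewrite /u_dot_grad.
move: (vel z.1 z.2).1 (vel z.1 z.2).2 (partial _ phi z) (hA _ sz) (partial _ phi z) (hB _ sz).
move=> v1 v2 p1 a1 p2 a2 b1 b2.
apply: le_trans (ler_normD _ _) _; rewrite !normrM; apply: lerD.
  by apply: ler_pM; [exact: normr_ge0|exact: normr_ge0|exact: b1|exact: a1].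
by apply: ler_pM; [exact: normr_ge0|exact: normr_ge0|exact: b2|exact: a2].
Qed.

Lemma u_dot_grad_slice0 t : \int[@leb2 R]_(w in @cell R) u_dot_grad vel phi (t, w) = 0.
Proof.
have z0 : (forall w, vel t w = (0, 0)) -> \int[@leb2 R]_(w in @cell R) u_dot_grad vel phi (t, w) = 0.
  move=> h; apply: Rintegral0_eq => w _; rewrite /u_dot_grad /= h /=.
  by move: (partial _ _ _) (partial _ _ _) => q1 q2; rewrite !mul0r addr0.
have [at_|/negbTE nat_] := boolP (active t); last by apply: z0 => w; rewrite /vel nat_.
have st := stageP rho01 at_; have [t1 t2] := andP st.
have tn : tau (stage t) <= t <= tau (stage t).+1 by rewrite t1 ltW.
have /andP[w0 _] := gap_in rho01 tn.
(* At the singular instant the amplitude is 1, beyond the reach of [solenoidal_drift], but the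
   velocity is 0 there. *)
have [w|wn] := eqVneq (gap rho (stage t) t) 0.
  apply: z0 => -[x y]; rewrite /vel at_ /drift1 /drift2 /vel1 /vel2 /=.
  by rewrite (speed_gap0 g0 w) !mul0r.
have wp : 0 < gap rho (stage t) t by rewrite lt_neqAle eq_sym wn.
have kb : 0 <= kap rho g (stage t) t < 1 by rewrite kap_lt1// andbT; case/andP: (kap_in g rho01 tn).
have [v1x [v2y [c1 c2 c1x c2y d1 d2 div p1 p2]]] := solenoidal_drift kb.
rewrite /u_dot_grad /= /vel at_ /=.
apply: (@divergence_cell _ _ _ v1x v2y (fun w => phi (t, w))) => //.
- exact: continuous_pairr.
- exact: (continuous_pairr (x := t) cpx).
- exact: (continuous_pairr (x := t) cpy).
- by move=> x y; exact: test_function_derive_x.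
- by move=> x y; exact: test_function_derive_y.
- by move=> y; rewrite p1 test_function_periodic_x.
- by move=> x; rewrite p2 test_function_periodic_y.
Qed.

Lemma u_dot_grad_slab0 t1 t2 : \int[@leb3 R]_(z in slab t1 t2) u_dot_grad vel phi z = 0.
Proof.
have [M M0 hM] := bounded_u_dot_grad t1 t2.
rewrite (Rintegral_slab12 (measurable_funTS measurable_u_dot_grad) hM).
by apply: Rintegral0_eq => t _; exact: u_dot_grad_slice0.
Qed.

Definition weak_integrand (z : R * (R * R)) : R := theta z.1 z.2 * (d_t phi z + u_dot_grad vel phi z).

Lemma measurable_material_vel : measurable_fun [set: R_plane R] (fun z => d_t phi z + u_dot_grad vel phi z).
Proof.
by apply: measurable_funD; [exact: measurable_continuous3|exact: measurable_u_dot_grad].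
Qed.

Lemma bounded_material_vel t1 t2 : exists2 M, 0 <= M & forall z, slab t1 t2 z -> `|d_t phi z + u_dot_grad vel phi z| <= M.
Proof.
have [A A0 hA] := bounded_slab t1 t2 cpt; have [B B0 hB] := bounded_u_dot_grad t1 t2.
exists (A + B) => [|z sz]; first exact: addr_ge0.
by apply: le_trans (ler_normD _ _) _; rewrite lerD ?hA ?hB.
Qed.

Lemma measurable_weak_integrand : measurable_fun [set: R_plane R] weak_integrand.
Proof. by apply: measurable_funM; [exact: measurable_theta|exact: measurable_material_vel]. Qed.

Lemma bounded_weak_integrand t1 t2 : exists2 M, 0 <= M & forall z, slab t1 t2 z -> `|weak_integrand z| <= M.
Proof.
have [M M0 hM] := bounded_material_vel t1 t2; exists M => // z sz.
by rewrite normrM -[M]mul1r ler_pM ?theta_le1 ?hM.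
Qed.

Lemma slab_empty t : slab t t = set0 :> set (R_plane R).
Proof.
by apply/seteqP; split=> // -[s w] [/=]; rewrite in_itv/= => /andP[a b]; have := le_lt_trans a b; rewrite ltxx.
Qed.

(** Boundary terms of consecutive stages cancel by [slice_int_glue], and the one at t = 0 vanishes
    because test functions do. *)
Lemma telescope n : \int[@leb3 R]_(z in slab 0 (tau n)) weak_integrand z = slice_int rho g n phi (tau n).
Proof.
elim: n => [|n IH].
  rewrite tau0 slab_empty Rintegral_set0; apply/esym/Rintegral0_eq => w _.
  by rewrite (test_function_start test_phi) mulr0.
have [M M0 hM] := bounded_weak_integrand 0 (tau n.+1).
rewrite (@Rintegral_slab_split _ _ (tau n) _ _ M) ?tau_ge0 ?(ltW (tau_lt rho01 n))//; last by apply: measurable_funTS; exact: measurable_weak_integrand.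
rewrite IH -slice_int_glue// [X in _ + X](_ : _ = slice_int rho g n phi (tau n.+1) - slice_int rho g n phi (tau n)).
  by ring.
rewrite -(transport_stage rho01 g0 n test_phi).
apply: eq_Rintegral => -[t w] /set_mem[/=]; rewrite in_itv/= => tn _.
by rewrite /weak_integrand /material /u_dot_grad /= /theta /vel (active_stage rho01 tn) (stageE rho01 tn).
Qed.

(** At stages divisible by 4 the scalar is the sign of cos(2 pi 2^j y), which tends weakly to 0. *)
Lemma cvg_slice_int0 : slice_int rho g (4 * j) phi (tau (4 * j)) @[j --> \oo] --> (0 : R).
Proof.
have [L L0 hL] := bounded_box3 0 1 0 (Num.sqrt 2) 0 1 cpy.
apply/norm_cvg0P.
apply: (@squeeze_cvgr _ _ _ _ (fun=> 0) (fun j => j.+1%:R^-1 * (L * Num.sqrt 2))).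
- apply: nearW => j; rewrite normr_ge0 /=.
  pose b : R := pi *+ 2 * 2 ^+ j.
  have b0 : 0 < b by rewrite mulr_gt0 ?exprn_gt0// pmulrn_lgt0 ?pi_gt0.
  have bN : b = pi *+ 2 *+ (2 ^ j) by rewrite /b -[RHS]mulr_natr natrX.
  have tb : 0 <= tau (4 * j) <= 1.
    by rewrite tau_ge0//=; have := tau_lt_half rho01 (4 * j); lra.
  have hLt z : @cell R z -> `|partial (inord 2) phi (tau (4 * j), z)| <= L.
    by case: z => x y /cell_box[/= xb yb]; exact: hL.
  have := oscillation_small b0 bN (continuous_pairr (x := tau (4 * j)) cp) (continuous_pairr (x := tau (4 * j)) cpy)
    (fun x y => test_function_derive_y test_phi (tau (4 * j)) x y)
    (fun x => test_function_periodic_y test_phi (tau (4 * j)) x) hLt.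
  have -> : \int[@leb2 R]_(z in @cell R) (pm (cos (b * z.2)) * phi (tau (4 * j), z)) =
      slice_int rho g (4 * j) phi (tau (4 * j)).
    apply: eq_Rintegral => w _; rewrite phase_start ?modnMr//.
    by rewrite (_ : (4 * j %/ 4)%N = j)// mulKn.
  move=> h; apply: le_trans h _; rewrite -mulrA ler_wpM2r ?mulr_ge0//.
  have -> : pi / 2 / b = (2 ^+ j.+2)^-1.
    have p0 : (pi : R) != 0 by rewrite gt_eqF// pi_gt0.
    have q0 : (2 : R) ^+ j != 0 by rewrite expf_neq0.
    rewrite /b !exprS -(mulr_natl pi 2); move: (pi : R) p0 => p p0.
    by field; rewrite ?p0 ?q0.
  rewrite lef_pV2 ?posrE ?exprn_gt0// -natrX ler_nat.
  by apply: ltnW; apply: ltnW; exact: ltn_expl.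
- exact: cvg_cst.
- by apply: cvg_mul0; exact: cvg_harmonic0.
Qed.

(** The integrals over [0, tau n) converge to the one over [0, 1/2), so their limit may be read off
    the subsequence n = 4 j, along which the boundary term tends to 0. *)
Lemma transport_half : \int[@leb3 R]_(z in slab 0 (1 / 2)) weak_integrand z = 0.
Proof.
have [M M0 hM] := bounded_weak_integrand 0 (1 / 2).
have c : \int[@leb3 R]_(z in slab 0 (tau (4 * j))) weak_integrand z @[j --> \oo] --> \int[@leb3 R]_(z in slab 0 (1 / 2)) weak_integrand z.
  apply: (@cvg_slab_inner _ _ _ (fun=> 0) (fun j => tau (4 * j)) _ M) => //.
  - by apply: measurable_funTS; exact: measurable_weak_integrand.
  - by move=> j; apply: ltW; exact: tau_lt_half.
  - exact: cvg_cst.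
  - have := cvg_tau rho01 => ct; apply: (@cvg_comp _ _ _ (fun j => 4 * j)%N tau _ \oo) => //.
    by move=> A [N _ hN]; exists N => // j /= Nj; apply: hN => /=; apply: leq_trans Nj _; rewrite leq_pmull.
rewrite -(cvg_lim (@Rhausdorff R) c).
apply: (cvg_lim (@Rhausdorff R)); under eq_fun do rewrite telescope.
exact: cvg_slice_int0.
Qed.

End with_test.

Lemma st_integrable_bounded (h : R -> R * R -> R) (M : R) :
  measurable_fun [set: R_plane R] (fun z => h z.1 z.2) -> (forall t x, `|h t x| <= M) ->
  st_integrable h.
Proof.
move=> mh hM; apply: (@integrable_bounded _ _ _ (@leb3 R) _ (fun z => h z.1 z.2) M).
- exact: measurable_spacetime.
- exact: leb3_spacetime_lty.
- exact: measurable_funTS.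
- by move=> z _; exact: hM.
Qed.

Lemma transport_defined_bounded (h : R -> R * R -> R) :
  measurable_fun [set: R_plane R] (fun z => h z.1 z.2) -> (forall t x, `|h t x| <= 1) ->
  transport_defined vel h.
Proof.
move=> mh hM; split; first exact: st_integrable_bounded hM.
- apply: (@st_integrable_bounded _ (vel_const rho g)).
    by apply: measurable_funM => //; exact: measurable_vel1.
  move=> t x; rewrite normrM -[leRHS]mulr1 ler_pM//; exact: (vel_bd t x).1.
- apply: (@st_integrable_bounded _ (vel_const rho g)).
    by apply: measurable_funM => //; exact: measurable_vel2.
  move=> t x; rewrite normrM -[leRHS]mulr1 ler_pM//; exact: (vel_bd t x).2.
Qed.

Let half1 : (1 / 2 : R) <= 1. Proof. by lra. Qed.
Let half0 : 0 <= (1 / 2 : R). Proof. by lra. Qed.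

Theorem theta_solves : solves_transport vel theta.
Proof.
split.
  by apply: transport_defined_bounded; [exact: measurable_theta|exact: theta_le1].
move=> phi test_phi; rewrite /transport.
have [M M0 hM] := bounded_weak_integrand test_phi 0 1.
have m := measurable_funTS (measurable_weak_integrand test_phi) : measurable_fun (slab 0 1) _.
rewrite (Rintegral_spacetime m hM) (Rintegral_slab_split half0 half1 m hM).
rewrite (transport_half test_phi) add0r Rintegral0_eq ?oppr0// => -[t w] [/=].
rewrite in_itv/= => /andP[a b] _; rewrite /weak_integrand /theta /active /= [t < _]ltNge a andbF.
by rewrite mul0r.
Qed.

Theorem vel_div_free : div_free vel.
Proof.
move=> phi test_phi; have [M M0 hM] := bounded_u_dot_grad test_phi 0 1.
have m := measurable_funTS (measurable_u_dot_grad test_phi) : measurable_fun (slab 0 1) _.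
by rewrite (Rintegral_spacetime m hM) (u_dot_grad_slab0 test_phi).
Qed.

(** Here theta^2 is the indicator of [0, 1/2). The advective term integrates to 0 since the velocity
    is divergence free, and the time derivative leaves the value of phi at 1/2. *)
Theorem dissipation_theta phi : test_function phi ->
  dissipation vel theta phi = - \int[@leb2 R]_(w in @cell R) phi (1 / 2, w).
Proof.
move=> test_phi; rewrite /dissipation /transport; congr (- _).
have cpt : continuous (d_t phi) := @test_function_continuous_partial R phi test_phi (inord 0).
have [M M0 hM] := bounded_material_vel test_phi 0 1.
have m0 : measurable_fun [set: R_plane R] (fun z => theta z.1 z.2 ^+ 2 * (d_t phi z + u_dot_grad vel phi z)).
  apply: measurable_funM; last exact: measurable_material_vel.
  by apply: measurable_funX; exact: measurable_theta.
have m := measurable_funTS m0 : measurable_fun (slab 0 1) _.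
have hM2 z : slab 0 1 z -> `|theta z.1 z.2 ^+ 2 * (d_t phi z + u_dot_grad vel phi z)| <= M.
  move=> sz; rewrite normrM -[M]mul1r; apply: ler_pM; [exact: normr_ge0|exact: normr_ge0| |exact: hM].
  by rewrite theta_sqr; case: active; rewrite ?normr1 ?normr0.
rewrite (Rintegral_spacetime m hM2) (Rintegral_slab_split half0 half1 m hM2).
rewrite [X in _ + X]Rintegral0_eq; last first.
  move=> -[t w] [/=]; rewrite in_itv/= => /andP[a b] _.
  by rewrite theta_sqr /active /= [t < _]ltNge a andbF mul0r.
have [A A0 hA] := bounded_slab 0 (1 / 2) cpt.
have [B B0 hB] := bounded_u_dot_grad test_phi 0 (1 / 2).
have ma := measurable_slab_continuous (t1 := 0) (t2 := 1 / 2) cpt.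
have mb := measurable_funTS (measurable_u_dot_grad test_phi) : measurable_fun (slab 0 (1 / 2)) _.
transitivity (\int[@leb3 R]_(z in slab 0 (1 / 2)) (d_t phi z + u_dot_grad vel phi z)).
  rewrite addr0; apply: eq_Rintegral => -[t w] /set_mem[/=]; rewrite in_itv/= => tt _.
  by rewrite theta_sqr /active /= tt mul1r.
rewrite RintegralD; [|exact: measurable_slab|exact: integrable_slab hA|exact: integrable_slab hB].
rewrite (u_dot_grad_slab0 test_phi) addr0 (Rintegral_slab21 ma hA).
apply: eq_Rintegral => w _.
have h12 : 0 < (1 / 2 : R) by lra.
have d t := test_function_derive_t test_phi t w.
rewrite (@Rintegral_FTC R (fun t => phi (t, w)) (fun t => d_t phi (t, w)) 0 (1 / 2) h12 d (continuous_pairl cpt)).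
by rewrite (test_function_start test_phi) subr0.
Qed.

End weak_formulation.

(** * Upper bounds for integrals and norms without measurability *)

Section nonmeasurable_integral.
Context d (T : measurableType d) (R : realType) (mu : {measure set T -> \bar R}).
Local Open Scope ereal_scope.

(** The integral of a nonnegative function is a supremum over simple functions below it, hence
    monotone even for nonmeasurable functions; this applies to the Besov norm as a function of
    time. *)
Lemma ge0_le_integralT (f1 f2 : T -> \bar R) : (forall x, 0 <= f1 x) ->
  (forall x, f1 x <= f2 x) -> \int[mu]_x f1 x <= \int[mu]_x f2 x.
Proof.
move=> f10 f12; have f20 x : 0 <= f2 x by apply: le_trans (f10 x) (f12 x).
rewrite !ge0_integralTE//; apply: ereal_sup_le => _ [h hf <-].
by exists h => // x; apply: le_trans (hf x) (f12 x).
Qed.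

Lemma Lnorm_le_integral (q : R) (f : T -> \bar R) (F : T -> \bar R) (c : R) :
  (0 < q)%R -> (0 <= c)%R -> (forall x, `|f x| `^ q <= F x) ->
  \int[mu]_x F x <= c%:E -> 'N[mu]_q%:E[f] <= (c `^ q^-1)%:E.
Proof.
move=> q0 c0 fF Fc; rewrite unlock /= -poweR_EFin.
have h : \int[mu]_x `|f x| `^ q <= c%:E.
  by apply: le_trans Fc; apply: ge0_le_integralT => // x; exact: poweR_ge0.
have iq : (0 <= q^-1)%R by rewrite invr_ge0 ltW.
have hin (x : \bar R) : 0 <= x -> x \in `[0%E, +oo%E] by move=> x0; rewrite in_itv/= x0; exact: leey.
apply: (gt0_ler_poweR iq _ _ h); apply: hin; rewrite ?lee_fin//.
by apply: integral_ge0 => x _; exact: poweR_ge0.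
Qed.

End nonmeasurable_integral.

(** * The torus distance and L^p norms on the torus *)

Section torus_distance.
Context (R : realType).
Implicit Types (l x : R * R).

Lemma torus_norm_ge0 l : 0 <= torus_norm l.
Proof.
apply: lb_le_inf; first by exists (Num.sqrt ((shift (0, 0) l).1 ^+ 2 + (shift (0, 0) l).2 ^+ 2)), (0, 0).
by move=> _ [k _ <-]; exact: sqrtr_ge0.
Qed.

Lemma torus_norm_lb l (X C : R) : 0 <= C ->
  (forall k, X <= C * Num.sqrt ((shift k l).1 ^+ 2 + (shift k l).2 ^+ 2)) ->
  X <= C * torus_norm l.
Proof.
rewrite le_eqVlt => /predU1P[<-|C0] h; first by have := h (0, 0); rewrite !mul0r.
rewrite -ler_pdivrMl//; apply: lb_le_inf.
  by exists (Num.sqrt ((shift (0, 0) l).1 ^+ 2 + (shift (0, 0) l).2 ^+ 2)), (0, 0).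
by move=> _ [k _ <-]; rewrite ler_pdivrMl.
Qed.

Lemma norm1_le_sqrt (u v : R) : `|u| + `|v| <= 2 * Num.sqrt (u ^+ 2 + v ^+ 2).
Proof.
have hu : `|u| <= Num.sqrt (u ^+ 2 + v ^+ 2) by rewrite -sqrtr_sqr ler_wsqrtr// lerDl sqr_ge0.
have hv : `|v| <= Num.sqrt (u ^+ 2 + v ^+ 2) by rewrite -sqrtr_sqr ler_wsqrtr// lerDr sqr_ge0.
by lra.
Qed.

Lemma periodic_shift (f : R * R -> R) k l x : Defs.periodic f ->
  f (x.1 + l.1, x.2 + l.2) = f (x.1 + (shift k l).1, x.2 + (shift k l).2).
Proof. by move=> pf; rewrite -[LHS](pf k) /shift /= !addrA. Qed.

Lemma torus_Lnorm_oo_le (f : R * R -> R) (M : R) : 0 <= M ->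
  (forall x, `|f x| <= M) -> (torus_Lnorm +oo f <= M%:E)%E.
Proof.
move=> M0 fM; rewrite /torus_Lnorm unlock; case: ifP => _; last by rewrite lee_fin.
apply/ess_sup_inf.ess_supP; apply: aeW => x /=; rewrite lee_fin patchE; case: ifP => _ //.
by rewrite normr0.
Qed.

Lemma torus_Lnorm_ge0 p (f : R * R -> R) : (0 <= torus_Lnorm p f)%E.
Proof. exact: Lnorm_ge0. Qed.

Lemma torus_Lnorm_le (q : R) (f : R * R -> R) (S : set (plane R)) (M m : R) :
  0 < q -> 0 <= M -> 0 <= m -> measurable S -> (leb2 S <= m%:E)%E ->
  (forall x, @cell R x -> ~ S x -> f x = 0) -> (forall x, `|f x| <= M) ->
  (torus_Lnorm q%:E f <= (M * m `^ q^-1)%:E)%E.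
Proof.
move=> q0 M0 m0 mS Sm fS fM.
have -> : M * m `^ q^-1 = (M `^ q * m) `^ q^-1.
  by rewrite powRM ?powR_ge0// -powRrM divff ?gt_eqF// powRr1.
apply: (@Lnorm_le_integral _ _ R (@leb2 R) q _ (fun x => ((M `^ q)%:E * (\1_S x)%:E)%E) (M `^ q * m)) => //.
- by rewrite mulr_ge0 ?powR_ge0.
- move=> x; rewrite /= -?EFinM lee_fin /patch indicE.
  have [xS|xS] := boolP (x \in S).
    rewrite mulr1; case: ifP => _ /=.
      by apply: ge0_ler_powR => //; rewrite ?nnegrE// ltW.
    by rewrite normr0 powR0 ?gt_eqF// powR_ge0.
  rewrite mulr0; case: ifPn => [/set_mem cx|_] /=; last by rewrite normr0 powR0 ?gt_eqF.
  by rewrite fS ?normr0 ?powR0 ?gt_eqF// => /mem_set; apply/negP.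
- have mI : measurable_fun [set: plane R] (fun x => (\1_S x)%:E : \bar R).
    by apply/measurable_EFinP; exact: measurable_indic.
  have I0 x : [set: plane R] x -> (0 <= (\1_S x)%:E :> \bar R)%E by rewrite lee_fin.
  have Mq : (0 <= (M `^ q)%:E :> \bar R)%E by rewrite lee_fin powR_ge0.
  rewrite (@ge0_integralZl _ _ R (@leb2 R) _ measurableT _ mI _ I0 Mq).
  by rewrite integral_indic// setIT EFinM; apply: lee_pmul.
Qed.

End torus_distance.

(** * Translation invariance of length and area *)

Section translations.
Context (R : realType).

Definition translate1 (h : R) (x : measurableTypeR R) : measurableTypeR R := x + h.

Lemma measurable_translate1 h : measurable_fun [set: measurableTypeR R] (translate1 h).
Proof.
apply: (@measurable_realfun.measurable_funD _ (measurableTypeR R) R setT (fun x => x) (cst h)) => //.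
Qed.

HB.instance Definition _ h :=
  isMeasurableFun.Build _ _ _ _ (translate1 h) (measurable_translate1 h).

Lemma lebesgue_measure_translate h (A : set (measurableTypeR R)) : measurable A ->
  lebesgue_measure (translate1 h @^-1` A) = lebesgue_measure A.
Proof.
move=> mA; apply/esym.
apply: (@lebesgue_measure_unique R (pushforward (@lebesgue_measure R) (translate1 h))) => //.
move=> _ [[a b]] _ <-; rewrite /pushforward /=.
rewrite [X in _ = lebesgue_measure X](_ : _ = `]a - h, b - h]%classic); last first.
  by apply/seteqP; split=> x /=; rewrite /translate1 !in_itv/= ltrBlDr lerBrDr.
rewrite /= !lebesgue_measure_itv/= !lte_fin ltrD2r.
by case: ifP => // _; rewrite -!EFinB; congr (_%:E); ring.
Qed.

Definition translate2 (l : R * R) (w : plane R) : plane R := (w.1 + l.1, w.2 + l.2).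

Lemma measurable_translate2 l : measurable_fun [set: plane R] (translate2 l).
Proof.
apply: measurable_fun_pair => /=.
  exact: (measurableT_comp (measurable_translate1 l.1) measurable_fst).
exact: (measurableT_comp (measurable_translate1 l.2) measurable_snd).
Qed.

HB.instance Definition _ l :=
  isMeasurableFun.Build _ _ _ _ (translate2 l) (measurable_translate2 l).

Lemma leb2_translate l (A : set (plane R)) : measurable A ->
  leb2 (translate2 l @^-1` A) = leb2 A.
Proof.
move=> mA; apply/esym.
apply: (@product_measure_unique _ _ _ _ R (@lebesgue_measure R) (@lebesgue_measure R)
  (pushforward (@leb2 R) (translate2 l))) => // A1 A2 mA1 mA2.
have m1 : measurable (translate1 l.1 @^-1` A1).
  by rewrite -[X in measurable X]setTI; exact: measurable_translate1.
have m2 : measurable (translate1 l.2 @^-1` A2).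
  by rewrite -[X in measurable X]setTI; exact: measurable_translate1.
apply: etrans (product_measure1E (@lebesgue_measure R) (@lebesgue_measure R) m1 m2) _.
by congr (_ * _)%E; exact: lebesgue_measure_translate.
Qed.


End translations.

(** * Besov bounds from jump sets and from Lipschitz bounds *)

Section jumps.
Context (R : realType).
Implicit Types (f : R * R -> R) (l w : R * R).

(** For a sign-valued function the increment lives on this set and is bounded there, so its L^q norm
    is governed by an area. *)
Definition jump f l : set (plane R) :=
  [set w | @cell R w /\ f (w.1 + l.1, w.2 + l.2) != f w].

Lemma measurable_neq0 (h : plane R -> R) (D : set (plane R)) : measurable D ->
  measurable_fun [set: plane R] h -> measurable (D `&` [set w | h w != 0]).
Proof.
move=> mD mh; apply: measurableI => //.
rewrite (_ : [set w | _] = h @^-1` (~` [set 0])); last first.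
  by apply/seteqP; split=> w /=; move=> /eqP.
by rewrite -[X in measurable X]setTI; apply: mh => //; exact: measurableC.
Qed.

Lemma measurable_jump f l : measurable_fun [set: plane R] f -> measurable (jump f l).
Proof.
move=> mf; rewrite (_ : jump f l = @cell R `&` [set w | f (translate2 l w) - f w != 0]).
  apply: measurable_neq0; first exact: measurable_cell.
  apply: measurable_realfun.measurable_funB => //.
  exact: (measurableT_comp mf (@measurable_translate2 R l)).
by apply/seteqP; split=> w /= [cw h]; split=> //; move: h; rewrite subr_eq0.
Qed.

Lemma jump_le_cell f l : measurable_fun [set: plane R] f -> (leb2 (jump f l) <= 2%:E)%E.
Proof.
move=> mf; apply: (@le_trans _ _ (leb2 (@cell R))).
  by apply: le_measure; rewrite ?inE; [exact: measurable_jump|exact: measurable_cell|move=> w []].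
rewrite leb2_cell lee_fin; have /andP[_] := @sqrt2_bounds R; lra.
Qed.

(** By periodicity the jump set depends on l modulo the lattice only, so the bound may be taken at
    every representative; the factor 2 compares |l.1| + |l.2| with the Euclidean norm. *)
Lemma torus_jump_le f (C : R) : Defs.periodic f -> 0 <= C ->
  (forall l, (leb2 (jump f l) <= (C * (`|l.1| + `|l.2|))%:E)%E) ->
  forall l, (leb2 (jump f l) <= (2 * C * torus_norm l)%:E)%E.
Proof.
move=> pf C0 h l; have j k : jump f l = jump f (shift k l).
  apply/seteqP; split=> w /= [cw ne]; split=> //; apply: contra ne => /eqP e; apply/eqP; rewrite -e.
    exact: periodic_shift.
  exact/esym/periodic_shift.
have fin : leb2 (jump f l) \is a fin_num.
  by rewrite ge0_fin_numE; [exact: le_lt_trans (h l) (ltry _)|exact: measure_ge0].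
rewrite -(fineK fin) lee_fin; apply: torus_norm_lb; first lra.
move=> k; rewrite -lee_fin fineK// (j k); apply: le_trans (h _) _; rewrite lee_fin.
have := norm1_le_sqrt (shift k l).1 (shift k l).2.
by move: (Num.sqrt _) (`|_| + _) => s t st; nra.
Qed.

(* [m = m^(1-bq) m^(bq)]: the first factor is bounded by [E], the second cancels the
   weight [|l|^(-b)]. *)
Lemma besov_jump (q b : R) f (V E C : R) :
  0 < q -> 0 < b -> b * q < 1 -> 0 <= V -> 0 <= E -> 0 <= C ->
  measurable_fun [set: plane R] f ->
  (forall l w, `|f (w.1 + l.1, w.2 + l.2) - f w| <= V) ->
  (forall l, (leb2 (jump f l) <= E%:E)%E) ->
  (forall l, (leb2 (jump f l) <= (C * torus_norm l)%:E)%E) ->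
  (besov_seminorm b q%:E f <= (V * (E `^ (1 - b * q) * C `^ (b * q)) `^ q^-1)%:E)%E.
Proof.
move=> q0 b0 bq V0 E0 C0 mf fV fE fC; apply: ge_ereal_sup => _ [l _ <-].
set N := torus_norm l; have N0 : 0 <= N by exact: torus_norm_ge0.
set m := fine (leb2 (jump f l)); have m0 : 0 <= m by apply: fine_ge0; exact: measure_ge0.
have mE : leb2 (jump f l) = m%:E.
  rewrite fineK// ge0_fin_numE; [exact: le_lt_trans (fE l) (ltry _)|exact: measure_ge0].
have hE : m <= E by rewrite -lee_fin -mE.
have hC : m <= C * N by rewrite -lee_fin -mE.
have bq0 : 0 < b * q by rewrite mulr_gt0.
have lN : (torus_Lnorm q%:E (fun x => f (x.1 + l.1, x.2 + l.2) - f x)%R <= (V * m `^ q^-1)%:E)%E.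
  apply: (@torus_Lnorm_le R q _ (jump f l)) => //; first exact: measurable_jump.
  - by rewrite mE.
  - by move=> x cx; apply: contra_notP => /eqP; rewrite subr_eq0.
apply: le_trans (lee_wpmul2l _ lN) _; first by rewrite lee_fin powR_ge0.
rewrite -EFinM lee_fin mulrCA ler_wpM2l//.
(* By convention 0 raised to a nonzero real power is 0, so the weight vanishes with the torus
   norm. *)
have [N0'|N0'] := eqVneq N 0.
  rewrite N0' powR0 ?mul0r ?powR_ge0// oppr_eq0 gt_eqF//.
have Np : 0 < N by rewrite lt_neqAle eq_sym N0'.
have -> : N `^ (- b) = (N `^ (- (b * q))) `^ q^-1.
  by rewrite -powRrM mulNr mulrK// unitfE gt_eqF.
have iq : 0 <= q^-1 by rewrite invr_ge0 ltW.
rewrite -powRM ?powR_ge0// ge0_ler_powR ?nnegrE ?mulr_ge0 ?powR_ge0//.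
have -> : m = m `^ (1 - b * q) * m `^ (b * q).
  have [->|mn] := eqVneq m 0; first by rewrite [X in _ * X]powR0 ?mulr0// gt_eqF.
  by rewrite -powRD ?mn ?implybT// subrK powRr1.
rewrite mulrCA ler_pM ?mulr_ge0 ?powR_ge0//.
  by rewrite ge0_ler_powR ?nnegrE// subr_ge0 ltW.
apply: (@le_trans _ _ (N `^ (- (b * q)) * (C * N) `^ (b * q))).
  by rewrite ler_wpM2l ?powR_ge0// ge0_ler_powR ?nnegrE ?mulr_ge0//; exact: ltW.
rewrite powRM// mulrCA -powRD ?N0' ?implybT// addNr powRr0 mulr1 //.
Qed.

(** Interpolation: an increment m is split as m^(1-s) m^s, the first factor bounded by the sup norm
    and the second by the Lipschitz constant. *)
Lemma besov_lipschitz (s : R) f (A B : R) : 0 < s < 1 -> 0 <= A -> 0 <= B ->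
  Defs.periodic f -> (forall w, `|f w| <= A) ->
  (forall l w, `|f (w.1 + l.1, w.2 + l.2) - f w| <= B * (`|l.1| + `|l.2|)) ->
  (besov_seminorm s +oo f <= ((2 * A) `^ (1 - s) * (2 * B) `^ s)%:E)%E.
Proof.
move=> /andP[s0 s1] A0 B0 pf fA fB; apply: ge_ereal_sup => _ [l _ <-].
set N := torus_norm l; have N0 : 0 <= N by exact: torus_norm_ge0.
have h1 w : `|f (w.1 + l.1, w.2 + l.2) - f w| <= 2 * A.
  by apply: le_trans (ler_normB _ _) _; have := fA w; have := fA (w.1 + l.1, w.2 + l.2); lra.
have h2 w : `|f (w.1 + l.1, w.2 + l.2) - f w| <= 2 * B * N.
  apply: torus_norm_lb; first lra.
  move=> k; rewrite (periodic_shift k l w pf); apply: le_trans (fB _ _) _.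
  have := norm1_le_sqrt (shift k l).1 (shift k l).2.
  by move: (Num.sqrt _) (`|_| + _) => r t rt; nra.
have lN : (torus_Lnorm +oo (fun x => f (x.1 + l.1, x.2 + l.2) - f x)%R <=
    ((2 * A) `^ (1 - s) * (2 * B * N) `^ s)%:E)%E.
  apply: torus_Lnorm_oo_le; first by rewrite mulr_ge0 ?powR_ge0.
  move=> w; move: (h1 w) (h2 w) (normr_ge0 (f (w.1 + l.1, w.2 + l.2) - f w)).
  move: `|_ - _| => m m1 m2 m0.
  have -> : m = m `^ (1 - s) * m `^ s.
    have [->|mn] := eqVneq m 0; first by rewrite [X in _ * X]powR0 ?mulr0// gt_eqF.
    by rewrite -powRD ?mn ?implybT// subrK powRr1.
  by rewrite ler_pM ?powR_ge0// ge0_ler_powR ?nnegrE ?mulr_ge0//; lra.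
apply: le_trans (lee_wpmul2l _ lN) _; first by rewrite lee_fin powR_ge0.
rewrite -EFinM lee_fin mulrCA ler_wpM2l ?powR_ge0//.
have [N0'|N0'] := eqVneq N 0.
  by rewrite N0' powR0 ?mul0r ?powR_ge0// oppr_eq0 gt_eqF.
by rewrite powRM ?mulr_ge0// mulrCA -powRD ?N0' ?implybT// addNr powRr0 mulr1.
Qed.

End jumps.

(** * Strong measurability in time from right continuity *)

Section sampling.
Context (R : realType).

Let sample_interval (n : nat) (i : nat) : set (measurableTypeR R) :=
  `](i%:R - 1) / n.+1%:R, i%:R / n.+1%:R]%classic.

Let sample_intervalP n i (t : R) :
  sample_interval n i t <-> i%:R - 1 < t * n.+1%:R <= i%:R.
Proof. by rewrite /sample_interval /= in_itv/= ltr_pdivrMr// ler_pdivlMr. Qed.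

Let sample_interval_uniq n i j t : sample_interval n i t -> sample_interval n j t -> i = j.
Proof.
move=> /sample_intervalP/andP[i1 i2] /sample_intervalP/andP[j1 j2].
have : i%:R < j.+1%:R :> R by rewrite -natr1; lra.
have : j%:R < i.+1%:R :> R by rewrite -natr1; lra.
by rewrite !ltr_nat; lia.
Qed.

Let sample_interval_exists n (t : R) : 0 <= t <= 1 ->
  exists i : 'I_n.+2, sample_interval n i t.
Proof.
move=> /andP[t0 t1]; have n0 : 0 < n.+1%:R :> R by [].
have ex : exists i, t * n.+1%:R <= i%:R by exists n.+1; rewrite ler_piMl.
case: (ex_minnP ex) => m m1 m2; have mn : (m < n.+2)%N by rewrite ltnS m2// ler_piMl.
exists (Ordinal mn); apply/sample_intervalP; rewrite m1 andbT /=.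
case: m m1 m2 mn => [|m] m1 m2 mn.
  by apply: lt_le_trans (_ : 0 <= _); [lra|rewrite mulr_ge0].
by rewrite -natr1 addrK ltNge; apply/negP => /m2; rewrite ltnn.
Qed.

(* The approximations are constant on intervals closed on the right, where they take the
   value at the right endpoint; so only right continuity of [f] is needed. *)
Lemma strongly_measurable_right (s : R) (p : \bar R) (f : R -> R * R -> R) :
  (forall t, besov s p (f t)) ->
  {ae @lebesgue_measure R, forall t, `[0, 1]%classic t -> exists2 d, 0 < d &
    forall u : nat -> R, (forall n, t <= u n < t + d) -> u n @[n --> \oo] --> t ->
      besov_norm s p (fun x => f t x - f (u n) x) @[n --> \oo] --> 0%E} ->
  strongly_measurable s p f.
Proof.
move=> bf cf.
(* There are [n.+2] sampling intervals because the one of index 0, which ends at 0, takes care of t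
   = 0. *)
exists (fun n t x => \sum_(i < n.+2) \1_(sample_interval n i) t * f (i%:R / n.+1%:R) x).
  move=> n; exists n.+2, (fun i => sample_interval n i), (fun i => f (i%:R / n.+1%:R)).
  by split=> // i; exact: measurable_itv.
apply: (@ae_sub _ (measurableTypeR R) R (@lebesgue_measure R) _ _ _ cf) => t h t01.
have [d d0 {}h] := h t01.
have /choice[u hu] : forall n, exists v, t <= v <= t + n.+1%:R^-1 /\
    forall x, \sum_(i < n.+2) \1_(sample_interval n i) t * f (i%:R / n.+1%:R) x = f v x.
  move=> n; have n0 : 0 < n.+1%:R :> R by [].
  have [|i ti] := @sample_interval_exists n t; first by move: t01; rewrite /= in_itv.
  exists (i%:R / n.+1%:R); split.
    move: ti => /sample_intervalP/andP[t1 t2]; rewrite ler_pdivlMr// t2/=.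
    by rewrite ler_pdivrMr// mulrDl mulVf ?gt_eqF//; lra.
  move=> x; rewrite (bigD1 i)//= big1 ?addr0; last first.
    move=> j ji; rewrite indicE memNset ?mul0r// => tj.
    by move/eqP: ji; apply; apply/val_inj; exact: sample_interval_uniq tj ti.
  by rewrite indicE mem_set ?mul1r.
have -> : (fun n => besov_norm s p (fun x => f t x - \sum_(i < n.+2)
    \1_(sample_interval n i) t * f (i%:R / n.+1%:R) x)) =
    (fun n => besov_norm s p (fun x => f t x - f (u n) x)).
  by apply/funext => n; congr besov_norm; apply/funext => x; rewrite (hu n).2.
have ut : u n @[n --> \oo] --> t.
  apply: (@squeeze_cvgr _ _ _ R (fun=> t) (fun n => t + n.+1%:R^-1)).
  - by near=> n; exact: (hu n).1.
  - exact: cvg_cst.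
  - by rewrite -[X in _ --> X]addr0; apply: cvgD; [exact: cvg_cst|exact: cvg_harmonic].
(* The sequence is shifted so that all its terms lie within d of t. *)
have [N _ hN] := near_infty_natSinv_lt (PosNum d0).
rewrite -(cvg_shiftn N); apply: h; last by rewrite (cvg_shiftn N).
move=> n; have /andP[-> u2] := (hu (n + N)%N).1; rewrite (le_lt_trans u2)//.
by rewrite ltrD2l; apply: (hN (n + N)%N) => /=; exact: leq_addl.
Unshelve. all: by end_near. Qed.

Lemma cvg_powR0 (a : R) (u : nat -> R) : 0 < a -> (forall n, 0 <= u n) ->
  u n @[n --> \oo] --> 0 -> u n `^ a @[n --> \oo] --> 0.
Proof.
move=> a0 u0 cu; apply/cvgrPdist_lt => e e0.
have ea : 0 < e `^ a^-1 by rewrite powR_gt0.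
move/cvgrPdist_lt: cu => /(_ _ ea); apply: filterS => n.
rewrite !sub0r !normrN !ger0_norm ?powR_ge0// => un.
have -> : e = (e `^ a^-1) `^ a by rewrite -powRrM mulVf ?gt_eqF// powRr1// ltW.
by rewrite gt0_ltr_powR// nnegrE// ltW.
Qed.

End sampling.

(** * Besov norms of functions with small support *)

Section small_support.
Context (R : realType).
Implicit Types (f : R * R -> R).

(** The supremum must range over a nonempty set: the point (sqrt 2 / 2, 0) lies off the lattice. *)
Lemma besov_seminorm_ge0 (s : R) (p : \bar R) f : (0 <= besov_seminorm s p f)%E.
Proof.
have nl : (~` @lattice R) (Num.sqrt 2 / 2, 0).
  move=> [[k1 k2] _ [e _]]; have s0 := @sqrt2_gt0 R.
  have : k1%:~R * 2 = 1 :> R by apply: (mulfI (lt0r_neq0 s0)); move: e; lra.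
  by rewrite -[2]/(2%:~R) -intrM -[1]/(1%:~R) => /intr_inj; lia.
apply: le_trans (ereal_sup_ubound _); last by exists (Num.sqrt 2 / 2, 0).
by rewrite mule_ge0 ?lee_fin ?powR_ge0 ?torus_Lnorm_ge0.
Qed.

Lemma besov_norm_ge0 (s : R) (p : \bar R) f : (0 <= besov_norm s p f)%E.
Proof. by apply: adde_ge0; [exact: torus_Lnorm_ge0|exact: besov_seminorm_ge0]. Qed.

Lemma besov_of_norm (s : R) (p : \bar R) f : measurable_fun [set: plane R] f ->
  Defs.periodic f -> (besov_norm s p f < +oo)%E -> besov s p f.
Proof.
move=> mf pf fin; split=> //; apply: le_lt_trans fin.
  by rewrite /besov_norm leeDl// besov_seminorm_ge0.
by rewrite /besov_norm leeDr// torus_Lnorm_ge0.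
Qed.

(* Contains every translate of [cell] by a point of [cell]. *)
Definition double_cell : set (plane R) :=
  `[0, 2 * Num.sqrt 2[%classic `*` `[0, 2[%classic.

Lemma measurable_double_cell : measurable double_cell.
Proof. by apply: measurableX; exact: measurable_itv. Qed.

Lemma leb2_double_cell_lty : (leb2 double_cell < +oo)%E.
Proof.
rewrite /leb2 product_measure1E; [|exact: measurable_itv|exact: measurable_itv].
by rewrite lte_mul_pinfty ?ge0_fin_numE ?leb_itvco_lty.
Qed.

(** Modulo the lattice l lies in the cell, so that w and w + l both lie in [double_cell]; at a jump
    f is nonzero at one of the two. *)
Lemma leb2_jump_support f (e : R) : measurable_fun [set: plane R] f -> Defs.periodic f ->
  (leb2 (double_cell `&` [set w | f w != 0%R]) <= e%:E)%E ->
  forall l, (leb2 (jump f l) <= (2 * e)%:E)%E.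
Proof.
move=> mf pf fe l.
pose k : int * int := (- Num.floor (l.1 / Num.sqrt 2), - Num.floor l.2).
have s0 := @sqrt2_gt0 R.
have lc : @cell R (shift k l).
  rewrite /cell /shift /= !in_itv/= !mulrNz.
  have /andP[f1 f2] := floor_itv l.2; rewrite intrD in f2.
  have /andP[g1 g2] := floor_itv (l.1 / Num.sqrt 2); rewrite intrD in g2.
  rewrite ler_pdivlMr// in g1; rewrite ltr_pdivrMr// in g2.
  move: g1 g2; move: (Num.sqrt 2) s0 => s s0 g1 g2.
  by split; apply/andP; split; rewrite ?mulrN; nra.
have mB := measurable_double_cell.
have -> : jump f l = jump f (shift k l).
  apply/seteqP; split=> w /= [cw ne]; split=> //; apply: contra ne => /eqP e'; apply/eqP; rewrite -e'.
    exact: periodic_shift.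
  exact/esym/periodic_shift.
set l' := shift k l in lc *.
have mS := measurable_neq0 mB mf.
have mT : measurable (translate2 l' @^-1` (double_cell `&` [set w | f w != 0])).
  by rewrite -[X in measurable X]setTI; exact: measurable_translate2.
apply: (@le_trans _ _ (leb2 ((double_cell `&` [set w | f w != 0]) `|`
  (translate2 l' @^-1` (double_cell `&` [set w | f w != 0]))))).
  apply: le_measure; rewrite ?inE; [exact: measurable_jump|exact: measurableU|].
  move=> [x y] [cw ne]; move: cw lc; rewrite /cell /= !in_itv/= => -[/andP[x0 x1] /andP[y0 y1]] [/andP[a0 a1] /andP[b0 b1]].
  have [f0|f0] := eqVneq (f (x, y)) 0; last first.
    by left; split=> //; split=> /=; rewrite in_itv/=; apply/andP; split; lra.
  right; split; last by move: ne => /=; rewrite f0.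
  by split=> /=; rewrite in_itv/=; apply/andP; split; lra.
apply: (le_trans (@measureU2 _ _ R (@leb2 R) _ _ mS mT)).
rewrite mulr_natl mulr2n EFinD; apply: leeD => //.
by apply: le_trans fe; rewrite -(leb2_translate l' mS).
Qed.

(** In the interpolation of [besov_jump] the area of the support appears with the exponent 1 - b q >
    0, hence the seminorm tends to 0 although the weight forbids a direct L^q argument. *)
Lemma besov_norm_small_support (q b : R) (f : nat -> R * R -> R) (V C : R) (e : nat -> R) :
  0 < q -> 0 < b -> b * q < 1 -> 0 <= V -> 0 <= C ->
  (forall n, measurable_fun [set: plane R] (f n)) -> (forall n, Defs.periodic (f n)) ->
  (forall n w, `|f n w| <= V) ->
  (forall n l, (leb2 (jump (f n) l) <= (C * torus_norm l)%:E)%E) ->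
  (forall n, 0 <= e n) ->
  (forall n, (leb2 (double_cell `&` [set w | f n w != 0%R]) <= (e n)%:E)%E) ->
  e n @[n --> \oo] --> 0 -> besov_norm b q%:E (f n) @[n --> \oo] --> 0%E.
Proof.
move=> q0 b0 bq V0 C0 mf pf fV fC e0 fe ce.
have iq : 0 < q^-1 by rewrite invr_gt0.
pose h n := V * e n `^ q^-1 + 2 * V * ((2 * e n) `^ (1 - b * q) * C `^ (b * q)) `^ q^-1.
have ch : h n @[n --> \oo] --> 0.
  have -> : (0 : R) = V * 0 + 2 * V * 0 by rewrite !mulr0 addr0.
  apply: cvgD; apply: cvgMr.
    exact: cvg_powR0.
  apply: cvg_powR0 => // [n|]; first by rewrite mulr_ge0 ?powR_ge0.
  rewrite -[X in _ --> X](mul0r (C `^ (b * q))); apply: cvgMl.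
  apply: cvg_powR0; [lra|by move=> n; rewrite mulr_ge0|].
  by rewrite -[X in _ --> X](mulr0 2); apply: cvgMr.
have hn n : (0 <= besov_norm b q%:E (f n) <= (h n)%:E)%E.
  rewrite besov_norm_ge0 /besov_norm EFinD /=; apply: leeD.
    apply: (@torus_Lnorm_le R q _ (double_cell `&` [set w | f n w != 0%R])) => //.
      exact: measurable_neq0 measurable_double_cell _.
    move=> [x y] cw; apply: contra_notP => /eqP ne; split=> //.
    move: cw; rewrite /cell /double_cell /= !in_itv/=; have s0 := @sqrt2_gt0 R.
    by move=> [/andP[x0 x1] /andP[y0 y1]]; split; apply/andP; split; lra.
  apply: besov_jump => //; [by rewrite mulr_ge0|by rewrite mulr_ge0| |exact: leb2_jump_support].
  move=> l w; apply: le_trans (ler_normB _ _) _.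
  by have := fV n w; have := fV n (w.1 + l.1, w.2 + l.2); lra.
apply: (squeeze_cvge (nearW _ hn)); first exact: cvg_cst.
by apply: cvg_EFin; [exact: nearW|exact: ch].
Qed.

End small_support.

(** * Jump sets of the striped signs *)

Section stripes_torus.
Context (R : realType).

Lemma periodic_int (f : R -> R) (P : R) : (forall x, f (x + P) = f x) ->
  forall (k : int) x, f (x + P * k%:~R) = f x.
Proof.
move=> fP; elim=> [|n ih|n ih] x; first by rewrite mulr0 addr0.
- by rewrite intS intrD mulrDr mulr1 addrCA addrC fP ih.
- rewrite -(fP (x + P * (- n.+1%:Z)%:~R)) -[RHS]ih; congr f.
  by rewrite !mulrNz intS intrD; ring.
Qed.

Lemma periodicP (f : R * R -> R) : (forall x y, f (x + Num.sqrt 2, y) = f (x, y)) ->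
  (forall x y, f (x, y + 1) = f (x, y)) -> Defs.periodic f.
Proof.
move=> fx fy [k1 k2] [x y]; rewrite /shift /=.
rewrite (@periodic_int (fun x => f (x, y + k2%:~R)) _ (fun x => fx x _)).
by rewrite -[k2%:~R]mul1r (@periodic_int (fun y => f (x, y)) _ (fy x)).
Qed.

Variables (a b : R) (v : bool) (k : R).

Lemma measurable_pm_stripes : measurable_fun [set: plane R] (fun w => pm (stripes a b v k w.1 w.2)).
Proof.
apply: (measurableT_comp (@measurable_pm R)); apply: measurable_continuous2.
exact: stripes_continuous2.
Qed.

(** The translation is made in x, then in y. On each line the sign changes are those of a cosine
    plus a constant, so [switch_measure] bounds the sections; the constants come from 4 (sqrt 2 + 3)
    <= 18 and 16 sqrt 2 <= 24. *)
Lemma jump_stripes (F : R) l : 1 <= a <= F -> 1 <= b <= F ->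
  (leb2 (jump (fun w => pm (stripes a b v k w.1 w.2)) l) <= (24 * F * (`|l.1| + `|l.2|))%:E)%E.
Proof.
move=> /andP[a1 aF] /andP[b1 bF]; have s0 := @sqrt2_gt0 R; have /andP[s1 s2] := @sqrt2_bounds R.
pose f (x y : R) := pm (stripes a b v k x y).
pose S1 : set (plane R) := @cell R `&` [set w | f (w.1 + l.1) (w.2 + l.2) - f w.1 (w.2 + l.2) != 0].
pose S2 : set (plane R) := @cell R `&` [set w | f w.1 (w.2 + l.2) - f w.1 w.2 != 0].
have mf (c : R * R) : measurable_fun [set: plane R] (fun w : plane R => f (w.1 + c.1) (w.2 + c.2)).
  exact: (measurableT_comp measurable_pm_stripes (@measurable_translate2 R c)).
have m1 : measurable S1.
  apply: measurable_neq0; first exact: measurable_cell.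
  apply: measurable_realfun.measurable_funB; first exact: mf.
  have := mf (0, l.2); apply: eq_measurable_fun => w _ /=; by rewrite addr0.
have m2 : measurable S2.
  apply: measurable_neq0; first exact: measurable_cell.
  apply: measurable_realfun.measurable_funB; last exact: measurable_pm_stripes.
  have := mf (0, l.2); apply: eq_measurable_fun => w _ /=; by rewrite addr0.
have l1 : (leb2 S1 <= (18 * F * `|l.1|)%:E)%E.
  have c0 : 0 <= 4 * a * (Num.sqrt 2 + 3) * `|l.1| by rewrite !mulr_ge0//; lra.
  have -> : (18 * F * `|l.1|)%:E = ((18 * F * `|l.1|)%:E * @lebesgue_measure R `[0%R, 1%R[%classic)%E.
    by rewrite lebesgue_measure_itv/= lte01 oppr0 adde0 mule1.
  apply: (@le_trans _ _ ((4 * a * (Num.sqrt 2 + 3) * `|l.1|)%:E * @lebesgue_measure R `[0%R, 1%R[%classic)%E).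
    apply: (@leb2_ysection_le R S1 `[0%R, 1%R[%classic _ m1 (measurable_itv _)); rewrite ?lee_fin//.
      by move=> [x y] [[_ /=]].
    move=> y /=; rewrite in_itv/= => y01.
    have := @switch_measure R (if v then k else 1) ((if v then 1 else k) * cos (b * (y + l.2))) a _ l.1 a1 (ltW s0).
    congr (lebesgue_measure _ <= _)%E; apply/seteqP; split=> x.
      by move=> /= [/andP[x0 x1] h]; rewrite /ysection/= inE; split; [split; rewrite /= in_itv/=; lra|rewrite /= subr_eq0].
    rewrite /ysection/= inE => -[[/= + _]]; rewrite in_itv/= => x01.
    by rewrite subr_eq0.
  rewrite lebesgue_measure_itv/= lte01 oppr0 adde0 !mule1 lee_fin ler_wpM2r//.
  have : a * Num.sqrt 2 <= F * (3 / 2) by apply: ler_pM; lra.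
  by rewrite mulrDr; lra.
have l2 : (leb2 S2 <= (24 * F * `|l.2|)%:E)%E.
  have c0 : 0 <= 4 * b * (1 + 3) * `|l.2| by rewrite !mulr_ge0//; lra.
  apply: (@le_trans _ _ ((4 * b * (1 + 3) * `|l.2|)%:E * @lebesgue_measure R `[0%R, Num.sqrt 2[%classic)%E).
    apply: (@leb2_xsection_le R S2 `[0%R, Num.sqrt 2[%classic _ m2 (measurable_itv _)); rewrite ?lee_fin//.
      by move=> [x y] [[/= ? _]].
    move=> x /=; rewrite in_itv/= => x01.
    have := @switch_measure R (if v then 1 else k) ((if v then k else 1) * cos (a * x)) b _ l.2 b1 ler01.
    congr (lebesgue_measure _ <= _)%E; apply/seteqP; split=> y.
      move=> /= [/andP[y0 y1] h]; rewrite /xsection/= inE; split; first by split; rewrite /= in_itv/=; lra.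
      by rewrite /= subr_eq0 /f /stripes /= ![_ * cos (a * x) + _]addrC.
    rewrite /xsection/= inE => -[[/= _ +]]; rewrite in_itv/= => y01.
    by rewrite subr_eq0 /f /stripes /= ![_ * cos (a * x) + _]addrC.
  rewrite lebesgue_measure_itv/= lte_fin s0 oppr0 adde0 -EFinM lee_fin mulrAC ler_wpM2r//.
  have : b * Num.sqrt 2 <= F * (3 / 2) by apply: ler_pM; lra.
  by lra.
apply: (@le_trans _ _ (leb2 (S1 `|` S2))).
  apply: le_measure; rewrite ?inE; [apply: measurable_jump; exact: measurable_pm_stripes|exact: measurableU|].
  move=> [x y] [cw ne].
  have [e|e] := eqVneq (f (x + l.1) (y + l.2) - f x (y + l.2)) 0; last by left.
  by right; split=> //; rewrite /= -(subr0_eq e) subr_eq0.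
apply: (le_trans (@measureU2 _ _ R (@leb2 R) _ _ m1 m2)).
apply: le_trans (leeD l1 l2) _; rewrite -EFinD lee_fin mulrDr lerD2r ler_wpM2r//; lra.
Qed.

End stripes_torus.

(** * Spatial Besov norm of the scalar *)

Section scalar_besov.
Context (R : realType).
Variables (rho gam : R) (g : nat).
Hypotheses (rho01 : 0 < rho < 1) (g0 : (0 < g)%N).
Hypotheses (gam1 : 1 < gam) (gam4 : gam ^+ 4 = 2).
Notation theta := (theta rho g).
Notation stage := (stage rho).
Notation tau := (tau rho).

Let cosDnat (x : R) m : cos (x + pi *+ 2 *+ m) = cos x.
Proof. exact: cosDn. Qed.

Lemma theta_periodic t : Defs.periodic (theta t).
Proof.
apply: periodicP => x y; rewrite /theta /phase /stripes /=; case: ifP => // _.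
  by rewrite mulrDr freqx_period cosDn.
by rewrite mulrDr mulr1 [X in cos (_ + X)]freqy_period cosDn.
Qed.

Lemma measurable_theta_slice t : measurable_fun [set: plane R] (theta t).
Proof.
exact: (measurableT_comp (measurable_theta g rho01) (@measurable_pair1 _ _ (measurableTypeR R) (plane R) t)).
Qed.

Let gamn1 n : 1 <= gam ^+ n. Proof. by rewrite exprn_ege1// ltW. Qed.

Let gamn0 n : 0 <= gam ^+ n. Proof. by rewrite exprn_ge0// ltW// (lt_trans ltr01). Qed.

Let freq_ge1 n : 1 <= freqx R n <= 12 * gam ^+ n /\ 1 <= freqy R n <= 12 * gam ^+ n.
Proof.
have /andP[x1 ->] := freqx_rate gam1 gam4 n; have /andP[y1 ->] := freqy_rate gam1 gam4 n.
by rewrite !(le_trans (gamn1 n)).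
Qed.

Lemma theta_jump t l :
  (leb2 (jump (theta t) l) <= (2 * (24 * (12 * gam ^+ stage t)) * torus_norm l)%:E)%E.
Proof.
apply: torus_jump_le; [exact: theta_periodic|by rewrite !mulr_ge0|].
move=> {}l; have [fx fy] := freq_ge1 (stage t).
have [at_|nat_] := boolP (active t).
  apply: le_trans (jump_stripes (along_x (stage t)) (kap rho g (stage t) t) l fx fy).
  by rewrite /theta at_.
have -> : jump (theta t) l = set0.
  by apply/seteqP; split=> w //= -[_]; rewrite /theta (negbTE nat_) eqxx.
by rewrite measure0 lee_fin !mulr_ge0 ?addr_ge0// (le_trans ler01).
Qed.

Variables (q beta : R).
Hypotheses (q0 : 0 < q) (beta0 : 0 < beta) (bq : beta * q < 1).

Definition scalar_const : R :=
  2 `^ q^-1 + 2 * (2 `^ (1 - beta * q) * (2 * (24 * 12)) `^ (beta * q)) `^ q^-1.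

Lemma scalar_const_ge0 : 0 <= scalar_const.
Proof. by rewrite addr_ge0 ?mulr_ge0 ?powR_ge0. Qed.

(** The jump area is at most C gam^n |l| at stage n, and its power beta q, after a q-th root,
    becomes gam^(n beta). *)
Lemma besov_norm_theta t : (besov_norm beta q%:E (theta t) <=
  (if active t then scalar_const * (gam ^+ stage t) `^ beta else 0)%:E)%E.
Proof.
have mt := @measurable_theta_slice t; case: ifP => at_; last first.
  have t0 w : theta t w = 0 by rewrite /theta at_.
  rewrite -[leRHS]adde0; apply: leeD.
    apply: (@le_trans _ _ (0 * 2 `^ q^-1)%:E); last by rewrite mul0r.
    apply: (@torus_Lnorm_le R q _ (@cell R)) => //; [exact: measurable_cell| |by move=> w; rewrite t0 normr0].
    by rewrite leb2_cell lee_fin; have /andP[_] := @sqrt2_bounds R; lra.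
  apply: (@le_trans _ _ (0 * (2 `^ (1 - beta * q) * (2 * (24 * (12 * gam ^+ stage t))) `^ (beta * q)) `^ q^-1)%:E); last by rewrite mul0r.
  apply: besov_jump => //; [by rewrite !mulr_ge0|by move=> l w; rewrite !t0 subrr normr0| |exact: theta_jump].
  by move=> l; exact: jump_le_cell.
have G1 : 1 <= (gam ^+ stage t) `^ beta by have := ge0_ler_powR (ltW beta0) ler01 (gamn0 _) (gamn1 (stage t)); rewrite powR1.
rewrite /scalar_const mulrDl EFinD; apply: leeD.
  apply: (@le_trans _ _ (1 * 2 `^ q^-1)%:E).
    apply: (@torus_Lnorm_le R q _ (@cell R)) => //; [exact: measurable_cell| |by move=> w; exact: theta_le1].
    by rewrite leb2_cell lee_fin; have /andP[_] := @sqrt2_bounds R; lra.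
  by rewrite lee_fin mul1r ler_peMr// powR_ge0.
have -> : 2 * (2 `^ (1 - beta * q) * (2 * (24 * 12)) `^ (beta * q)) `^ q^-1 * (gam ^+ stage t) `^ beta =
    2 * (2 `^ (1 - beta * q) * (2 * (24 * (12 * gam ^+ stage t))) `^ (beta * q)) `^ q^-1.
  have -> : 2 * (24 * (12 * gam ^+ stage t)) = 2 * (24 * 12) * gam ^+ stage t by ring.
  rewrite (@powRM R (2 * (24 * 12)) (gam ^+ stage t)) ?mulr_ge0// [in RHS]mulrA.
  rewrite (@powRM R (_ * _) ((gam ^+ stage t) `^ _)) ?mulr_ge0 ?powR_ge0//.
  rewrite -[((gam ^+ _) `^ _) `^ _]powRrM mulfK ?gt_eqF//; exact: esym (mulrA _ _ _).
apply: besov_jump => //; [by rewrite !mulr_ge0| | |exact: theta_jump].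
  move=> l w; apply: le_trans (ler_normB _ _) _.
  by have := theta_le1 rho g t w; have := theta_le1 rho g t (w.1 + l.1, w.2 + l.2); lra.
by move=> l; exact: jump_le_cell.
Qed.

Lemma besov_theta t : besov beta q%:E (theta t).
Proof.
apply: besov_of_norm; [exact: measurable_theta_slice|exact: theta_periodic|].
exact: le_lt_trans (besov_norm_theta t) (ltry _).
Qed.

End scalar_besov.

(** * The scalar in time: integrability and right continuity *)

Section scalar_in_time.
Context (R : realType).
Variables (rho : R) (g : nat).
Hypotheses (rho01 : 0 < rho < 1) (g0 : (0 < g)%N).
Notation theta := (theta rho g).
Notation stage := (stage rho).
Notation tau := (tau rho).
Notation dur := (dur rho).

(** F is dominated by a series of multiples of indicators of the stages, which is integrated term by
    term. *)
Lemma integral_stages_le (F : R -> \bar R) (c : nat -> R) (M : R) :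
  (forall t, 0 <= F t)%E -> (forall n, 0 <= c n) ->
  (forall n t, tau n <= t < tau n.+1 -> (F t <= (c n)%:E)%E) ->
  (forall t, ~~ active t -> F t = 0%E) ->
  (forall N, \sum_(0 <= n < N) c n * dur n <= M) ->
  (\int[@lebesgue_measure R]_t F t <= M%:E)%E.
Proof.
move=> F0 c0 Fc Fn cM.
pose I n : set (measurableTypeR R) := `[tau n, tau n.+1[%classic.
pose G n (t : measurableTypeR R) : \bar R := (c n * \1_(I n) t)%:E.
have mI n : measurable (I n) by exact: measurable_itv.
have G0 n t : (0 <= G n t)%E by rewrite lee_fin mulr_ge0.
have mG n : measurable_fun [set: measurableTypeR R] (G n).
  apply/measurable_EFinP; apply: measurable_realfun.measurable_funM; first exact: measurable_cst.
  exact: measurable_indic.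
apply: (@le_trans _ _ (\int[@lebesgue_measure R]_t \big[+%E/0%R]_(0 <= n <oo) G n t)%E).
  apply: ge0_le_integralT => // t; have [at_|nat_] := boolP (active t); last first.
    by rewrite Fn//; apply: nneseries_ge0.
  have [n tn] := stage_exists rho01 at_; apply: le_trans (Fc _ _ tn) _.
  apply: le_trans (nneseries_lim_ge n.+1 _) => //.
  rewrite big_nat_recr//= -[leLHS]add0e; apply: leeD; first exact: sume_ge0.
  by rewrite /G indicE mem_set ?mulr1// /I /= in_itv.
rewrite integral_nneseries//; apply: lime_le.
  by apply: is_cvg_nneseries => n _ _; exact: integral_ge0.
apply: nearW => N; apply: (@le_trans _ _ (\sum_(0 <= n < N) c n * dur n)%:E); last by rewrite lee_fin.
rewrite -sumEFin; apply: lee_sum => n _.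
have -> : (fun t => G n t) = (fun t => (c n)%:E * (\1_(I n) t)%:E)%E by apply/funext.
have mI1 : measurable_fun [set: measurableTypeR R] (fun t => (\1_(I n) t)%:E : \bar R).
  by apply/measurable_EFinP; exact: measurable_indic.
have I0 t : [set: measurableTypeR R] t -> (0 <= (\1_(I n) t)%:E :> \bar R)%E by rewrite lee_fin.
have cn0 : (0 <= (c n)%:E :> \bar R)%E by rewrite lee_fin.
rewrite (@ge0_integralZl _ _ R (@lebesgue_measure R) _ measurableT _ mI1 _ I0 cn0).
have lI : @lebesgue_measure R (I n) = (dur n)%:E.
  by rewrite /I lebesgue_measure_itv/= lte_fin (tau_lt rho01) -EFinB durE.
by rewrite integral_indic// setIT EFinM -lI.
Qed.

Lemma sum_geometric_le (A z : R) N : 0 <= A -> 0 <= z < 1 ->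
  \sum_(0 <= n < N) A * z ^+ n <= A / (1 - z).
Proof.
move=> A0 /andP[z0 z1]; have d : 0 < 1 - z by rewrite subr_gt0.
have -> : \sum_(0 <= n < N) A * z ^+ n = A * (1 - z ^+ N) / (1 - z).
  elim: N => [|N ih]; first by rewrite big_nil expr0 subrr mulr0 mul0r.
  by rewrite big_nat_recr//= ih exprS; field; rewrite gt_eqF.
by rewrite ler_wpM2r ?invr_ge0 ?(ltW d)// ler_piMr// gerBl exprn_ge0.
Qed.

Variable gam : R.
Hypotheses (gam1 : 1 < gam) (gam4 : gam ^+ 4 = 2).
Variables (q beta : R).
Hypotheses (q0 : 0 < q) (beta0 : 0 < beta) (bq : beta * q < 1).
Hypothesis decay : rho * gam `^ (beta * q) < 1.

(** Stage n contributes about rho^n gam^(n beta q), the general term of a geometric series whose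
    ratio is below 1 by [decay]. *)
Lemma theta_time_norm : (Lnorm (@lebesgue_measure R) q%:E
  ((fun t => besov_norm beta q%:E (theta t)) \_ `[0%R, 1%R]%classic) < +oo)%E.
Proof.
pose K := scalar_const q beta; have K0 : 0 <= K := scalar_const_ge0 q beta.
pose c n := (K * (gam ^+ n) `^ beta) `^ q.
pose F t : \bar R := (if active t then c (stage t) else 0)%:E.
have gp : 0 < gam by apply: lt_trans gam1.
have c0 n : 0 <= c n by exact: powR_ge0.
have Fle (t : measurableTypeR R) : (`|((fun t => besov_norm beta q%:E (theta t)) \_ `[0%R, 1%R]%classic) t| `^ q <= F t)%E.
  rewrite patchE; case: ifP => _; last first.
    by rewrite abse0 poweR0r ?gt_eqF// lee_fin; case: ifP.
  rewrite gee0_abs ?besov_norm_ge0//; have := besov_norm_theta g rho01 gam1 gam4 q0 beta0 bq t.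
  have iq := ltW q0; have hin (x : \bar R) : (0 <= x)%E -> x \in `[0%E, +oo%E].
    by move=> x0; rewrite in_itv/= x0; exact: leey.
  move=> /(gt0_ler_poweR iq (hin _ (besov_norm_ge0 _ _ _)) (hin _ _)) h.
  apply: le_trans (h _) _; first by rewrite lee_fin; case: ifP => // _; rewrite mulr_ge0 ?powR_ge0.
  by rewrite /F; case: ifP => _ /=; rewrite ?powR0 ?gt_eqF.
pose z := rho * gam `^ (beta * q).
have zb : 0 <= z < 1 by rewrite decay andbT mulr_ge0 ?powR_ge0//; case/andP: rho01 => /ltW.
have Fint : (\int[@lebesgue_measure R]_t F t <= (K `^ q * ((1 - rho) / 2) / (1 - z))%:E)%E.
  apply: (@integral_stages_le F c) => //.
  - by move=> t; rewrite lee_fin; case: ifP.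
  - by move=> n t tn; rewrite /F (active_stage rho01 tn) (stageE rho01 tn).
  - by move=> t /negbTE nat_; rewrite /F nat_.
  move=> N; rewrite (eq_bigr (fun n => K `^ q * ((1 - rho) / 2) * z ^+ n)).
    by apply: sum_geometric_le => //; rewrite mulr_ge0 ?powR_ge0//; case/andP: rho01; lra.
  move=> n _; rewrite /c /dur /z powRM ?powR_ge0// -powRrM exprMn.
  have -> : (gam ^+ n) `^ (beta * q) = (gam `^ (beta * q)) ^+ n.
    by rewrite -(powR_mulrn n (ltW gp)) -(powR_mulrn n (powR_ge0 _ _)) -!powRrM mulrC.
  by ring.
apply: le_lt_trans (ltry ((K `^ q * ((1 - rho) / 2) / (1 - z)) `^ q^-1)).
apply: (Lnorm_le_integral q0 _ Fle Fint); case/andP: zb; case/andP: rho01 => *.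
by rewrite divr_ge0 ?mulr_ge0 ?powR_ge0//; lra.
Qed.

(** Within a stage the signs converge almost everywhere, so the area where [theta t] and
    [theta (u k)] differ tends to 0, while the jump sets of their difference stay bounded by the
    frequency of the stage. Inactive times are inactive shortly afterwards, too. *)
Lemma theta_right_continuous t : exists2 d, 0 < d &
  forall u : nat -> R, (forall n, t <= u n < t + d) -> u n @[n --> \oo] --> t ->
    besov_norm beta q%:E (fun x => theta t x - theta (u n) x) @[n --> \oo] --> 0%E.
Proof.
have norm0 s : ~~ active s -> besov_norm beta q%:E (theta s) = 0%E.
  move=> /negbTE ns; apply/eqP; rewrite eq_le besov_norm_ge0 andbT.
  by have := besov_norm_theta g rho01 gam1 gam4 q0 beta0 bq s; rewrite ns.
have [at_|nat_] := boolP (active t); last first.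
  have [t0|t0] := ltP t 0.
    exists (- t); first by rewrite oppr_gt0.
    move=> u ut _; rewrite (_ : (fun n => _) = cst 0%E); first exact: cvg_cst.
    apply/funext => n; rewrite /= -(norm0 _ nat_); congr besov_norm; apply/funext => x.
    rewrite {2}/theta (_ : active (u n) = false) ?subr0//.
    by apply/negbTE; rewrite negb_and -ltNge; case/andP: (ut n) => _; rewrite subrr => ->.
  exists 1 => // u ut _; rewrite (_ : (fun n => _) = cst 0%E); first exact: cvg_cst.
  apply/funext => n; rewrite /= -(norm0 _ nat_); congr besov_norm; apply/funext => x.
  rewrite {2}/theta (_ : active (u n) = false) ?subr0//.
  apply/negbTE; move: nat_; rewrite !negb_and -!leNgt -ltNge ltNge t0 /= => th.
  by rewrite (le_trans th) ?orbT//; case/andP: (ut n).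
have /andP[t1 t2] := stageP rho01 at_; set n := stage t in t1 t2.
exists (tau n.+1 - t); first by rewrite subr_gt0.
move=> u ut cu.
have un k : tau n <= u k < tau n.+1.
  by case/andP: (ut k) => h1 h2; rewrite (le_trans t1 h1)/=; move: h2; rewrite addrC subrK.
have thu k : theta (u k) = fun x => pm (phase rho g n (u k, x)).
  by apply/funext => x; rewrite /theta (active_stage rho01 (un k)) (stageE rho01 (un k)).
have tht : theta t = fun x => pm (phase rho g n (t, x)) by apply/funext => x; rewrite /theta at_.
pose f k x := theta t x - theta (u k) x.
have mf k : measurable_fun [set: plane R] (f k).
  by apply: measurable_realfun.measurable_funB; exact: measurable_theta_slice.
have mB := @measurable_double_cell R.
have mS k : measurable (@double_cell R `&` [set w | f k w != 0]) by exact: measurable_neq0.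
(* A difference of signs is 0, 2 or -2, so the integral [e k] below is the area of the disagreement
   set in [double_cell]. *)
have fI k w : (f k w / 2) ^+ 2 = \1_[set w | f k w != 0] w.
  rewrite indicE; have [f0|f0] := eqVneq (f k w) 0.
    by rewrite memNset /= ?f0 ?mul0r ?expr0n//= => /negP; rewrite eqxx.
  rewrite mem_set//=; move: f0; rewrite /f tht thu /pm; case: ifP => _; case: ifP => _; rewrite ?subrr ?eqxx// => _.
    by field.
  by field.
pose e k := \int[@leb2 R]_(w in @double_cell R) (f k w / 2) ^+ 2.
have mf2 k : measurable_fun [set: plane R] (fun w => (f k w / 2) ^+ 2).
  apply: measurable_realfun.measurable_funX; apply: measurable_realfun.measurable_funM => //.
have ce : e k @[k --> \oo] --> 0.
  rewrite -(@Rintegral0_eq _ _ _ (@leb2 R) (@double_cell R) (fun=> 0)) //.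
  apply: (@cvg_Rintegral_bounded _ _ _ _ _ _ _ 1) => //.
  - exact: leb2_double_cell_lty.
  - by move=> k; exact: measurable_funTS.
  - by move=> k w _; rewrite fI indicE ger0_norm//; case: (_ \in _).
  apply: ae_sub (stripes_ae_neq0 (freqx_gt0 R n) (freqy_gt0 R n) (along_x n) (kap rho g n t)) => w nz _.
  have cp : pm (phase rho g n (u k, w)) @[k --> \oo] --> pm (phase rho g n (t, w)).
    apply: cvg_pm => //; apply: (@cvg_comp _ _ _ u (fun r => phase rho g n (r, w)) _ _ _ cu).
    exact: (continuous_pairl (y := w) (@continuous_phase R rho g n)).
  have cf : f k w / 2 @[k --> \oo] --> 0.
    rewrite -(mul0r 2^-1) -(subrr (theta t w)); apply: cvgMl; apply: cvgB; first exact: cvg_cst.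
    under eq_fun do rewrite thu; rewrite tht; exact: cp.
  by rewrite -(mul0r (0 : R)); apply: (cvgM cf cf).
have bg : 0 <= 2 * (24 * (12 * gam ^+ n)) by rewrite !mulr_ge0// exprn_ge0// ltW// (lt_trans ltr01).
apply: (@besov_norm_small_support R q beta f 2 (2 * (2 * (24 * (12 * gam ^+ n)))) e) => //.
- by rewrite mulr_ge0.
- by move=> k z x; rewrite /f !theta_periodic.
- move=> k w; apply: le_trans (ler_normB _ _) _.
  by have := theta_le1 rho g t w; have := theta_le1 rho g (u k) w; lra.
- move=> k l; have m1 := measurable_jump l (measurable_theta_slice g rho01 t).
  have m2 := measurable_jump l (measurable_theta_slice g rho01 (u k)).
  apply: (@le_trans _ _ (leb2 (jump (theta t) l `|` jump (theta (u k)) l))).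
    apply: le_measure; rewrite ?inE; [exact: measurable_jump|exact: measurableU|].
    move=> w [cw ne]; have [e1|e1] := eqVneq (theta t (w.1 + l.1, w.2 + l.2)) (theta t w); last by left.
    right; split=> //; apply: contra ne => /eqP e2; apply/eqP.
    by rewrite /f; move: e1 e2 => /= -> ->.
  apply: (le_trans (@measureU2 _ _ R (@leb2 R) _ _ m1 m2)).
  rewrite -mulrA mulr_natl mulr2n EFinD; apply: leeD; first exact: theta_jump.
  by have := theta_jump rho g gam1 gam4 (u k) l; rewrite (stageE rho01 (un k)).
- by move=> k; apply: Rintegral_ge0 => w _; exact: sqr_ge0.
move=> k; rewrite /e /Rintegral fineK.
  rewrite (eq_integral (fun w => (\1_(@double_cell R `&` [set w | f k w != 0%R]) w)%:E)); last first.
    by move=> w /set_mem Bw; rewrite fI !indicE in_setI (mem_set Bw).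
  by rewrite integral_indic// [X in (_ <= _ X)%E]setIidl// => w [].
apply: integrable_fin_num => //; apply: (@integrable_bounded _ _ _ _ _ _ 1) => //.
- exact: leb2_double_cell_lty.
- exact: measurable_funTS.
- by move=> w _; rewrite fI indicE ger0_norm//; case: (_ \in _).
Qed.

Lemma theta_Lq_besov : Lq_besov q%:E beta q%:E theta.
Proof.
have bt := besov_theta g rho01 gam1 gam4 q0 beta0 bq.
split.
- by apply: measurable_funTS; exact: measurable_theta.
- by apply: aeW => t _; exact: bt.
- apply: strongly_measurable_right => //; apply: aeW => t _; exact: theta_right_continuous.
- exact: theta_time_norm.
Qed.

End scalar_in_time.

(** * Uniform Hoelder bounds for a velocity component, from size and Lipschitz bounds *)

Section hoelder_in_time.
Context (R : realType).
Variables (rho gam : R) (g : nat) (s : R).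
Hypotheses (rho01 : 0 < rho < 1) (s01 : 0 < s < 1).
Hypotheses (gam1 : 1 < gam) (rho_gam : rho * gam `^ (1 - s) = 1).
Hypothesis gs : 1 <= g%:R * (1 - s).
Notation stage := (stage rho).
Notation tau := (tau rho).
Notation gap := (gap rho).
Notation V := (vel_const rho g).

Variable U : R -> R * R -> R.
Hypotheses (perU : forall t, Defs.periodic (U t))
  (mU : measurable_fun [set: R_plane R] (fun z => U z.1 z.2))
  (U0 : forall t w, ~~ active t -> U t w = 0)
  (U_bound : forall n t w, tau n <= t < tau n.+1 ->
     `|U t w| <= V / rho ^+ n * gap n t ^+ g.-1 / gam ^+ n)
  (U_lipschitz : forall n t w l, tau n <= t < tau n.+1 -> 0 < gap n t ->
     `|U t (w.1 + l.1, w.2 + l.2) - U t w| <=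
       12 * (V / rho ^+ n) / gap n t * (`|l.1| + `|l.2|))
  (U_time : forall n t (u : nat -> R), tau n <= t < tau n.+1 -> 0 < gap n t ->
     (forall k, tau n <= u k < tau n.+1) -> (forall k, gap n t / 2 <= gap n (u k)) ->
     u k @[k --> \oo] --> t -> exists2 A : nat -> R,
       (forall k w, `|U t w - U (u k) w| <= A k) & A k @[k --> \oo] --> 0).

Let g2 : (1 < g)%N.
Proof.
case/andP: s01 => s0 s1; have gs' := gs; rewrite ltnNge; apply/negP => g1.
have : g%:R <= 1 :> R by rewrite (_ : 1 = 1%:R)// ler_nat.
by move=> ?; have : g%:R * (1 - s) <= 1 * (1 - s); [rewrite ler_wpM2r//|]; lra.
Qed.

Let V0 : 0 <= V. Proof. exact: vel_const_ge0. Qed.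
Let rhon n : 0 < rho ^+ n. Proof. by rewrite exprn_gt0//; case/andP: rho01. Qed.
Let gamn n : 0 < gam ^+ n. Proof. by rewrite exprn_gt0// (lt_trans ltr01). Qed.

Let rho_gam1 : 1 <= rho * gam.
Proof.
case/andP: rho01 => r0 _; case/andP: s01 => s0 _.
rewrite -rho_gam ler_pM2l// -[leRHS]powRr1; last by rewrite ltW// (lt_trans ltr01).
by apply: ler_powR; [exact: ltW|rewrite gerBl ltW].
Qed.

(** The total exponent of w is (g - 1) (1 - s) - s = g (1 - s) - 1, nonnegative by the choice of g;
    the power of gam is rho^n by the choice of rho. *)
Lemma hoelder_rate n (w : R) : 0 < w <= 1 ->
  (w ^+ g.-1 / gam ^+ n) `^ (1 - s) * (w^-1) `^ s <= rho ^+ n.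
Proof.
move=> /andP[w0 w1]; case/andP: s01 => s0 s1.
have gs0 : (gam ^+ n) `^ (1 - s) * rho ^+ n = 1.
  have gp : 0 <= gam by rewrite ltW// (lt_trans ltr01).
  have -> : (gam ^+ n) `^ (1 - s) = (gam `^ (1 - s)) ^+ n.
    by rewrite -(powR_mulrn n gp) -(powR_mulrn n (powR_ge0 _ _)) -!powRrM mulrC.
  by rewrite -exprMn mulrC rho_gam expr1n.
rewrite powRM ?exprn_ge0 ?invr_ge0 ?(ltW w0) ?(ltW (gamn n))//.
have -> : ((gam ^+ n)^-1) `^ (1 - s) = rho ^+ n.
  rewrite -(powR_inv1 (ltW (gamn n))) -powRrM mulN1r powRN.
  by apply: (mulfI (lt0r_neq0 (powR_gt0 (1 - s) (gamn n)))); rewrite gs0 divff// gt_eqF// powR_gt0.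
rewrite mulrAC ler_piMl ?(ltW (rhon n))//.
rewrite -(powR_mulrn g.-1 (ltW w0)) -(powR_inv1 (ltW w0)) -!powRrM -powRD ?(gt_eqF w0) ?implybT//.
rewrite -[leRHS](powRr0 w); apply: ger_powR; first by rewrite w0.
have -> : g.-1%:R = g%:R - 1 :> R by rewrite -subn1 natrB// ltnW.
by have gs' := gs; lra.
Qed.

Lemma besov_norm_zero (f : R * R -> R) : (forall w, f w = 0) -> besov_norm s +oo f = 0%E.
Proof.
move=> f0; apply/eqP; rewrite eq_le besov_norm_ge0 andbT -[leRHS]adde0; apply: leeD.
  by apply: torus_Lnorm_oo_le => // w; rewrite f0 normr0.
apply: le_trans (@besov_lipschitz R s f 0 0 s01 (lexx 0) (lexx 0) _ _ _) _.
- by move=> k w; rewrite !f0.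
- by move=> w; rewrite f0 normr0.
- by move=> l w; rewrite !f0 subrr normr0 mul0r.
by rewrite mulr0 powR0 ?mul0r// gt_eqF// subr_gt0; case/andP: s01.
Qed.

Lemma hoelder_norm_le t : (besov_norm s +oo (U t) <= (25 * V)%:E)%E.
Proof.
have h0 : (0 <= (25 * V)%:E :> \bar R)%E by rewrite lee_fin mulr_ge0.
have [at_|nat_] := boolP (active t); last by rewrite besov_norm_zero// => w; exact: U0.
have tn := stageP rho01 at_; set n := stage t in tn.
have tn' : tau n <= t <= tau n.+1 by case/andP: tn => -> /ltW.
have /andP[w0 w1] := gap_in rho01 tn'.
have [w|wn] := eqVneq (gap n t) 0.
  rewrite besov_norm_zero// => x; apply/eqP; rewrite -normr_le0.
  apply: le_trans (U_bound x tn) _; rewrite w expr0n (_ : g.-1 == 0%N = false) ?mulr0 ?mul0r//.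
  by move: g2; case: g => [|[]].
have wp : 0 < gap n t by rewrite lt_neqAle eq_sym wn.
have c0 : 0 <= V / rho ^+ n by rewrite divr_ge0 ?(ltW (rhon n)).
have A0 : 0 <= V / rho ^+ n * gap n t ^+ g.-1 / gam ^+ n.
  by rewrite divr_ge0 ?(ltW (gamn n))// mulr_ge0// exprn_ge0.
have B0 : 0 <= 12 * (V / rho ^+ n) / gap n t by rewrite divr_ge0// mulr_ge0.
(* V bounds the sup norm; 24 V, twice the constant 12 of the Lipschitz bound, bounds the
   seminorm. *)
have -> : (25 * V)%:E = (V%:E + (24 * V)%:E)%E by rewrite -EFinD; congr (_%:E); ring.
apply: leeD.
  apply: torus_Lnorm_oo_le => // w; apply: le_trans (U_bound w tn) _.
  rewrite -mulrA -mulrA ler_piMr// mulrA ler_pdivrMr// mul1r mulrC ler_pdivrMr//.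
  apply: (@le_trans _ _ 1); first by rewrite exprn_ile1.
  by rewrite -exprMn exprn_ege1// mulrC.
apply: le_trans (@besov_lipschitz R s (U t) _ _ s01 A0 B0 (perU t) _ _) _.
- by move=> w; exact: U_bound.
- by move=> l w; exact: U_lipschitz.
rewrite lee_fin; set X := 24 * (V / rho ^+ n); have X0 : 0 <= X by rewrite mulr_ge0.
have s0 : 0 <= s by case/andP: s01 => /ltW.
have s1 : 0 <= 1 - s by rewrite subr_ge0 ltW//; case/andP: s01.
set P := gap n t ^+ g.-1 / gam ^+ n.
have P0 : 0 <= P by apply: divr_ge0; [exact: exprn_ge0|exact: ltW].
have i0 : 0 <= (gap n t)^-1 by rewrite invr_ge0.
apply: (@le_trans _ _ ((X * P) `^ (1 - s) * (X * (gap n t)^-1) `^ s)).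
  have h2 : 0 <= 2 :> R by [].
  have := mulr_ge0 h2 A0; have := mulr_ge0 h2 B0; have := mulr_ge0 X0 P0; have := mulr_ge0 X0 i0.
  move=> *; apply: ler_pM; rewrite ?powR_ge0//; apply: ge0_ler_powR; rewrite ?nnegrE//.
    have -> : 2 * (V / rho ^+ n * gap n t ^+ g.-1 / gam ^+ n) = 2 * (V / rho ^+ n) * P by rewrite /P; ring.
    by rewrite ler_wpM2r// /X ler_wpM2r// ler_nat.
  by rewrite le_eqVlt /X; apply/orP; left; apply/eqP; ring.
have XE : X = X `^ (1 - s) * X `^ s.
  have [->|Xn] := eqVneq X 0; first by rewrite [X in _ * X]powR0 ?mulr0// gt_eqF//; case/andP: s01.
  by rewrite -powRD ?Xn ?implybT// subrK powRr1.
rewrite (powRM _ X0 P0) (powRM _ X0 i0) mulrACA -XE.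
have r0 := gt_eqF (rhon n).
have -> : 24 * V = X * rho ^+ n by rewrite /X; field; rewrite r0.
by rewrite ler_wpM2l//; apply: hoelder_rate; rewrite wp.
Qed.

Lemma measurable_slice t : measurable_fun [set: plane R] (U t).
Proof. exact: (measurableT_comp mU (@measurable_pair1 _ _ (measurableTypeR R) (plane R) t)). Qed.

Lemma besov_slice t : besov s +oo (U t).
Proof.
apply: besov_of_norm; [exact: measurable_slice|exact: perU|].
exact: le_lt_trans (hoelder_norm_le t) (ltry _).
Qed.

(** Where [gap] is positive the Lipschitz constant is controlled uniformly near t, and interpolation
    upgrades uniform convergence to Hoelder convergence. The countably many times [tau n], some of
    which have [gap] equal to 0, are excluded. *)
Lemma hoelder_right_continuous t : 0 <= t -> (forall n, t != tau n) ->
  exists2 d, 0 < d & forall u : nat -> R, (forall n, t <= u n < t + d) ->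
    u n @[n --> \oo] --> t ->
    besov_norm s +oo (fun x => U t x - U (u n) x) @[n --> \oo] --> 0%E.
Proof.
move=> t0 tne; have [at_|nat_] := boolP (active t); last first.
  exists 1 => // u ut _; rewrite (_ : (fun n => _) = cst 0%E); first exact: cvg_cst.
  apply/funext => n; rewrite /= besov_norm_zero// => x; rewrite U0// U0 ?subrr//.
  move: nat_; rewrite !negb_and -!leNgt -ltNge ltNge t0 /= => th.
  by rewrite (le_trans th) ?orbT//; case/andP: (ut n).
have tn := stageP rho01 at_; set n := stage t in tn; have /andP[t1 t2] := tn.
have wp : 0 < gap n t by apply: gap_gt0; rewrite // t2 andbT lt_neqAle eq_sym tne.
have d0 := dur_gt0 rho01 n.
(* The first bound stays within the stage, the second keeps [gap] above half of its value at t. *)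
exists (Num.min (tau n.+1 - t) (gap n t / 2 * dur rho n)).
  by rewrite lt_min subr_gt0 t2/= mulr_gt0// divr_gt0.
move=> u ut cu.
have ud k : [/\ t <= u k, u k < tau n.+1 & u k - t <= gap n t / 2 * dur rho n].
  have /andP[h1] := ut k; rewrite -ltrBlDl lt_min => /andP[h2 h3].
  by split=> //; [move: h2; rewrite ltrBlDl addrC subrK|exact: ltW].
have un k : tau n <= u k < tau n.+1 by have [h1 h2 _] := ud k; rewrite (le_trans t1 h1).
have gu k : gap n t / 2 <= gap n (u k).
  have [h1 _ h3] := ud k; have gE x : gap n x * dur rho n = if odd n then x - tau n else tau n.+1 - x.
    by rewrite /gap divfK// gt_eqF.
  rewrite -(ler_pM2r d0) gE; have := gE t; have := mulr_gt0 wp d0.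
  by case: (odd n) => G0 G; move: h3; lra.
have [A hA cA] := U_time tn wp un gu cu.
have A0 k : 0 <= A k by apply: le_trans (hA k (0, 0)).
pose B := 12 * (V / rho ^+ n) / gap n t + 12 * (V / rho ^+ n) / (gap n t / 2).
have c0 : 0 <= 12 * (V / rho ^+ n) by rewrite mulr_ge0// divr_ge0 ?(ltW (rhon n)).
have B0 : 0 <= B by rewrite addr_ge0// divr_ge0// ltW// divr_gt0.
have hn k : (0 <= besov_norm s +oo (fun x => (U t x - U (u k) x)%R) <=
    (A k + (2 * A k) `^ (1 - s) * (2 * B) `^ s)%:E)%E.
  rewrite besov_norm_ge0 /= EFinD; apply: leeD; first exact: torus_Lnorm_oo_le.
  apply: besov_lipschitz => //; first by move=> j x; rewrite !perU.
  move=> l w; rewrite (_ : _ - _ = (U t (w.1 + l.1, w.2 + l.2) - U t w) -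
    (U (u k) (w.1 + l.1, w.2 + l.2) - U (u k) w)); last by ring.
  apply: le_trans (ler_normB _ _) _; rewrite /B mulrDl; apply: lerD; first exact: U_lipschitz.
  have gk : 0 < gap n (u k) by apply: lt_le_trans (gu k); rewrite divr_gt0.
  apply: le_trans (U_lipschitz _ _ (un k) gk) _; rewrite ler_wpM2r ?addr_ge0//.
  by rewrite ler_wpM2l// lef_pV2// posrE divr_gt0.
apply: (squeeze_cvge (nearW _ hn)); first exact: cvg_cst.
apply: cvg_EFin; first exact: nearW.
rewrite -[X in _ --> X](addr0 0); apply: cvgD => //.
rewrite -[X in _ --> X](mul0r ((2 * B) `^ s)); apply: cvgMl; apply: cvg_powR0.
- by rewrite subr_gt0; case/andP: s01.
- by move=> k; rewrite mulr_ge0.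
by rewrite -[X in _ --> X](mulr0 2); apply: cvgMr.
Qed.

Lemma hoelder_Lq_besov : Lq_besov +oo s +oo U.
Proof.
split.
- exact: measurable_funTS.
- by apply: aeW => t _; exact: besov_slice.
- apply: strongly_measurable_right; first exact: besov_slice.
  apply: (@ae_of_null _ (measurableTypeR R) R (@lebesgue_measure R) (range tau)).
  + rewrite (_ : range tau = \bigcup_n [set tau n]); last first.
      by apply/seteqP; split=> [_ [n _ <-]|t [n _ ->]]; [exists n|exists n].
    by apply: bigcup_measurable => n _; exact: measurable_set1.
  + by apply: countable_lebesgue_measure0; exact: card_image_le.
  move=> t nt; rewrite /= in_itv/= => /andP[t0 t1]; apply: hoelder_right_continuous => // n.
  by apply/eqP => tE; apply: nt; exists n.
apply: le_lt_trans (ltry (25 * V)); rewrite unlock; case: ifP => _; last by rewrite lee_fin mulr_ge0.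
apply/ess_sup_inf.ess_supP; apply: aeW => t /=; rewrite patchE; case: ifP => _.
  by rewrite gee0_abs ?besov_norm_ge0// hoelder_norm_le.
by rewrite abse0 lee_fin mulr_ge0.
Qed.

End hoelder_in_time.

(** * The two velocity components satisfy these bounds *)

Section velocity_besov.
Context (R : realType).

Let pair_variation (f c c' S1 S2 S1' S2' M L : R) : 0 < f ->
  `|S1| <= M -> `|S2| <= M -> `|S1 - S1'| <= L -> `|S2 - S2'| <= L ->
  `|c / f * (S1 + S2) - c' / f * (S1' + S2')| <= (`|c - c'| * (2 * M) + `|c'| * (2 * L)) / f.
Proof.
move=> f0 h1 h2 h3 h4.
have -> : c / f * (S1 + S2) - c' / f * (S1' + S2') =
  ((c - c') * (S1 + S2) + c' * ((S1 - S1') + (S2 - S2'))) / f by ring.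
rewrite normrM normfV (gtr0_norm f0) ler_wpM2r ?invr_ge0 ?(ltW f0)//.
apply: le_trans (ler_normD _ _) _; rewrite !normrM; apply: lerD; apply: ler_wpM2l => //.
  by apply: le_trans (ler_normD _ _) _; lra.
by apply: le_trans (ler_normD _ _) _; lra.
Qed.

Variables (rho gam : R) (g : nat) (s : R).
Hypotheses (rho01 : 0 < rho < 1) (s01 : 0 < s < 1).
Hypotheses (gam1 : 1 < gam) (gam4 : gam ^+ 4 = 2) (rho_gam : rho * gam `^ (1 - s) = 1).
Hypothesis gs : 1 <= g%:R * (1 - s).
Notation tau := (tau rho).
Notation gap := (gap rho).
Notation kap := (kap rho g).
Notation dkap := (dkap rho g).
Notation speed := (speed rho g).
Notation V := (vel_const rho g).
Notation vel := (vel rho g).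

Let g0 : (0 < g)%N.
Proof. by have h := gs; rewrite lt0n; apply/eqP => g0; move: h; rewrite g0 mul0r ler10. Qed.

Let rates n : [/\ 0 < freqx R n, 0 < freqy R n, freqx R n <= 12 * freqy R n,
  freqy R n <= 12 * freqx R n & gam ^+ n <= freqx R n /\ gam ^+ n <= freqy R n].
Proof.
have /andP[x1 x2] := freqx_rate gam1 gam4 n; have /andP[y1 y2] := freqy_rate gam1 gam4 n.
have gn : 0 < gam ^+ n by rewrite exprn_gt0// (lt_trans ltr01).
by split=> //; lra.
Qed.

Let velE n t : tau n <= t < tau n.+1 ->
  vel t = fun w => (drift1 rho g n (t, w), drift2 rho g n (t, w)).
Proof.
by move=> tn; apply/funext => w; rewrite /vel (active_stage rho01 tn) (stageE rho01 tn).
Qed.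

Let shear_periodic_neg k (z : R) n : shear k (z - pi *+ 2 *+ n) = shear k z.
Proof. by rewrite -(shear_periodic k (z - _) n) subrK. Qed.

Let shift_left k (u v : R) n : shear k (u + pi *+ 2 *+ n + v) = shear k (u + v).
Proof. by rewrite addrAC shear_periodic. Qed.

Let shift_right k (u v : R) n : shear k (u + (v + pi *+ 2 *+ n)) = shear k (u + v) /\
  shear k (u - (v + pi *+ 2 *+ n)) = shear k (u - v).
Proof. by rewrite opprD !addrA shear_periodic shear_periodic_neg. Qed.

Lemma vel_periodic t : Defs.periodic (fun w => (vel t w).1) /\ Defs.periodic (fun w => (vel t w).2).
Proof.
have ex x : freqx R (stage rho t) * (x + Num.sqrt 2) =
    freqx R (stage rho t) * x + pi *+ 2 *+ (2 ^ (stage rho t %/ 4).+1).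
  by rewrite mulrDr freqx_period.
have ey y : freqy R (stage rho t) * (y + 1) =
    freqy R (stage rho t) * y + pi *+ 2 *+ (2 ^ ((stage rho t + 2) %/ 4)).
  by rewrite mulrDr mulr1 [X in _ + X]freqy_period.
by split; apply: periodicP => x y; rewrite /vel /drift1 /drift2 /vel1 /vel2 /=; case: ifP => //= _;
  rewrite ?ex ?ey ?shift_left ?(shift_right _ _ _ _).1 ?(shift_right _ _ _ _).2.
Qed.

Let weights_le (f a b x y c : R) : 0 < f -> a <= 12 * f -> b <= 12 * f -> 0 <= c ->
  c / f * (a * `|x| + b * `|y|) <= 12 * c * (`|x| + `|y|).
Proof.
move=> f0 af bf c0; have h : (a * `|x| + b * `|y|) / f <= 12 * (`|x| + `|y|).
  rewrite ler_pdivrMr//; have := ler_wpM2r (normr_ge0 x) af; have := ler_wpM2r (normr_ge0 y) bf.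
  by lra.
have -> : c / f * (a * `|x| + b * `|y|) = c * ((a * `|x| + b * `|y|) / f) by ring.
have -> : 12 * c * (`|x| + `|y|) = c * (12 * (`|x| + `|y|)) by ring.
exact: ler_wpM2l.
Qed.

Let vel_lipschitz n t w l : tau n <= t < tau n.+1 -> 0 < gap n t ->
  `|(vel t (w.1 + l.1, w.2 + l.2)).1 - (vel t w).1| <=
       12 * (V / rho ^+ n) / gap n t * (`|l.1| + `|l.2|) /\
  `|(vel t (w.1 + l.1, w.2 + l.2)).2 - (vel t w).2| <=
       12 * (V / rho ^+ n) / gap n t * (`|l.1| + `|l.2|).
Proof.
move=> tn wp; have [a0 b0 ab ba _] := rates n.
have /andP[k0 _] : 0 <= kap n t <= 1.
  by apply: kap_in => //; case/andP: tn => -> /ltW.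
have c0 : 0 <= V / rho ^+ n / gap n t.
  have [r0 _] := andP rho01.
  by rewrite divr_ge0 ?(ltW wp)// divr_ge0 ?vel_const_ge0// exprn_ge0// ltW.
rewrite (velE tn); case: w => x y; rewrite -[12 * _ / _]mulrA /=; split.
  apply: le_trans (drift1_lipschitz rho01 g0 (x + l.1) (y + l.2) x y wp k0) _.
  rewrite (dur_coef g rho01) ![_ + _ - _]addrAC !subrr !add0r.
  by apply: weights_le => //; have := a0; lra.
apply: le_trans (drift2_lipschitz rho01 g0 (x + l.1) (y + l.2) x y wp k0) _.
rewrite (dur_coef g rho01) ![_ + _ - _]addrAC !subrr !add0r.
by apply: weights_le => //; have := b0; lra.
Qed.

Let vel_bounds n t w : tau n <= t < tau n.+1 ->
  `|(vel t w).1| <= V / rho ^+ n * gap n t ^+ g.-1 / gam ^+ n /\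
  `|(vel t w).2| <= V / rho ^+ n * gap n t ^+ g.-1 / gam ^+ n.
Proof.
move=> tn; have := vel_stage_bound rho01 g0 gam1 gam4 w (active_stage rho01 tn).
by rewrite (stageE rho01 tn).
Qed.

(** As long as [gap] stays above half of its value at t, the amplitude is at most K < 1, so the
    profile is bounded and Lipschitz in its parameter; speed and amplitude are continuous in
    time. *)
Let vel_time n t (u : nat -> R) : tau n <= t < tau n.+1 -> 0 < gap n t ->
  (forall k, tau n <= u k < tau n.+1) -> (forall k, gap n t / 2 <= gap n (u k)) ->
  u k @[k --> \oo] --> t -> exists2 A : nat -> R,
  (forall k w, `|(vel t w).1 - (vel (u k) w).1| <= A k /\
               `|(vel t w).2 - (vel (u k) w).2| <= A k) & A k @[k --> \oo] --> 0.
Proof.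
move=> tn wp un gu cu; have [a0 b0 _ _ _] := rates n.
(* [W] is a lower bound for the square root of 1 - k at all times considered. *)
pose W := (gap n t / 2) ^+ g; pose K := 1 - W ^+ 2.
have W0 : 0 < W by rewrite exprn_gt0// divr_gt0.
have K1 : K < 1 by rewrite gtrBl exprn_gt0.
have kb r : tau n <= r < tau n.+1 -> gap n t / 2 <= gap n r -> 0 <= kap n r <= K.
  move=> rn gr; have /andP[-> _] /= : 0 <= kap n r <= 1.
    by apply: kap_in => //; case/andP: rn => -> /ltW.
  have h2 : 0 <= gap n t / 2 by rewrite divr_ge0// ltW.
  rewrite /kap lerD2l lerN2 /W -exprM muln2; apply: lerXn2r; rewrite ?nnegrE//.
  exact: le_trans gr.
have kt : 0 <= kap n t <= K by apply: kb => //; lra.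
have kt1 : 0 <= kap n t < 1 by case/andP: kt => -> /le_lt_trans -> //.
have Wt : W ^+ 2 <= 1 - kap n t by case/andP: kt => _; rewrite /K; lra.
pose L k := `|kap n t - kap n (u k)| / (1 - K) ^+ 2.
pose A k f := (`|speed n t - speed n (u k)| * (2 * (1 / (2 * W))) + `|speed n (u k)| * (2 * L k)) / f.
have cs : speed n (u k) @[k --> \oo] --> speed n t.
  apply: (@cvg_comp _ _ _ u (speed n) _ _ _ cu); rewrite /speed.
  by case: (along_x n); [|apply: cvgN]; exact: continuous_dkap.
have ck : kap n (u k) @[k --> \oo] --> kap n t.
  by apply: (@cvg_comp _ _ _ u (kap n) _ _ _ cu); exact: continuous_kap.
have cL : L k @[k --> \oo] --> 0.
  rewrite -(mul0r ((1 - K) ^+ 2)^-1) -(@normr0 _ R) -(subrr (kap n t)); apply: cvgMl; apply: cvg_norm.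
  by apply: cvgB => //; exact: cvg_cst.
have cA f : A k f @[k --> \oo] --> 0.
  rewrite -(mul0r f^-1); apply: cvgMl.
  rewrite (_ : 0 = `|speed n t - speed n t| * (2 * (1 / (2 * W))) + `|speed n t| * (2 * 0)); last first.
    by rewrite subrr normr0 mul0r !mulr0 addr0.
  apply: cvgD; first by apply: cvgMl; apply: cvg_norm; apply: cvgB => //; exact: cvg_cst.
  by apply: cvgM; [exact: cvg_norm|exact: cvgMr].
have sb z : `|shear (kap n t) z| <= 1 / (2 * W) by exact: shear_bound.
have sl k z : `|shear (kap n t) z - shear (kap n (u k)) z| <= L k.
  by apply: shear_param_lipschitz => //; exact: kb.
have A0 k f : 0 < f -> 0 <= A k f.
  move=> f0; rewrite /A divr_ge0 ?(ltW f0)// addr_ge0// mulr_ge0// mulr_ge0// divr_ge0//.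
    by rewrite mulr_ge0// ltW.
  by rewrite sqr_ge0.
exists (fun k => A k (freqx R n) + A k (freqy R n)); last first.
  by rewrite -[X in _ --> X](addr0 0); exact: cvgD.
move=> k [x y]; rewrite (velE tn) (velE (un k)) /= /drift1 /drift2 /vel1 /vel2 /=.
split; [apply: (@le_trans _ _ (A k (freqx R n)))|apply: (@le_trans _ _ (A k (freqy R n)))].
- exact: pair_variation.
- by rewrite lerDl A0.
- by apply: pair_variation => //; rewrite ?normrN// -opprD normrN.
- by rewrite lerDr A0.
Qed.

Lemma vel1_Lq_besov : Lq_besov +oo s +oo (fun t x => (vel t x).1).
Proof.
apply: (hoelder_Lq_besov rho01 s01 gam1 rho_gam gs).
- by move=> t; case: (vel_periodic t).
- exact: measurable_vel1.
- by move=> t w /negbTE nt; rewrite /vel nt.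
- by move=> n t w tn; case: (vel_bounds w tn).
- by move=> n t w l tn wp; case: (vel_lipschitz w l tn wp).
- move=> n t u tn wp un gu cu; have [A hA cA] := vel_time tn wp un gu cu.
  by exists A => // k w; case: (hA k w).
Qed.

Lemma vel2_Lq_besov : Lq_besov +oo s +oo (fun t x => (vel t x).2).
Proof.
apply: (hoelder_Lq_besov rho01 s01 gam1 rho_gam gs).
- by move=> t; case: (vel_periodic t).
- exact: measurable_vel2.
- by move=> t w /negbTE nt; rewrite /vel nt.
- by move=> n t w tn; case: (vel_bounds w tn).
- by move=> n t w l tn wp; case: (vel_lipschitz w l tn wp).
- move=> n t u tn wp un gu cu; have [A hA cA] := vel_time tn wp un gu cu.
  by exists A => // k w; case: (hA k w).
Qed.

End velocity_besov.

(** * A smooth compactly supported function of time *)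

Section smooth_functions.
Context (R : realType).

(** One derivative more than the index is required, so that continuity of the last derivative
    counted comes for free. *)
Fixpoint smooth_upto (k : nat) (f : R -> R) : Prop :=
  exists2 df : R -> R, (forall x : R, is_derive x 1 f (df x)) &
    if k is k'.+1 then smooth_upto k' df else True.

Lemma smooth_upto_pred k f : smooth_upto k.+1 f -> smooth_upto k f.
Proof.
elim: k f => [|k ih] f [df dfE h]; first by exists df.
by exists df => //; exact: ih.
Qed.

Lemma smooth_upto_ext k f h : f =1 h -> smooth_upto k f -> smooth_upto k h.
Proof. by move=> /funext ->. Qed.

Lemma smooth_uptoD k f h : smooth_upto k f -> smooth_upto k h -> smooth_upto k (fun x => f x + h x).
Proof.
elim: k f h => [|k ih] f h [df dfE sf] [dh dhE sh].
  by exists (fun x => df x + dh x) => // x; exact: is_derive1D.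
by exists (fun x => df x + dh x); [move=> x; exact: is_derive1D|exact: ih].
Qed.

Lemma smooth_uptoM k f h : smooth_upto k f -> smooth_upto k h -> smooth_upto k (fun x => f x * h x).
Proof.
elim: k f h => [|k ih] f h sf sh; have [df dfE sdf] := sf; have [dh dhE sdh] := sh.
  by exists (fun x => df x * h x + f x * dh x) => // x; exact: is_derive1M.
exists (fun x => df x * h x + f x * dh x); first by move=> x; exact: is_derive1M.
by apply: smooth_uptoD; apply: ih => //; exact: smooth_upto_pred.
Qed.

Lemma smooth_upto_cst k (c : R) : smooth_upto k (fun=> c).
Proof.
elim: k c => [|k ih] c; first by exists (fun=> 0) => // x; exact: is_derive1_cst.
by exists (fun=> 0); [move=> x; exact: is_derive1_cst|exact: ih].
Qed.

Lemma smooth_upto_affine k f (a b : R) : smooth_upto k f -> smooth_upto k (fun x => f (a * x + b)).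
Proof.
elim: k f => [|k ih] f [df dfE sf]; exists (fun x => df (a * x + b) * a).
- move=> x; apply: (@is_derive1_compf R f (fun x => a * x + b) x _ _ (dfE _)).
  by apply: is_derive1_eq (is_derive1D (is_derive1_scale a x) (is_derive1_cst x b)) _; rewrite addr0.
- by [].
- move=> x; apply: (@is_derive1_compf R f (fun x => a * x + b) x _ _ (dfE _)).
  by apply: is_derive1_eq (is_derive1D (is_derive1_scale a x) (is_derive1_cst x b)) _; rewrite addr0.
- by apply: smooth_uptoM; [exact: ih|exact: smooth_upto_cst].
Qed.

Lemma is_Ck_time k f : smooth_upto k f -> is_Ck k (fun z : R * (R * R) => f z.1).
Proof.
have cfst (h dh : R -> R) : (forall x : R, is_derive x 1 h (dh x)) ->
    continuous (fun z : R * (R * R) => h z.1).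
  by move=> dhE; apply: (continuous_compr (is_derive1_continuous dhE)) => z; exact: cvg_fst.
elim: k f => [|k ih] f [df dfE sf]; split=> //; try exact: cfst dfE.
move=> i; split.
  (* For a function of time only, the difference quotients along a basis vector are, by conversion,
     those of [f] along its time component. *)
  move=> z; suff : derivable f z.1 (basis_vec R i).1 by [].
  rewrite /basis_vec /=; case: (_ == _); last exact: derivable0.
  by case: (dfE z.1).
have -> : partial i (fun z : R * (R * R) => f z.1) =
    (fun z => (if i == 0 :> nat then df else fun=> 0) z.1).
  apply/funext => z; transitivity ('D_((basis_vec R i).1) f z.1); first by [].
  rewrite /basis_vec /=; case: (_ == _); last exact: derive0.
  by case: (dfE z.1).
apply: ih; case: ifP => _ //; exact: smooth_upto_cst.
Qed.

(* The derivative of [x ^- m * exp (- 1 / x)] is a combination of such functions. *)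
Definition flat (m : nat) (x : R) : R := if 0 < x then x^-1 ^+ m * expR (- x^-1) else 0.

(** From exp y >= y^(m+2) / (m+2)! at y = 1/x. The quadratic bound makes the derivative at 0
    vanish. *)
Lemma flat_bound m x : `|flat m x| <= (m.+2)`!%:R * x ^+ 2.
Proof.
rewrite /flat; case: ifPn => [x0|_]; last by rewrite normr0 mulr_ge0// sqr_ge0.
have y0 : 0 < x^-1 by rewrite invr_gt0.
rewrite ger0_norm; last by rewrite mulr_ge0 ?exprn_ge0 ?expR_ge0 ?ltW.
rewrite expRN ler_pdivrMr ?expR_gt0//.
apply: (@le_trans _ _ ((m.+2)`!%:R * x ^+ 2 * (x^-1 ^+ m.+2 / (m.+2)`!%:R))).
  have fn : (m.+2)`!%:R != 0 :> R by rewrite pnatr_eq0 -lt0n fact_gt0.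
  rewrite le_eqVlt; apply/orP; left; apply/eqP; rewrite [X in _ = _ * (X / _)]exprSr [X in _ = _ * (X * _ / _)]exprSr.
  move: (m.+2)`!%:R fn => c fn; field; by rewrite fn gt_eqF.
apply: ler_wpM2l; first by rewrite mulr_ge0// sqr_ge0.
by have := @expR_ge1Dxn R x^-1 m.+1 (ltW y0); lra.
Qed.

Lemma is_derive_flat0 (f : R -> R) (C : R) : 0 <= C -> (forall x, `|f x| <= C * x ^+ 2) ->
  is_derive (0 : R) 1 f 0.
Proof.
move=> C0 fC; have f0 : f 0 = 0.
  by apply/eqP; rewrite -normr_le0 (le_trans (fC 0))// expr0n mulr0.
have c : h^-1 *: (f (h *: (1 : R) + 0) - f 0) @[h --> 0^'] --> (0 : R).
  apply/cvgrPdist_le => e e0; near=> h.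
  have h0 : h != 0 by near: h; exact: nbhs_dnbhs_neq.
  rewrite sub0r normrN f0 subr0 addr0 -[h *: 1]/(h * 1) mulr1 -[_ *: _]/(h^-1 * _) normrM normfV.
  rewrite mulrC ler_pdivrMr ?normr_gt0//.
  apply: (@le_trans _ _ (C * `|h| * `|h|)).
    by rewrite -mulrA -normrM -expr2 (ger0_norm (sqr_ge0 h)).
  rewrite ler_wpM2r//; apply: (@le_trans _ _ (C * (e / (C + 1)))).
    by rewrite ler_wpM2l//; near: h; apply: dnbhs0_le; rewrite divr_gt0// ltr_wpDl.
  by rewrite mulrCA ler_piMr ?(ltW e0)// ler_pdivrMr ?mul1r ?lerDl// ltr_wpDl.
split; first by apply/cvg_ex; exists 0.
exact: cvg_lim.
Unshelve. all: by end_near. Qed.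

Lemma is_derive_flat m (x : R) : is_derive x 1 (flat m) (- m%:R * flat m.+1 x + flat m.+2 x).
Proof.
have [x0|x0|x0] := ltgtP 0 x.
- rewrite /flat x0; apply: (@near_eq_is_derive R R R (fun y => y^-1 ^+ m * expR (- y^-1))).
    near=> y; rewrite /flat ifT//; near: y; exact: lt_nbhsr.
  have dV : is_derive x 1 (fun y : R => y^-1) (- 1 / x ^+ 2).
    by apply: is_derive1V; rewrite ?gt_eqF//; exact: is_derive_id.
  have dX := is_derive_expn m dV.
  have dE := @is_derive1_compf R expR (fun y => - y^-1) x _ _ (is_derive_expR _) (is_derive1N dV).
  apply: is_derive1_eq (is_derive1M dX dE) _; have xn : x != 0 by rewrite gt_eqF.
  by case: m {dX} => [|m]; rewrite !exprS ?expr0; move: (expR _) => E; field.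
- apply: (@near_eq_is_derive R R R (fun=> 0)).
    near=> y; rewrite /flat ifF//; apply/negbTE; rewrite -leNgt ltW//; near: y; exact: lt_nbhsl.
  apply: is_derive1_eq (is_derive1_cst x 0) _; rewrite /flat [0 < x]ltNge (ltW x0)/=.
  by rewrite mulr0 addr0.
- rewrite -x0 /flat ltxx mulr0 addr0; apply: is_derive_flat0 (flat_bound m).
  by [].
Unshelve. all: by end_near. Qed.

Lemma smooth_upto_flat k m : smooth_upto k (flat m).
Proof.
elim: k m => [|k ih] m.
  by exists (fun x => - m%:R * flat m.+1 x + flat m.+2 x) => // x; exact: is_derive_flat.
exists (fun x => - m%:R * flat m.+1 x + flat m.+2 x); first by move=> x; exact: is_derive_flat.
by apply: smooth_uptoD => //; apply: smooth_uptoM => //; exact: smooth_upto_cst.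
Qed.

(** Vanishes outside [1/4, 3/4] and is positive at 1/2, so that it detects the dissipation. *)
Definition bump (t : R) : R := flat 0 (1 * t + - (1 / 4)) * flat 0 (-1 * t + 3 / 4).

Lemma test_function_bump : test_function (fun z : R * (R * R) => bump z.1).
Proof.
split=> [k|t j x //|].
  by apply: is_Ck_time; apply: smooth_uptoM; apply: smooth_upto_affine; exact: smooth_upto_flat.
exists (1 / 4), (3 / 4); split; [lra|lra|move=> t x].
rewrite negb_and -!ltNge => /orP[h|h]; rewrite /bump /flat /=.
  by rewrite ifF ?mul0r//; apply/negbTE; rewrite -leNgt; lra.
by rewrite [X in _ * X]ifF ?mulr0//; apply/negbTE; rewrite -leNgt; lra.
Qed.

Lemma bump_half : 0 < bump (1 / 2).
Proof.
rewrite /bump /flat !ifT; [|lra|lra].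
by rewrite !expr0 !mul1r mulr_gt0// expR_gt0.
Qed.

End smooth_functions.

(** * The dissipation as a nonzero negative Radon measure *)

Section dissipation_measure.
Context (R : realType).

Definition embed_half (w : plane R) : R_plane R := (1 / 2, w).

Lemma measurable_embed_half : measurable_fun [set: plane R] embed_half.
Proof. exact: (@measurable_pair1 _ _ (measurableTypeR R) (plane R)). Qed.

Definition half_pushforward : {measure set (R_plane R) -> \bar R} :=
  measure_function_pushforward__canonical__measure_function_Measure (@leb2 R) measurable_embed_half.

(** The area of the cell placed on the slice t = 1/2, which is minus the dissipation. *)
Definition half_measure : {measure set (R_plane R) -> \bar R} :=
  mrestr half_pushforward (@measurable_spacetime R).

Lemma half_measureE (A : set (R_plane R)) :
  half_measure A = leb2 ([set w | A (1 / 2, w)] `&` @cell R).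
Proof.
rewrite /half_measure /= /mrestr /pushforward; congr (leb2 _).
apply/seteqP; split=> w /=; first by move=> [Aw [_ cw]].
by move=> [Aw cw]; split=> //; split=> //=; rewrite in_itv/=; lra.
Qed.

Lemma negative_Radon_half (D : (R * (R * R) -> R) -> R) :
  (forall phi, test_function phi -> D phi = - \int[@leb2 R]_(w in @cell R) phi (1 / 2, w)) ->
  negative_Radon_supported_on D ([set 1 / 2] `*` @cell R).
Proof.
move=> DE; exists half_measure; split.
- split.
    rewrite half_measureE (_ : _ `&` _ = set0) ?measure0//; apply/seteqP; split=> // w [/= h cw].
    by apply: h; split=> //=; rewrite in_itv/=; lra.
  move=> a b _ _; rewrite half_measureE; apply: le_lt_trans (@leb2_cell_lty R).
  apply: le_measure; rewrite ?inE; [|exact: measurable_cell|by move=> w []].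
  apply: measurableI; last exact: measurable_cell.
  rewrite -[X in measurable X]setTI; apply: measurable_embed_half => //.
  by apply: measurableX; [exact: measurable_itv|exact: measurable_cell].
- move=> phi tphi; rewrite (DE _ tphi); congr (- _).
  have cphi := test_function_continuous tphi.
  have ms := @measurable_spacetime R.
  have pre : embed_half @^-1` @spacetime R = @cell R.
    apply/seteqP; split=> w /=; first by move=> [].
    by move=> cw; split=> //=; rewrite in_itv/=; lra.
  rewrite /Rintegral; congr fine.
  rewrite (@eq_measure_integral _ _ _ _ half_pushforward); last first.
    by move=> A mA As; rewrite /half_measure /= /mrestr setIidl.
  rewrite (integral_pushforward measurable_embed_half)//.
  + by rewrite pre.
  + by apply/measurable_EFinP; exact: measurable_continuous3.
  + by rewrite pre; exact: (integrable_cell (continuous_pairr cphi)).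
move=> A mA; rewrite !half_measureE; congr (leb2 _).
by apply/seteqP; split=> w /= [] => [[Aw _] cw|Aw cw].
Qed.

Lemma nonzero_half (D : (R * (R * R) -> R) -> R) :
  (forall phi, test_function phi -> D phi = - \int[@leb2 R]_(w in @cell R) phi (1 / 2, w)) ->
  nonzero_distribution D.
Proof.
move=> DE; exists (fun z => bump z.1); first exact: test_function_bump.
rewrite DE; last exact: test_function_bump.
have -> : \int[@leb2 R]_(w in @cell R) bump (1 / 2) = bump (1 / 2) * Num.sqrt 2.
  apply: etrans (Rintegral_cst (@leb2 R) (@measurable_cell R) _) _; congr (_ * _).
  exact: (f_equal fine (@leb2_cell R)).
apply/eqP; rewrite oppr_eq0 mulf_neq0// gt_eqF ?bump_half//; exact: sqrt2_gt0.
Qed.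

End dissipation_measure.

(** * The slice has Hausdorff dimension 2 *)

Section hausdorff_dimension.
Context (R : realType).
Local Notation dist := (@spacetime_dist R).
Local Notation S := ([set 1 / 2 : R] `*` @cell R).

Lemma torus_norm_le (l : R * R) : torus_norm l <= `|l.1| + `|l.2|.
Proof.
apply: (@le_trans _ _ (Num.sqrt (l.1 ^+ 2 + l.2 ^+ 2))).
  apply: ge_inf; first by exists 0 => _ [k _ <-]; exact: sqrtr_ge0.
  by exists (0, 0) => //; rewrite /shift /= !mulr0 !addr0.
rewrite -[leRHS]ger0_norm ?addr_ge0// -sqrtr_sqr ler_wsqrtr//.
rewrite -(real_normK (num_real l.1)) -(real_normK (num_real l.2)).
by have := normr_ge0 l.1; have := normr_ge0 l.2; move: `|l.1| `|l.2| => a b; nra.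
Qed.

Lemma spacetime_dist_le (t x y x' y' : R) :
  dist (t, (x, y)) (t, (x', y')) <= `|x - x'| + `|y - y'|.
Proof.
rewrite /spacetime_dist /= subrr expr0n /= add0r sqrtr_sqr ger0_norm ?torus_norm_ge0//.
exact: torus_norm_le.
Qed.

(* Two points of a small square see each other directly, not around the torus. *)
Lemma spacetime_dist_ge (t x y x' y' : R) : 0 <= x <= 1 / 4 -> 0 <= y <= 1 / 4 ->
  0 <= x' <= 1 / 4 -> 0 <= y' <= 1 / 4 ->
  `|x - x'| <= dist (t, (x, y)) (t, (x', y')) /\ `|y - y'| <= dist (t, (x, y)) (t, (x', y')).
Proof.
move=> xb yb xb' yb'; rewrite /spacetime_dist /= subrr expr0n /= add0r sqrtr_sqr (ger0_norm (torus_norm_ge0 _)).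
have /andP[s1 s2] := @sqrt2_bounds R.
have far (P d : R) (k : int) : 1 <= P -> `|d| <= 1 / 4 -> `|d| <= `|d + P * k%:~R|.
  move=> P1 d4; have [->|k0] := eqVneq k 0; first by rewrite mulr0 addr0.
  have k1 : 1 <= `|k%:~R : R|.
    by rewrite -intr_norm ler1z -gtz0_ge1 normr_gt0.
  have P0 : 0 <= P by lra.
  have h : P * `|k%:~R| - `|d| <= `|d + P * k%:~R|.
    by rewrite [d + _]addrC -{1}(ger0_norm P0) -normrM; exact: lerB_normD.
  have : 1 * 1 <= P * `|k%:~R : R| by apply: ler_pM.
  by move: h d4; move: (P * `|k%:~R|) => X; lra.
have dx : `|x - x'| <= 1 / 4 by rewrite ler_norml; apply/andP; split; lra.
have dy : `|y - y'| <= 1 / 4 by rewrite ler_norml; apply/andP; split; lra.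
split; rewrite -[torus_norm _]mul1r; apply: torus_norm_lb => // k; rewrite mul1r.
  apply: le_trans (far _ _ k.1 s1 dx) _.
  by rewrite -sqrtr_sqr ler_wsqrtr// lerDl sqr_ge0.
apply: le_trans (far 1 _ k.2 _ dy) _ => //.
by rewrite mul1r -sqrtr_sqr ler_wsqrtr// lerDr sqr_ge0.
Qed.

Lemma ediam_ge0 (U : set (R * (R * R))) : (0 <= ediam dist U)%E.
Proof. by apply: ereal_sup_ubound; left. Qed.

Lemma ediam_le (U : set (R * (R * R))) (h : R) : 0 <= h ->
  (forall z w, U z -> U w -> dist z w <= h) -> (ediam dist U <= h%:E)%E.
Proof.
move=> h0 Uh; apply: ge_ereal_sup => _ [->|[[z w] [/= Uz Uw] <-]]; first by rewrite lee_fin.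
by rewrite lee_fin; exact: Uh.
Qed.

Let powE_le (s h : R) (e : \bar R) : 0 < s -> (0 <= e)%E -> (e <= h%:E)%E ->
  (poweR e s <= (h `^ s)%:E)%E.
Proof.
move=> s0 e0 eh; have hin (x : \bar R) : (0 <= x)%E -> x \in `[0%E, +oo%E].
  by move=> x0; rewrite in_itv/= x0; exact: leey.
by have := gt0_ler_poweR (ltW s0) (hin _ e0) (hin _ (le_trans e0 eh)) eh.
Qed.

Lemma sum_truncated (c : R) (M N : nat) : 0 <= c ->
  \sum_(0 <= i < N) (if (i < M)%N then c else 0) <= M%:R * c.
Proof.
move=> c0; apply: (@le_trans _ _ ((minn M N)%:R * c)); last first.
  by rewrite ler_wpM2r// ler_nat geq_minl.
elim: N => [|N ih]; first by rewrite big_nil minn0 mul0r.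
rewrite big_nat_recr//=; case: ltnP => h.
  have -> : minn M N.+1 = (minn M N).+1 by lia.
  by rewrite -natr1 mulrDl mul1r lerD2r.
have -> : minn M N.+1 = minn M N by lia.
  by rewrite addr0.
Qed.

(** The cell lies in [0, 2)^2, which splits into 4 M^2 squares of side 1/M, each of diameter at most
    2/M. *)
Lemma content_grid (s : R) (M : nat) : 0 < s -> (0 < M)%N ->
  (hausdorff_content dist s (2 / M%:R) S <=
    ((4 * M ^ 2)%N%:R * (2 / M%:R) `^ s)%:E)%E.
Proof.
move=> s0 M0; have Mp : 0 < M%:R :> R by rewrite ltr0n.
set h : R := 2 / M%:R; have h0 : 0 <= h by rewrite divr_ge0// ltW.
(* The index encodes column and row by division by 2 M; from 4 M^2 on the sets are empty and
   contribute 0. *)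
pose U i := [set z : R * (R * R) | [/\ (i < 4 * M ^ 2)%N, z.1 = 1 / 2,
  (i %% M.*2)%:R <= z.2.1 * M%:R < (i %% M.*2).+1%:R &
  (i %/ M.*2)%:R <= z.2.2 * M%:R < (i %/ M.*2).+1%:R]].
have dU i : (ediam dist (U i) <= h%:E)%E.
  apply: ediam_le => // -[t [x y]] [t' [x' y']] [_ /= -> x1 y1] [_ /= -> x2 y2].
  apply: le_trans (spacetime_dist_le _ _ _ _ _) _.
  have close (a b : R) m : m%:R <= a * M%:R < m.+1%:R -> m%:R <= b * M%:R < m.+1%:R ->
      `|a - b| <= M%:R^-1.
    rewrite -natr1 => ab bb; rewrite -[_^-1]mul1r ler_pdivlMr// -[X in _ * X <= _](gtr0_norm Mp) -normrM mulrBl.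
    by rewrite ler_norml; apply/andP; split; lra.
  have := close _ _ _ x1 x2; have := close _ _ _ y1 y2; rewrite /h.
  by have -> : 2 / M%:R = M%:R^-1 + M%:R^-1 :> R by [ring]; lra.
apply: ereal_inf_le; exists (\sum_(0 <= i <oo) poweR (ediam dist (U i)) s)%E.
  exists U => //; split=> // -[t [x y]] [/= -> cxy].
  have /andP[s1 s2] := @sqrt2_bounds R.
  have [x0 x2 y0 y2] : [/\ 0 <= x, x < 2, 0 <= y & y < 2].
    by case: cxy; rewrite /= !in_itv/= => /andP[? ?] /andP[? ?]; split; lra.
  have := truncn_itv (_ : 0 <= x * M%:R); have := truncn_itv (_ : 0 <= y * M%:R).
  rewrite !mulr_ge0 ?(ltW Mp)// => /(_ isT) hy /(_ isT) hx.
  move: (Num.trunc (x * M%:R)) (Num.trunc (y * M%:R)) hx hy => a b hx hy.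
  have small (c : R) m : c < 2 -> m%:R <= c * M%:R < m.+1%:R -> (m < M.*2)%N.
    move=> c2 /andP[h1 _]; rewrite -(ltr_nat R) (le_lt_trans h1)// -mul2n natrM.
    by rewrite ltr_pM2r.
  have aM := small _ _ x2 hx; have bM := small _ _ y2 hy.
  have M2 : (0 < M.*2)%N by rewrite double_gt0.
  exists (b * M.*2 + a)%N => //; rewrite /U /= modnMDl modn_small// divnMDl// divn_small// addn0.
  split=> //; apply: (@leq_trans (b.+1 * M.*2)%N); first by rewrite mulSn addnC ltn_add2r.
  rewrite (_ : (4 * M ^ 2)%N = (M.*2 * M.*2)%N) ?leq_mul2r ?bM ?orbT//.
  by rewrite -mul2n -mulnn mulnACA.
apply: lime_le; first by apply: is_cvg_nneseries => n _ _; exact: poweR_ge0.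
apply: nearW => N; apply: (@le_trans _ _ (\sum_(0 <= i < N) if (i < 4 * M ^ 2)%N then h `^ s else 0)%:E).
  rewrite -sumEFin; apply: lee_sum => i _; case: ltnP => im.
    exact: powE_le (ediam_ge0 _) (dU i).
  have -> : U i = set0 by apply/seteqP; split=> // z []; rewrite ltnNge im.
  rewrite (_ : ediam dist set0 = 0%E) ?poweR0r ?gt_eqF//; apply/eqP.
  by rewrite eq_le ediam_ge0 andbT; apply: ediam_le.
by rewrite lee_fin; apply: sum_truncated; exact: powR_ge0.
Qed.

Lemma content_ge0 (s d : R) : (0 <= hausdorff_content dist s d S)%E.
Proof.
apply/ereal_infP => _ [U _ <-]; apply: nneseries_ge0 => n _ _; exact: poweR_ge0.
Qed.

(** The grid sum 4 M^2 (2/M)^s equals 16 (2/M)^(s-2), which tends to 0. *)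
Lemma hausdorff_measure_gt2 (s : R) : 2 < s -> hausdorff_measure dist s S = 0%E.
Proof.
move=> s2; have s0 : 0 < s by lra.
have c0 d : 0 < d -> hausdorff_content dist s d S = 0%E.
  move=> d0; apply/eqP; rewrite eq_le content_ge0 andbT.
  apply/lee_addgt0Pr => e e0; rewrite add0e.
  have cu : 2 / n.+1%:R @[n --> \oo] --> (0 : R).
    by rewrite -[X in _ --> X](mulr0 2); apply: cvgMr; exact: cvg_harmonic.
  have cp : 16 * (2 / n.+1%:R) `^ (s - 2) @[n --> \oo] --> (0 : R).
    rewrite -[X in _ --> X](mulr0 16); apply: cvgMr; apply: cvg_powR0 => //; first by rewrite subr_gt0.
  have n1 : \forall n \near \oo, 2 / n.+1%:R <= d by exact: (cvgr_le _ cu d d0).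
  have n2 : \forall n \near \oo, 16 * (2 / n.+1%:R) `^ (s - 2) <= e by exact: (cvgr_le _ cp e e0).
  have [n [h1 h2]] := filter_ex (filterI n1 n2).
  apply: (@le_trans _ _ (hausdorff_content dist s (2 / n.+1%:R) S)).
    apply: ereal_inf_le_tmp => _ [U [SU dU] <-]; exists U => //; split=> // i.
    by apply: le_trans (dU i) _; rewrite lee_fin.
  apply: le_trans (content_grid s0 (ltn0Sn n)) _; rewrite lee_fin.
  apply: le_trans h2; rewrite le_eqVlt; apply/orP; left; apply/eqP.
  have p : 0 < 2 / n.+1%:R :> R by rewrite divr_gt0.
  rewrite -[in LHS](subrK 2 s) [in LHS]powRD; last by rewrite (gt_eqF p) implybT.
  rewrite (powR_mulrn 2) ?ltW// natrM natrX; move: (_ `^ _) => w.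
  by field.
apply/eqP; rewrite eq_le; apply/andP; split.
  by apply: ge_ereal_sup => _ [d d0 <-]; rewrite (c0 d d0).
by rewrite -(c0 1 ltr01); apply: ereal_sup_ubound; exists 1 => /=.
Qed.

(* Mass distribution principle for Lebesgue measure on a small square. *)
Lemma hausdorff_measure_lt2 (s : R) : 0 < s -> s < 2 -> hausdorff_measure dist s S <> 0%E.
Proof.
move=> s0 s2 H0.
(* The square [Q] has area 1/16, and a set of diameter d <= 1 meets it inside a square of area 4 d^2
   <= 4 d^s; hence a covering sum is at least 1/64. *)
have : (hausdorff_content dist s 1 S < (1 / 64)%:E)%E.
  apply: (@le_lt_trans _ _ 0%E); last by rewrite lte_fin.
  by rewrite -H0; apply: ereal_sup_ubound; exists 1 => //=.
move=> /ereal_inf_lt[_ [U [SU dU] <-]] sumU.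
pose d i := fine (ediam dist (U i)).
have dE i : ediam dist (U i) = (d i)%:E.
  by rewrite fineK// ge0_fin_numE ?ediam_ge0// (le_lt_trans (dU i)) ?ltry.
have d0 i : 0 <= d i by apply: fine_ge0; exact: ediam_ge0.
have d1 i : d i <= 1 by rewrite -lee_fin -dE.
pose Q : set (plane R) := `[0, 1 / 4]%classic `*` `[0, 1 / 4]%classic.
(* [p] is a point of [Q] on the trace of [U i]; when there is none, any value does. *)
have /choice[p hp] : forall i, exists p : R * R, forall x y, Q (x, y) ->
    U i (1 / 2, (x, y)) -> `|x - p.1| <= d i /\ `|y - p.2| <= d i.
  move=> i; have [[[a b] [Qp Up]]|np] := pselect (exists p, Q p /\ U i (1 / 2, p)); last first.
    by exists (0, 0) => x y Qx Ux; exfalso; apply: np; exists (x, y).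
  exists (a, b) => x y Qx Ux; move: Qp Qx; rewrite /Q /= !in_itv/= => -[a4 b4] [x4 y4].
  have [h1 h2] := spacetime_dist_ge (1 / 2) x4 y4 a4 b4.
  have h : dist (1 / 2, (x, y)) (1 / 2, (a, b)) <= d i.
    rewrite -lee_fin -dE; apply: ereal_sup_ubound; right.
    by exists ((1 / 2, (x, y)), (1 / 2, (a, b))).
  by split; [exact: le_trans h1 h|exact: le_trans h2 h].
pose B i : set (plane R) := `[(p i).1 - d i, (p i).1 + d i]%classic `*`
  `[(p i).2 - d i, (p i).2 + d i]%classic.
have mB i : measurable (B i) by apply: measurableX; exact: measurable_itv.
have mQ : measurable Q by apply: measurableX; exact: measurable_itv.
have QB : Q `<=` \bigcup_i B i.
  move=> [x y] Qxy; have /SU[i _ Ui] : S (1 / 2, (x, y)).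
    split=> //; move: Qxy; rewrite /Q /cell /= !in_itv/= => -[x4 y4].
    have /andP[s1 _] := @sqrt2_bounds R; split; apply/andP; split; lra.
  have [] := hp i x y Qxy Ui; rewrite !ler_distl => hx hy.
  by exists i => //; split; rewrite /= in_itv/=; lra.
have rect (I J : set (measurableTypeR R)) (a b : R) : measurable I -> measurable J ->
    lebesgue_measure I = a%:E -> lebesgue_measure J = b%:E -> leb2 (I `*` J) = (a * b)%:E.
  move=> mI mJ Ia Jb; rewrite EFinM -Ia -Jb.
  exact: (product_measure1E (@lebesgue_measure R) (@lebesgue_measure R) mI mJ).
have lB i : (leb2 (B i) = (4 * d i ^+ 2)%:E)%E.
  have itvE (a : R) : lebesgue_measure (`[a - d i, a + d i]%classic : set (measurableTypeR R)) = (2 * d i)%:E.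
    rewrite lebesgue_measure_itv/= lte_fin; case: ltP => h; last first.
      by congr (_%:E); have := d0 i; lra.
    by rewrite -EFinB; congr (_%:E); ring.
  apply: etrans (rect _ _ _ _ (measurable_itv _) (measurable_itv _) (itvE _) (itvE _)) _.
  by congr (_%:E); ring.
have lQ : (leb2 Q = (1 / 16)%:E)%E.
  have h : lebesgue_measure (`[0, 1 / 4]%classic : set (measurableTypeR R)) = (1 / 4)%:E.
    by rewrite lebesgue_measure_itv/= lte_fin ifT ?oppr0 ?adde0//; lra.
  apply: etrans (rect _ _ _ _ (measurable_itv _) (measurable_itv _) h h) _.
  by congr (_%:E); field.
have : ((1 / 16)%:E <= 4%:E * \sum_(0 <= i <oo) poweR (ediam dist (U i)) s)%E.
  have sub := @measure_sigma_subadditive _ R _ (@leb2 R) Q B mB mQ QB.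
  rewrite -lQ; apply: le_trans sub _.
  rewrite -nneseriesZl; last by move=> i _; exact: poweR_ge0.
  apply: lee_nneseries => [i _ _|i _]; first exact: measure_ge0.
  rewrite [leLHS]lB EFinM lee_wpmul2l// ?lee_fin//.
  rewrite dE poweR_EFin lee_fin; have [->|dn] := eqVneq (d i) 0; first by rewrite expr0n/= powR_ge0.
  rewrite -powR_mulrn//; apply: ger_powR; last exact: ltW.
  by rewrite d1 andbT lt_neqAle eq_sym dn d0.
apply/negP; rewrite -ltNge; apply: lt_le_trans (_ : 4%:E * (1 / 64)%:E <= _)%E.
  by rewrite lte_pmul2l// lte_fin.
by rewrite -EFinM lee_fin; lra.
Qed.

Theorem hausdorff_dim_half : hausdorff_dim dist S = 2%:E.
Proof.
apply/eqP; rewrite eq_le; apply/andP; split.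
  apply/lee_addgt0Pr => e e0; apply: ereal_inf_lbound; exists (2 + e); last by rewrite EFinD.
  by split; [lra|apply: hausdorff_measure_gt2; lra].
apply/ereal_infP => _ [s [s0 Hs] <-]; rewrite lee_fin leNgt; apply/negP => s2.
exact: (hausdorff_measure_lt2 s0 s2 Hs).
Qed.

End hausdorff_dimension.

(** * Choice of the parameters and conclusion *)

Lemma gt1_ltr_powR (R : realType) (a x y : R) : 1 < a -> x < y -> a `^ x < a `^ y.
Proof.
move=> a1 xy; have a0 : 0 < a by apply: lt_trans a1.
by rewrite /powR gt_eqF// ltr_expR ltr_pM2r// ln_gt0.
Qed.

(** For q infinite the right-hand side is 0, against a nonnegative left-hand side; for finite q the
    condition is beta q < 1 - sigma. *)
Lemma exponent_condition (R : realType) (q : \bar R) (sigma beta : R) :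
  (1 <= q)%E -> sigma < 1 -> 0 < beta ->
  ((2 * beta / (1 - sigma))%:E < 1 - (1 - 2%:E / q - 1 / +oo) * (3 - 2))%E ->
  exists r : R, [/\ q = r%:E, 0 < r & beta * r < 1 - sigma].
Proof.
move=> hq s1 b0.
have -> : (3 - 2 = 1 :> \bar R)%E by rewrite -EFinB; congr (_%:E); ring.
rewrite mule1 invey mule0 sube0; case: q hq => [r| |] //= hq; last first.
  rewrite -EFinD lte_fin mulr0 subr0 subrr ltNge => /negP[].
  by rewrite divr_ge0 ?mulr_ge0 ?(ltW b0)// subr_ge0 ltW.
have r0 : 0 < r by rewrite lee_fin in hq; lra.
rewrite inver gt_eqF// -EFinM -!EFinB lte_fin => h; exists r; split=> //.
have d : 0 < 1 - sigma by rewrite subr_gt0.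
move: h; rewrite ltr_pdivrMr// => h.
have : 2 * beta * r < (1 - (1 - 2 / r)) * (1 - sigma) * r by rewrite ltr_pM2r.
have -> : (1 - (1 - 2 / r)) * (1 - sigma) * r = 2 * (1 - sigma) by field; rewrite gt_eqF.
lra.
Qed.


Theorem theorem1p12 (R : realType) (q : \bar R) (sigma beta : R)
  (hq : (1 <= q)%E)
  (hsigma : 0 < sigma < 1) (hbeta : 0 < beta < 1)
  (hcond : ((2 * beta / (1 - sigma))%:E
              < 1 - (1 - 2%:E / q - 1 / +oo) * (3 - 2))%E) :
  exists (u : R -> R * R -> R * R) (theta : R -> R * R -> R),
    [/\ Lq_besov +oo%E sigma +oo%E (fun t x => (u t x).1)
        /\ Lq_besov +oo%E sigma +oo%E (fun t x => (u t x).2),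
        div_free u,
        Lq_besov q beta q theta,
        solves_transport u theta
      & let S := [set 1 / 2] `*` @cell R in
        let D := dissipation u theta in
        [/\ transport_defined u (fun t x => theta t x ^+ 2),
            nonzero_distribution D,
            negative_Radon_supported_on D S
          & hausdorff_dim (@spacetime_dist R) S = 2%:E]].
Proof.
case/andP: hsigma => s0 s1; case/andP: hbeta => b0 b1.
have [r [qE r0 br]] := exponent_condition hq s1 b0 hcond; subst q.
(* [gam] is the growth of the frequencies per stage, and [rho] is chosen so that the Hoelder norm of
   order sigma of the velocity neither grows nor decays with the stage. *)
pose gam : R := 2 `^ (1 / 4); pose rho : R := gam `^ (- (1 - sigma)).
have gam4 : gam ^+ 4 = 2 by rewrite -powR_mulrn ?powR_ge0// -powRrM divfK// powRr1.
have gam1 : 1 < gam by rewrite -[ltLHS](powRr0 2); apply: gt1_ltr_powR; lra.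
have gp : 0 < gam by apply: lt_trans gam1.
have gamD x y : gam `^ x * gam `^ y = gam `^ (x + y) by rewrite powRD// (gt_eqF gp) implybT.
have rho_gam : rho * gam `^ (1 - sigma) = 1 by rewrite gamD addNr powRr0.
have rho01 : 0 < rho < 1.
  by rewrite powR_gt0//= -[ltRHS](powRr0 gam); apply: gt1_ltr_powR; lra.
have rho_gam1 : 1 <= rho * gam.
  rewrite -[X in _ * X](powRr1 (ltW gp)) gamD.
  by rewrite -[leLHS](powRr0 gam); apply: ler_powR; lra.
(* The exponent of gam is beta r - (1 - sigma), negative by hypothesis. *)
have decay : rho * gam `^ (beta * r) < 1.
  rewrite gamD -[ltRHS](powRr0 gam).
  by apply: gt1_ltr_powR => //; lra.
(* The flatness must be at least 1 / (1 - sigma) to absorb the singularity at the change of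
   topology. *)
pose g := (Num.trunc (1 - sigma)^-1).+1.
have gs : 1 <= g%:R * (1 - sigma).
  by rewrite -ler_pdivrMr ?subr_gt0// mul1r ltW// truncnS_gt.
have g0 : (0 < g)%N by [].
have hs : 0 < sigma < 1 by rewrite s0.
have br1 : beta * r < 1 by lra.
have DE := dissipation_theta rho01 g0 gam1 gam4 rho_gam1.
exists (vel rho g), (theta rho g); split.
- by split; [exact: vel1_Lq_besov hs gam1 gam4 rho_gam gs|exact: vel2_Lq_besov hs gam1 gam4 rho_gam gs].
- exact: vel_div_free rho01 g0 gam1 gam4 rho_gam1.
- exact: (theta_Lq_besov g rho01 gam1 gam4 r0 b0 br1 decay).
- exact: theta_solves rho01 g0 gam1 gam4 rho_gam1.
split.
- apply: (transport_defined_bounded rho01 g0 gam1 gam4 rho_gam1).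
    by apply: measurable_realfun.measurable_funX; exact: measurable_theta.
  by move=> t x; rewrite theta_sqr; case: active; rewrite ?normr1 ?normr0.
- exact: nonzero_half DE.
- exact: negative_Radon_half DE.
- exact: hausdorff_dim_half.
Qed.
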